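(* Let $\Omega\subseteq\mathbb{R}^N$ be a nonempty open set, let $V\in L^\infty_{\mathrm{loc}}(\Omega;\mathbb{R})$, let $0<m<1$ and let $(a,b,c)\in\mathbb{C}^3$ satisfy one of the three following conditions. 1) $a\neq0$, $\mathrm{Re}(a)\ge0$, $\mathrm{Re}(a\overline b)\ge0$ and $\mathrm{Re}(a\overline c)\ge0$. 2) $b\neq0$, $\mathrm{Re}(b)\ge0$, $a=kb$ for some $k\ge0$, and $\mathrm{Re}(b\overline c)\ge0$. 3) $c\neq0$, $\mathrm{Re}(c)\ge0$, $a=kc$ for some $k>0$, and $\mathrm{Re}(b\overline c)\ge0$. Let $F\in L^1_{\mathrm{loc}}(\Omega)$. If $u_1,u_2\in H^1(\Omega)\cap L^{m+1}(\Omega)$ are two solutions of $$-\Delta u+a|u|^{-(1-m)}u+bu+cV^2u=F$$ with the same boundary condition, either homogeneous Dirichlet $u_{|\Gamma}=0$ or homogeneous Neumann $\frac{\partial u}{\partial\nu}_{|\Gamma}=0$ (in the Neumann case $\Omega$ is additionally assumed to have a $C^1$ boundary), and if $Vu_1,Vu_2\in L^2(\Omega)$, then $u_1=u_2$.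
   Context: All functions are complex-valued unless indicated otherwise; $\Gamma$ is the boundary of $\Omega$ and $\nu$ its outward unit normal. The expression $|u|^{-(1-m)}u$ is understood to be $0$ where $u=0$. The equation is understood in the sense of distributions on $\Omega$. The Dirichlet condition means $u\in H^1_0(\Omega)$. The Neumann condition is understood weakly: put $X=\{v\in H^1(\Omega)\cap L^{m+1}(\Omega);\ Vv\in L^2(\Omega)\}$; $F$ is understood to act as a real-linear functional $v\mapsto\langle F,v\rangle$ on $X$ (the same functional for $u_1$ and $u_2$, equal to $\mathrm{Re}\int_\Omega F\overline v\,dx$ for $v\in C^\infty_c(\Omega)$), and $u$ satisfies the equation with the Neumann condition if $$\mathrm{Re}\int_\Omega\nabla u\cdot\overline{\nabla v}\,dx+\mathrm{Re}\int_\Omega\big(a|u|^{-(1-m)}u+bu\big)\overline v\,dx+\mathrm{Re}\Big(c\int_\Omega Vu\,\overline{Vv}\,dx\Big)=\langle F,v\rangle\quad\text{for all }v\in X.$$ *)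

(* Defs.v *)
From HB Require Import structures.
From mathcomp Require Import all_boot all_order all_algebra.
From mathcomp Require Import all_classical all_reals all_analysis.
From mathcomp Require Import complex.

Set Implicit Arguments.
Unset Strict Implicit.
Unset Printing Implicit Defensive.

Import Order.TTheory GRing.Theory Num.Theory.
Import numFieldNormedType.Exports.

Local Open Scope classical_set_scope.
Local Open Scope ring_scope.

(* R^n is 'rV[R]_n. It is given the product sigma-algebra, i.e. the Borel
   sigma-algebra. *)
Definition rV_display : measure_display. Proof. exact default_measure_display. Qed.

Section rV_measurable.
Context {R : realType} (n : nat).

Let coors : 'I_n -> 'rV[R]_n -> measurableTypeR R := fun i x => x ord0 i.

Let rV_set0 : g_sigma_preimage coors set0.
Proof. exact: sigma_algebra0. Qed.

Let rV_setC A : g_sigma_preimage coors A -> g_sigma_preimage coors (~` A).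
Proof. exact: sigma_algebraC. Qed.

Let rV_bigcup (F : _^nat) : (forall i, g_sigma_preimage coors (F i)) ->
  g_sigma_preimage coors (\bigcup_i (F i)).
Proof. exact: sigma_algebra_bigcup. Qed.

HB.instance Definition _ := @isMeasurable.Build rV_display
  'rV[R]_n (g_sigma_preimage coors) rV_set0 rV_setC rV_bigcup.

Lemma measurable_coord_rV (i : 'I_n) :
  measurable_fun [set: 'rV[R]_n] (fun x => x ord0 i : measurableTypeR R).
Proof.
move=> _ Y mY; rewrite setTI; apply: sub_sigma_algebra.
rewrite -bigcup_seq/=; exists i => /=; first by rewrite mem_index_enum.
by exists Y => //; rewrite setTI.
Qed.

Lemma measurable_fun_rV d (T : measurableType d) (f : T -> 'rV[R]_n) :
  (forall i, measurable_fun setT (fun t => f t ord0 i : measurableTypeR R)) ->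
  measurable_fun setT f.
Proof.
move=> mf; pose G := \big[setU/set0]_(i < n)
  preimage_set_system setT (coors i) measurable.
apply: (@measurability _ _ _ _ setT f G) => // _ [A + <-].
rewrite setTI /G -bigcup_seq/= => -[i _ [B mB <-]].
by rewrite setTI -[X in measurable X]setTI; exact: mf.
Qed.

End rV_measurable.

Section lebesgue_rV_step.
Local Open Scope ereal_scope.
Context {R : realType} (n : nat).

Definition rVcons (p : measurableTypeR R * 'rV[R]_n) : 'rV[R]_n.+1 :=
  \row_i oapp (fun j => p.2 ord0 j) p.1 (unlift ord0 i).

Lemma measurable_rVcons : measurable_fun setT rVcons.
Proof.
apply: measurable_fun_rV => i.
case: (unliftP ord0 i) => [j|] ->.
- rewrite (_ : (fun _ => _) =
      (fun x : 'rV[R]_n => x ord0 j : measurableTypeR R) \o snd).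
    by apply: measurableT_comp; [exact: measurable_coord_rV|exact: measurable_snd].
  by apply/funext => p; rewrite /= mxE liftK.
- rewrite (_ : (fun _ => _) = fst); first exact: measurable_fst.
  by apply/funext => p; rewrite /= mxE unlift_none.
Qed.

Variable m : {sigma_finite_measure set 'rV[R]_n -> \bar R}.

Definition rVcons_measure (A : set 'rV[R]_n.+1) : \bar R :=
  (@lebesgue_measure R \x m) (rVcons @^-1` A).

Let rVcons_measure0 : rVcons_measure set0 = 0.
Proof. by rewrite /rVcons_measure preimage_set0 measure0. Qed.

Let rVcons_measure_ge0 A : 0 <= rVcons_measure A.
Proof. exact: measure_ge0. Qed.

Let rVcons_measure_sigma_additive : semi_sigma_additive rVcons_measure.
Proof.
move=> F mF tF mUF; rewrite /rVcons_measure preimage_bigcup.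
apply: measure_semi_sigma_additive.
- by move=> k; rewrite -[X in measurable X]setTI; exact: measurable_rVcons.
- apply/trivIsetP => /= i j _ _ ij; rewrite -preimage_setI.
  by move/trivIsetP : tF => /(_ _ _ _ _ ij) ->//; rewrite preimage_set0.
- by rewrite -preimage_bigcup -[X in measurable X]setTI; exact: measurable_rVcons.
Qed.

HB.instance Definition _ := isMeasure.Build _ _ _ rVcons_measure
  rVcons_measure0 rVcons_measure_ge0 rVcons_measure_sigma_additive.

Let rVcons_measure_sigma_finite : sigma_finite setT rVcons_measure.
Proof.
have /sigma_finiteP[F [TF ndF Foo]] := sigma_finiteT (@lebesgue_measure R).
have /sigma_finiteP[G [TG ndG Goo]] := sigma_finiteT m.
pose unc (x : 'rV[R]_n.+1) : measurableTypeR R * 'rV[R]_n :=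
  (x ord0 ord0, \row_j x ord0 (lift ord0 j)).
have uncK : cancel rVcons unc.
  move=> [a x]; rewrite /unc /rVcons mxE unlift_none; congr (_, _).
  by apply/rowP => j; rewrite !mxE liftK.
have munc : measurable_fun setT unc.
  apply/measurable_fun_pairP; split; first exact: measurable_coord_rV.
  apply: measurable_fun_rV => i.
  rewrite (_ : (fun _ => _) = fun x : 'rV[R]_n.+1 =>
    x ord0 (lift ord0 i) : measurableTypeR R); first exact: measurable_coord_rV.
  by apply/funext => x; rewrite /= mxE.
exists (fun k => unc @^-1` (F k `*` G k)).
  apply/esym/seteqP; split => // x _ /=.
  have [k _ Fk] : (\bigcup_k F k) (unc x).1 by rewrite -TF.
  have [l _ Gl] : (\bigcup_k G k) (unc x).2 by rewrite -TG.
  exists (maxn k l) => //; split.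
  - by move: Fk; exact/subsetPset/ndF/leq_maxl.
  - by move: Gl; exact/subsetPset/ndG/leq_maxr.
move=> k; have [mF Fk] := Foo k; have [mG Gk] := Goo k; split.
  by rewrite -[X in measurable X]setTI; apply: munc => //; exact: measurableX.
rewrite /rVcons_measure -comp_preimage (_ : unc \o rVcons = id).
  by rewrite preimage_id product_measure1E// lte_mul_pinfty// ge0_fin_numE.
by apply/funext => p /=; rewrite uncK.
Qed.

HB.instance Definition _ := Measure_isSigmaFinite.Build _ _ _ rVcons_measure
  rVcons_measure_sigma_finite.

End lebesgue_rV_step.

(* The iterated product of the one-dimensional Lebesgue measure. *)
Fixpoint lebesgue_rV {R : realType} (n : nat) :
    {sigma_finite_measure set 'rV[R]_n -> \bar R} :=
  match n with
  | 0 => \d_(0 : 'rV[R]_0)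
  | n'.+1 => rVcons_measure (lebesgue_rV n')
  end.

Lemma lebesgue_rV_box {R : realType} (n : nat)
    (A : 'I_n -> set (measurableTypeR R)) : (forall i, measurable (A i)) ->
  (lebesgue_rV n [set x : 'rV[R]_n | forall i, A i (x ord0 i)] =
   \prod_(i < n) lebesgue_measure (A i))%E.
Proof.
elim: n A => [A _|n IH A mA] /=.
  by rewrite big_ord0 diracE mem_set// => -[].
rewrite big_ord_recl -(IH (fun i => A (lift ord0 i)))//.
rewrite /rVcons_measure -product_measure1E//; last first.
  rewrite (_ : [set _ | _] = \big[setI/setT]_(i < n)
    [set x : 'rV[R]_n | A (lift ord0 i) (x ord0 i)]).
    apply: bigsetI_measurable => i _; rewrite -[X in measurable X]setTI.
    by apply: measurable_coord_rV => //; exact: mA.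
  rewrite -bigcap_seq; apply/seteqP; split => x /= Ax i.
    by move=> _; exact: Ax.
  by apply: (Ax i); rewrite /= mem_index_enum.
congr (_ _); apply/seteqP; split => -[x y] /=.
  move=> h; split=> [|i /=]; first by have := h ord0; rewrite mxE unlift_none.
  by have := h (lift ord0 i); rewrite mxE liftK.
move=> [/= Ax Ay] i; rewrite mxE.
by case: (unliftP ord0 i) => [j|] -> /=.
Qed.

Local Open Scope complex_scope.
Local Notation Re := complex.Re.
Local Notation Im := complex.Im.
Local Notation normc := ComplexField.Normc.normc.

Section partial_derivatives.
Context {R : realType} {n : nat}.
Implicit Types f : 'rV[R]_n -> R.

Definition partial (i : 'I_n) f : 'rV[R]_n -> R :=
  fun x => 'D_('e_i) f x.

Definition C1 f := continuous f /\
  forall i, (forall x, derivable f x 'e_i) /\ continuous (partial i f).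

(* foldr partial f [:: i1; ..; ik] is d_{i1} .. d_{ik} f. *)
Definition smooth f := forall s : seq 'I_n,
  continuous (foldr partial f s) /\
  forall i x, derivable (foldr partial f s) x 'e_i.

Definition cpartial (i : 'I_n) (phi : 'rV[R]_n -> R[i]) : 'rV[R]_n -> R[i] :=
  fun x => partial i (fun y => Re (phi y)) x +i* partial i (fun y => Im (phi y)) x.

Definition laplacian (phi : 'rV[R]_n -> R[i]) : 'rV[R]_n -> R[i] :=
  fun x => \sum_(i < n) cpartial i (cpartial i phi) x.

(* C^infty_c(Omega; C), extended by 0 outside Omega *)
Definition test_function (Omega : set 'rV[R]_n) (phi : 'rV[R]_n -> R[i]) :=
  [/\ smooth (fun x => Re (phi x)), smooth (fun x => Im (phi x)) &
      exists K, [/\ compact K, K `<=` Omega & forall x, ~ K x -> phi x = 0]].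

End partial_derivatives.

(* Near each boundary point, and up to the choice of a coordinate axis j and of
   its orientation, Omega is the strict epigraph of a C^1 function of the n-1
   other coordinates. *)
Definition C1_boundary {R : realType} {n : nat} (Omega : set 'rV[R]_n) :=
  forall x0, (closure Omega `\` interior Omega) x0 ->
  exists (j : 'I_n) (s : bool) (gamma : 'rV[R]_n.-1 -> R), C1 gamma /\
    \forall x \near x0, Omega x <->
      (-1) ^+ s * gamma (col' j x) < (-1) ^+ s * x ord0 j.

Section function_spaces.
Context {R : realType} {n : nat} (Omega : set 'rV[R]_n).
Local Notation mu := (lebesgue_rV n).
Implicit Types u v f g : 'rV[R]_n -> R[i].

Definition cmeasurable_fun u :=
  measurable_fun Omega (fun x => Re (u x)) /\
  measurable_fun Omega (fun x => Im (u x)).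

Definition cintegral f : R[i] :=
  (\int[mu]_(x in Omega) Re (f x)) +i* (\int[mu]_(x in Omega) Im (f x)).

Definition Lp (p : R) u := cmeasurable_fun u /\
  (\int[mu]_(x in Omega) (normc (u x) `^ p)%:E < +oo)%E.

Definition L1_loc f := cmeasurable_fun f /\
  forall K, compact K -> K `<=` Omega ->
    (\int[mu]_(x in K) (normc (f x))%:E < +oo)%E.

Definition Linfty_loc (V : 'rV[R]_n -> R) := measurable_fun Omega V /\
  forall K, compact K -> K `<=` Omega ->
    exists M : R, {ae mu, forall x, K x -> `|V x| <= M}.

Definition ae_eq_on u v := {ae mu, forall x, Omega x -> u x = v x}.

Definition weak_partial (i : 'I_n) u g :=
  [/\ L1_loc u, L1_loc g &
      forall phi, test_function Omega phi ->
        cintegral (fun x => u x * cpartial i phi x) =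
        - cintegral (fun x => g x * phi x)].

(* A representative of the i-th weak partial derivative, unique up to a null
   set when it exists. *)
Definition wpartial (i : 'I_n) u : 'rV[R]_n -> R[i] :=
  xget (fun=> 0) [set g | weak_partial i u g].

Definition H1 u := Lp 2 u /\
  forall i, exists2 g, weak_partial i u g & Lp 2 g.

Definition H1_dist_sqr u v : \bar R :=
  (\int[mu]_(x in Omega) (normc (u x - v x) ^+ 2)%:E +
   \sum_(i < n) \int[mu]_(x in Omega)
     (normc (wpartial i u x - wpartial i v x) ^+ 2)%:E)%E.

Definition H10 u := H1 u /\
  forall e : R, 0 < e ->
    exists2 phi, test_function Omega phi & (H1_dist_sqr u phi < e%:E)%E.

End function_spaces.

Section equation.
Context {R : realType} {n : nat} (Omega : set 'rV[R]_n).
Variables (V : 'rV[R]_n -> R) (m : R) (a b c : R[i]).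
Implicit Types u v F : 'rV[R]_n -> R[i].

(* |z|^{-(1-m)} z; it is 0 at z = 0, whatever the value of 0 `^ (- (1 - m)). *)
Definition nonlin (z : R[i]) : R[i] := (normc z `^ (- (1 - m)))%:C * z.

Definition Vmul u : 'rV[R]_n -> R[i] := fun x => (V x)%:C * u x.

Definition spaceX v :=
  [/\ H1 Omega v, Lp Omega (m + 1) v & Lp Omega 2 (Vmul v)].

Definition distributional_solution F u :=
  forall phi, test_function Omega phi ->
    - cintegral Omega (fun x => u x * laplacian phi x) +
    cintegral Omega (fun x =>
      (a * nonlin (u x) + b * u x + c * (V x)%:C ^+ 2 * u x) * phi x) =
    cintegral Omega (fun x => F x * phi x).

Definition dirichlet_solution F u :=
  H10 Omega u /\ distributional_solution F u.

(* ell is a real-linear functional on the space X of classes modulo equality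
   almost everywhere, extending v |-> Re (int F v^* ) from test functions. *)
Definition extends_source F (ell : ('rV[R]_n -> R[i]) -> R) :=
  [/\ forall v w, spaceX v -> spaceX w -> ae_eq_on Omega v w -> ell v = ell w,
      forall v w, spaceX v -> spaceX w ->
        ell (fun x => v x + w x) = ell v + ell w,
      forall (t : R) v, spaceX v -> ell (fun x => t%:C * v x) = t * ell v &
      forall phi, test_function Omega phi ->
        ell phi = Re (cintegral Omega (fun x => F x * (phi x)^*))].

Definition neumann_solution (ell : ('rV[R]_n -> R[i]) -> R) u :=
  forall v, spaceX v ->
    Re (cintegral Omega (fun x =>
          \sum_(i < n) wpartial Omega i u x * (wpartial Omega i v x)^*)) +
    Re (cintegral Omega (fun x =>
          (a * nonlin (u x) + b * u x) * (v x)^*)) +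
    Re (c * cintegral Omega (fun x => Vmul u x * (Vmul v x)^*)) =
    ell v.

End equation.

(* Main.v *)
(* Let w = u1 - u2. In each of the three cases there is lam (namely a, b or c)
   with Re lam >= 0 such that
     E = Re (lam^* (a (f u1 - f u2) + b w + c V^2 w) w^* ),  f z = |z|^{-(1-m)} z,
   is pointwise nonnegative and vanishes only where u1 = u2, because f is strictly
   monotone. So it suffices to show that the integral of E is <= 0.

   Neumann: subtract the two equations tested with lam w; what is left besides the
   integral of E is Re lam times the integral of |grad w|^2.

   Dirichlet: let z_j be test functions converging to w in H^1. The reaction term is
   only locally integrable, so the equation cannot simply be tested with z_j and j sent to
   infinity. Instead test it with the conjugate of theta z_j, where
     theta = |z_k|^2 / (|z_j|^2 + |z_k|^2 + e),
   which is a test function bounded by |z_k|. For fixed k and e let j tend to infinity, drop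
   the term Re lam * theta |grad w|^2 >= 0, then let k tend to infinity and e to 0: theta
   tends to 1/2 where w != 0, and the terms containing grad theta tend to 0.

   Since [wpartial] is an arbitrary representative of the weak derivative, both parts use
   its uniqueness almost everywhere, i.e. the fundamental lemma of the calculus of
   variations, and, for Dirichlet, integration by parts for test functions. *)

Require Import Defs.
From mathcomp Require Import all_boot all_order all_algebra.
From mathcomp Require Import all_classical all_reals all_analysis.
From mathcomp Require Import complex.
From mathcomp Require Import measurable_realfun.
From mathcomp Require Import ring lra.

Import Order.TTheory GRing.Theory Num.Theory.
Import numFieldNormedType.Exports.

Set Implicit Arguments.
Unset Strict Implicit.
Unset Printing Implicit Defensive.

Local Open Scope classical_set_scope.
Local Open Scope ring_scope.
Local Open Scope complex_scope.

(** The Dirichlet case is shaped by one obstacle: the reaction [G] of the difference is integrable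
    against [w^*], but alone it is only in [L^1_loc], and the approximating test functions have no
    common compact support. The factor [theta] repairs this: [|z_j| |z_k|] is at most its
    denominator, so the reaction term is dominated by [|G| |z_k|], integrable for fixed [k]. The
    price is the derivative of [theta]. Its form gives [|d theta| |z_j| <= |d z_k| + 2 |d z_j|] for
    each partial derivative, with constants independent of [e], so that the cross terms are
    dominated by squares of gradients in both limits. They vanish at the end because the two halves
    of [d theta] cancel when [e = 0] and both arguments agree. A rational function of real and
    imaginary parts stays smooth, unlike a truncation, hence the equation need not be extended to a
    larger class of test functions. Dominated convergence needs integrable majorants, more than
    convergence in norm: the approximations have summable squared errors, and the sum of the series
    is the majorant. *)

Section real_integrals.
Context d (T : measurableType d) (R : realType).
Variables (mu : {measure set T -> \bar R}) (D : set T) (mD : measurable D).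
Implicit Types f g : T -> R.

Local Notation rint f := (mu.-integrable D (EFin \o f)).

Lemma rintP f : rint f <->
  measurable_fun D f /\ (\int[mu]_(x in D) `|f x|%:E < +oo)%E.
Proof.
split=> [/integrableP[mf fi]|[mf fi]]; first by split=> //; exact/measurable_EFinP.
by apply/integrableP; split => //; exact/measurable_EFinP.
Qed.

Lemma rint_measurable f : rint f -> measurable_fun D f.
Proof. by move=> /rintP[]. Qed.

Lemma rint_le f g : measurable_fun D f -> (forall x, D x -> `|f x| <= g x) ->
  rint g -> rint f.
Proof.
move=> mf fg; apply: le_integrable => //; first exact/measurable_EFinP.
by move=> x Dx /=; rewrite lee_fin (le_trans (fg x Dx))// ler_norm.
Qed.

Lemma eq_rint f g : (forall x, D x -> f x = g x) -> rint f -> rint g.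
Proof.
move=> fg; apply: eq_integrable => // x; rewrite inE => Dx /=.
by rewrite fg.
Qed.

Lemma rintD f g : rint f -> rint g -> rint (fun x => f x + g x).
Proof. by move=> fi gi; exact: (integrableD mD fi gi). Qed.

Lemma rintN f : rint f -> rint (fun x => - f x).
Proof. by move=> fi; exact: (integrableN fi). Qed.

Lemma rintB f g : rint f -> rint g -> rint (fun x => f x - g x).
Proof. by move=> fi /rintN gi; exact: rintD. Qed.

Lemma rintZ k f : rint f -> rint (fun x => k * f x).
Proof. by move=> fi; exact: (integrableZl mD k fi). Qed.

Lemma rint0 : rint (fun=> 0).
Proof. exact: integrable0. Qed.

Lemma rint_sum (I : Type) (s : seq I) (h : I -> T -> R) :
  (forall i, rint (h i)) -> rint (fun x => \sum_(i <- s) h i x).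
Proof.
move=> hi; elim: s => [|i s IH].
  by apply: eq_rint rint0 => x _; rewrite big_nil.
apply: eq_rint (rintD (hi i) IH) => x _.
by rewrite big_cons.
Qed.

Lemma rint_norm f : rint f -> rint (fun x => `|f x|).
Proof. by move=> fi; exact: (integrable_abse fi). Qed.

Lemma Rintegral_sum (I : Type) (s : seq I) (h : I -> T -> R) :
  (forall i, rint (h i)) ->
  \int[mu]_(x in D) (\sum_(i <- s) h i x) = \sum_(i <- s) \int[mu]_(x in D) h i x.
Proof.
move=> hi; elim: s => [|i s IH].
  rewrite big_nil -[RHS](mul0r (fine (mu D))) -Rintegral_cst//.
  by apply: eq_Rintegral => x _; rewrite big_nil.
rewrite big_cons -IH -RintegralD//; last exact: rint_sum.
by apply: eq_Rintegral => x _; rewrite big_cons.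
Qed.

Lemma rint_dominated_cvg (f_ : nat -> T -> R) f g :
  (forall n, measurable_fun D (f_ n)) -> measurable_fun D f ->
  {ae mu, forall x, D x -> f_ n x @[n --> \oo] --> f x} ->
  rint g -> {ae mu, forall x, forall n, D x -> `|f_ n x| <= g x} ->
  rint f /\ \int[mu]_(x in D) f_ n x @[n --> \oo] --> \int[mu]_(x in D) f x.
Proof.
move=> mf_ mf f_f gi f_g.
have [||||fi _ fl] := @dominated_convergence _ _ _ mu D mD
  (fun n => EFin \o f_ n) (EFin \o f) (EFin \o g) _ _ _ gi.
- by move=> n; exact/measurable_EFinP.
- exact/measurable_EFinP.
- apply: filterS f_f => x fx Dx /=; apply: cvg_EFin; last exact: fx.
  by apply: nearW.
- by apply: filterS f_g => x fx n Dx /=; rewrite lee_fin fx.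
split=> //; rewrite /Rintegral; apply: fine_cvg.
by rewrite fineK//; exact: integrable_fin_num.
Qed.

(** Dominated convergence accepts a bound that holds only almost everywhere; it is applied to the
    constant sequence [f]. *)
Lemma rint_le_ae f g : measurable_fun D f ->
  {ae mu, forall x, D x -> `|f x| <= g x} -> rint g -> rint f.
Proof.
move=> mf fg gi.
have fn : {ae mu, forall x, forall k : nat, D x -> `|f x| <= g x}.
  by apply: filterS fg => x h k; exact: h.
have fc : {ae mu, forall x, D x -> f x @[k --> \oo] --> f x}.
  by apply: aeW => x Dx; exact: cvg_cst.
by have [] := rint_dominated_cvg (fun=> mf) mf fc gi fn.
Qed.

(* Stands in for the passage to an a.e. convergent subsequence dominated by
   an integrable function. *)
Lemma summable_dominated (f_ : nat -> T -> R) (e : nat -> R) :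
  (forall n, measurable_fun D (f_ n)) -> (forall n x, D x -> 0 <= f_ n x) ->
  (forall n, (\int[mu]_(x in D) (f_ n x)%:E <= (e n)%:E)%E) ->
  (\sum_(n <oo) (e n)%:E < +oo)%E ->
  exists S : T -> R, [/\ rint S,
    {ae mu, forall x, forall n, D x -> f_ n x <= S x} &
    {ae mu, forall x, D x -> f_ n x @[n --> \oo] --> (0 : R)}].
Proof.
move=> mf f0 fe ey.
(* The sum of the series has a finite integral, hence is finite almost everywhere. This one fact
   gives the majorant of every term and the convergence of the terms to 0. *)
pose F x := (\sum_(n <oo) (f_ n x)%:E)%E.
have mF : measurable_fun D F.
  apply: ge0_emeasurable_sum => //.
  - by move=> k x Dx _; rewrite lee_fin f0.
  - by move=> k _; exact/measurable_EFinP.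
have F0 x : D x -> (0 <= F x)%E.
  by move=> Dx; apply: nneseries_ge0 => n _ _; rewrite lee_fin f0.
have Fi : mu.-integrable D F.
  apply/integrableP; split => //.
  under eq_integral => x do [rewrite inE => Dx; rewrite gee0_abs; last exact: F0].
  rewrite (integral_nneseries mu mD) => [|n|n x Dx]; last 2 first.
  - exact/measurable_EFinP.
  - by rewrite lee_fin f0.
  apply: le_lt_trans ey; apply: lee_nneseries => // n _ _.
  by apply: integral_ge0 => x Dx; rewrite lee_fin f0.
have Ffin := integrable_ae mD Fi.
exists (fine \o F); split.
- apply/rintP; split; first exact: measurableT_comp.
  move/integrableP : Fi => [_]; apply: le_lt_trans.
  apply: ge0_le_integral => //=.
  + apply/measurable_EFinP/measurableT_comp => //; exact: measurableT_comp.
  + exact: measurableT_comp.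
  + by move=> x Dx; case: (F x) => [r| |] //=; rewrite ?normr0 leey.
- apply: filterS Ffin => x Fx n Dx; rewrite -lee_fin fineK//; last exact: Fx.
  apply: le_trans (nneseries_lim_ge n.+1 _); last by move=> k _; rewrite lee_fin f0.
  rewrite big_nat_recr//= leeDr// sume_ge0// => k _; by rewrite lee_fin f0.
- apply: filterS Ffin => x Fx Dx.
  apply: cvg_series_cvg_0; apply: nondecreasing_is_cvgn.
    apply/nondecreasing_seqP => n.
    by rewrite /series/= big_nat_recr//= lerDl f0.
  exists (fine (F x)) => _ [n _ <-]; rewrite -lee_fin fineK; last exact: Fx.
  rewrite /series/= -sumEFin.
  by apply: nneseries_lim_ge => k _; rewrite lee_fin f0.
Qed.

End real_integrals.

(** * Smooth functions *)

Section continuous_arith.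
Context {R : realType} {T : topologicalType}.
Implicit Types f g : T -> R.

Lemma continuous_add f g : continuous f -> continuous g ->
  continuous (fun x => f x + g x).
Proof. by move=> cf cg x; exact: cvgD (cf x) (cg x). Qed.

Lemma continuous_mul f g : continuous f -> continuous g ->
  continuous (fun x => f x * g x).
Proof. by move=> cf cg x; exact: cvgM (cf x) (cg x). Qed.

Lemma continuous_inv f : (forall x, f x != 0) -> continuous f ->
  continuous (fun x => (f x)^-1).
Proof. by move=> f0 cf x; exact: cvgV (f0 x) (cf x). Qed.

End continuous_arith.

Section smooth_calculus.
Context {R : realType} {n : nat}.
Implicit Types f g : 'rV[R]_n -> R.

(** Iterated derivatives along a word behave badly under the product rule. Counting orders instead
    works by induction, since the derivative of a product or an inverse is built from functions of
    one order less. Order 0 demands nothing, so every base case is trivial. *)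
Fixpoint Cfun (k : nat) f : Prop := if k is k'.+1 then
  continuous f /\ forall i, (forall x, derivable f x 'e_i) /\ Cfun k' (partial i f)
  else True.

Lemma smoothE f : smooth f <-> forall k, Cfun k f.
Proof.
split=> [sf k|Cf s].
  elim: k f sf => //= k IH f sf; split; first exact: (sf [::]).1.
  move=> i; split=> [x|]; first exact: (sf [::]).2.
  by apply: IH => s; have := sf (rcons s i); rewrite foldr_rcons.
(* One order more than the length of the word, because the last derivative must still be continuous
   and derivable. The innermost derivative is the last letter, hence the induction from the right
   end. *)
have {}Cf : Cfun (size s).+1 f by exact: Cf.
elim/last_ind: s f Cf => [f /= [cf df]|s i IH f].
  by split=> // i x; exact: (df i).1.
by rewrite size_rcons foldr_rcons => -[_ /(_ i)[_ /IH]].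
Qed.

Lemma CfunW k f : Cfun k.+1 f -> Cfun k f.
Proof.
elim: k f => // k IH f [cf df]; split=> // i; split; first exact: (df i).1.
by apply: IH; exact: (df i).2.
Qed.

Lemma partial_cst i (c : R) : partial i (fun _ : 'rV[R]_n => c) = fun=> 0.
Proof. by apply/funext => x; rewrite /partial derive_cst. Qed.

Lemma Cfun_cst k (c : R) : Cfun k (fun=> c).
Proof.
elim: k c => //= k IH c; split; first exact: cst_continuous.
move=> i; split; first by move=> x; exact: derivable_cst.
by rewrite partial_cst.
Qed.

Lemma partialD i f g x : derivable f x 'e_i -> derivable g x 'e_i ->
  partial i (fun x => f x + g x) x = partial i f x + partial i g x.
Proof. by move=> df dg; rewrite /partial deriveD. Qed.

Lemma partialM i f g x : derivable f x 'e_i -> derivable g x 'e_i ->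
  partial i (fun x => f x * g x) x = f x * partial i g x + g x * partial i f x.
Proof. by move=> df dg; rewrite /partial deriveM. Qed.

Lemma partialV i f x : derivable f x 'e_i -> f x != 0 ->
  partial i (fun x => (f x)^-1) x = - ((f x)^-1 * (f x)^-1 * partial i f x).
Proof. by move=> df f0; rewrite /partial deriveV// -mulNr -expr2 exprVn. Qed.

Lemma CfunD k f g : Cfun k f -> Cfun k g -> Cfun k (fun x => f x + g x).
Proof.
elim: k f g => //= k IH f g [cf df] [cg dg]; split.
  exact: continuous_add.
move=> i; have [dfi Cf] := df i; have [dgi Cg] := dg i; split.
  by move=> x; exact: derivableD.
rewrite (_ : partial i _ = fun x => partial i f x + partial i g x); first exact: IH.
by apply/funext => x; rewrite partialD.
Qed.

Lemma CfunM k f g : Cfun k f -> Cfun k g -> Cfun k (fun x => f x * g x).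
Proof.
elim: k f g => //= k IH f g Cf Cg.
have [cf df] := Cf; have [cg dg] := Cg; split.
  exact: continuous_mul.
move=> i; have [dfi Cfi] := df i; have [dgi Cgi] := dg i; split.
  by move=> x; exact: derivableM.
rewrite (_ : partial i _ = fun x => f x * partial i g x + g x * partial i f x).
  by apply: CfunD; apply: IH => //; exact: CfunW.
by apply/funext => x; rewrite partialM.
Qed.

Lemma CfunV k f : (forall x, f x != 0) -> Cfun k f -> Cfun k (fun x => (f x)^-1).
Proof.
move=> f0; elim: k => //= k IH Cf.
have [cf df] := Cf; split; first exact: continuous_inv.
move=> i; have [dfi Cfi] := df i; split; first by move=> x; exact: derivableV.
rewrite (_ : partial i _ = fun x => (-1) * ((f x)^-1 * (f x)^-1 * partial i f x)).
  apply: CfunM; first exact: Cfun_cst.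
  by apply: CfunM => //; apply: CfunM; apply: IH; exact: CfunW.
by apply/funext => x; rewrite partialV// mulN1r.
Qed.

Lemma smooth_cst (c : R) : smooth (fun _ : 'rV[R]_n => c).
Proof. by apply/smoothE => k; exact: Cfun_cst. Qed.

Lemma smoothD f g : smooth f -> smooth g -> smooth (fun x => f x + g x).
Proof.
by move=> /smoothE sf /smoothE sg; apply/smoothE => k; exact: CfunD.
Qed.

Lemma smoothM f g : smooth f -> smooth g -> smooth (fun x => f x * g x).
Proof.
by move=> /smoothE sf /smoothE sg; apply/smoothE => k; exact: CfunM.
Qed.

Lemma smoothN f : smooth f -> smooth (fun x => - f x).
Proof.
move=> sf; rewrite (_ : (fun _ => _) = fun x => (-1) * f x).
  by apply: smoothM => //; exact: smooth_cst.
by apply/funext => x; rewrite mulN1r.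
Qed.

Lemma smoothB f g : smooth f -> smooth g -> smooth (fun x => f x - g x).
Proof. by move=> sf /smoothN; exact: smoothD. Qed.

Lemma smoothV f : (forall x, f x != 0) -> smooth f -> smooth (fun x => (f x)^-1).
Proof.
by move=> f0 /smoothE sf; apply/smoothE => k; exact: CfunV.
Qed.

Lemma smooth_prod (I : Type) (s : seq I) (F : I -> 'rV[R]_n -> R) :
  (forall i, smooth (F i)) -> smooth (fun x => \prod_(i <- s) F i x).
Proof.
move=> sF; elim: s => [|i s IH].
  rewrite (_ : (fun _ => _) = fun=> 1); first exact: smooth_cst.
  by apply/funext => x; rewrite big_nil.
rewrite (_ : (fun _ => _) = fun x => F i x * \prod_(i <- s) F i x).
  exact: smoothM.
by apply/funext => x; rewrite big_cons.
Qed.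

Lemma smooth_continuous f : smooth f -> continuous f.
Proof. by move=> /(_ [::])[]. Qed.

Lemma smooth_derivable f i x : smooth f -> derivable f x 'e_i.
Proof. by move=> /(_ [::])[]. Qed.

Lemma smooth_partial i f : smooth f -> smooth (partial i f).
Proof. by move=> sf s; have := sf (rcons s i); rewrite foldr_rcons. Qed.

Lemma partial_coord (g dg : R -> R) (i j : 'I_n) (x : 'rV[R]_n) :
  (forall t : R, is_derive t (1 : R) g (dg t)) ->
  derivable (fun y : 'rV[R]_n => g (y ord0 i)) x 'e_j /\
  partial j (fun y => g (y ord0 i)) x = (i == j)%:R * dg (x ord0 i).
Proof.
move=> dgP; have [dgx <-] := dgP (x ord0 i).
rewrite /derivable /partial /derive.
have [<-|ij] := eqVneq i j.
  have -> : (fun h : R => h^-1 *: (g ((h *: 'e_i + x) ord0 i) - g (x ord0 i))) =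
    (fun h : R => h^-1 *: (g (h *: 1 + x ord0 i) - g (x ord0 i))).
    by apply/funext => h; rewrite !mxE !eqxx.
  by split; [exact: dgx|rewrite mul1r].
have -> : (fun h : R => h^-1 *: (g ((h *: 'e_j + x) ord0 i) - g (x ord0 i))) =
    (fun h : R => 0 : R).
  apply/funext => h; rewrite !mxE (negbTE ij) andbF mulr0 add0r subrr.
  by rewrite scaler0.
split; first exact: is_cvg_cst.
by rewrite mul0r lim_cst.
Qed.

End smooth_calculus.

(** * A smooth function vanishing on a half-line *)

Section flat_function.
Context {R : realType}.

(* The linear span of these functions is closed under differentiation. *)
Definition flat (n : nat) (t : R) : R :=
  if 0 < t then t^-1 ^+ n * expR (- t^-1) else 0.

Lemma flat_ge0 n t : 0 <= flat n t.
Proof.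
rewrite /flat; case: ifPn => // t0.
by rewrite mulr_ge0 ?expR_ge0// exprn_ge0// invr_ge0 ltW.
Qed.

Lemma flat0_gt0 t : 0 < t -> 0 < flat 0 t.
Proof. by move=> t0; rewrite /flat t0 expr0 mul1r expR_gt0. Qed.

Lemma flat_npos n t : t <= 0 -> flat n t = 0.
Proof. by move=> t0; rewrite /flat ltNge t0. Qed.

(** This is [exp s >= (s / (n+1)) ^ (n+1)] at [s = 1/t], itself the power [n+1] of [exp x >= 1 + x].
    The linear factor is what is needed at 0: the difference quotient of [flat n] there is
    [flat n.+1], which therefore tends to 0. *)
Lemma flat_le n t : flat n t <= (n.+1)%:R ^+ n.+1 * `|t|.
Proof.
have [t0|t0] := leP t 0; first by rewrite flat_npos// mulr_ge0// exprn_ge0.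
rewrite /flat t0 gtr0_norm//.
have h : (t^-1 / n.+1%:R) ^+ n.+1 <= expR t^-1.
  rewrite (_ : expR t^-1 = expR (n.+1%:R * (t^-1 / n.+1%:R))); last first.
    by rewrite [_ * (_ / _)]mulrC divfK.
  rewrite expRM_natl.
  apply: lerXn2r; rewrite ?nnegrE ?expR_ge0//.
    by rewrite divr_ge0// invr_ge0 ltW.
  by apply: le_trans (expR_ge1Dx _); rewrite lerDr.
rewrite expRN ler_pdivrMr ?expR_gt0// -ler_pdivrMl ?mulr_gt0 ?exprn_gt0//.
apply: le_trans h; rewrite expr_div_n le_eqVlt; apply/orP; left; apply/eqP.
rewrite invfM mulrAC [RHS]mulrC -!mulrA; congr (_ * _).
by rewrite exprSr.
Qed.

Lemma is_derive_flat n (t : R) :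
  is_derive t 1 (flat n) (flat n.+2 t - n%:R * flat n.+1 t).
Proof.
have [t0|t0|->] := ltgtP t 0.
- rewrite !flat_npos ?(ltW t0)// mulr0 subr0.
  apply: (@near_eq_is_derive R R R (cst 0)).
  by near=> y; rewrite flat_npos// ltW//; near: y; exact: lt_nbhsl.
- have E : \near t, t^-1 ^+ n * expR (- t^-1) = flat n t.
    by near=> y; rewrite /flat ifT//; near: y; exact: lt_nbhsr.
  apply: near_eq_is_derive E _.
  have tn0 : t != 0 by rewrite gt_eqF.
  have dV := @is_deriveV R id t 1 1 tn0 (is_derive_id t 1).
  have dN := is_deriveN dV.
  have dE := @is_derive1_comp R expR (fun y => - y^-1) t _ _ (is_derive_expR _) dN.
  have dX := is_deriveX n dV.
  rewrite (_ : (fun _ => _) =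
      ([eta GRing.inv] ^+ n * (expR \o (fun y : R => - y^-1)))); last first.
    by apply/funext => y; rewrite !fctE.
  apply: (is_derive_eq (is_deriveM dX dE)).
  rewrite /flat t0 !fctE /= /GRing.scale/= !mulr1.
  rewrite -[t ^- 2]exprVn; set b := expR _; move: b (t^-1) => b a.
  by case: n {dX} => [|n] /=; rewrite ?exprS; ring.
- rewrite !flat_npos// mulr0 subr0.
  suff h : (fun h : R => h^-1 *: (flat n (h *: 1 + 0) - flat n 0)) @ (0 : R)^' --> (0 : R).
    by apply: DeriveDef; [apply/cvg_ex; exists 0|apply: cvg_lim].
  apply/cvgr0Pnorm_lt => e e0; near=> h.
  rewrite addr0 [flat n 0]flat_npos// subr0 /GRing.scale/= mulr1.
  have [h0|h0] := leP h 0; first by rewrite flat_npos// mulr0 normr0.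
  have -> : h^-1 * flat n h = flat n.+1 h by rewrite /flat h0 exprS mulrA.
  rewrite ger0_norm ?flat_ge0//; apply: le_lt_trans (flat_le _ _) _.
  rewrite -ltr_pdivlMl ?exprn_gt0//.
  near: h; apply: dnbhs0_lt; rewrite mulr_gt0// invr_gt0 exprn_gt0//.
Unshelve. all: by end_near. Qed.

Lemma continuous_flat n : continuous (flat n).
Proof.
move=> t; apply: differentiable_continuous; apply/derivable1_diffP.
by have [] := is_derive_flat n t.
Qed.

End flat_function.

Section smooth_flat.
Context {R : realType} {n : nat}.

Lemma smooth_flat_coord (k : nat) (s a : R) (i : 'I_n) :
  smooth (fun x : 'rV[R]_n => flat k (s * (x ord0 i - a))).
Proof.
apply/smoothE => l; elim: l k => //= l IH k; split.
  move=> x; apply: (@continuous_comp _ _ _ (fun x : 'rV[R]_n => s * (x ord0 i - a))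
    (flat k)); last exact: continuous_flat.
  apply: (@continuous_mul R _ (fun=> s)); first exact: cst_continuous.
  apply: (@continuous_add R _ _ (fun=> - a)); last exact: cst_continuous.
  exact: coord_continuous.
move=> j.
have dg (t : R) : is_derive t (1 : R) (fun t => flat k (s * (t - a)))
    (s * (flat k.+2 (s * (t - a)) - k%:R * flat k.+1 (s * (t - a)))).
  have d1 : is_derive t 1 (fun t : R => s * (t - a)) s.
    have d2 := is_deriveZ s (is_deriveB (is_derive_id t 1) (is_derive_cst a t 1)).
    by apply: (is_derive_eq d2); rewrite subr0 /GRing.scale/= mulr1.
  have d3 := @is_derive1_comp R (flat k) _ t _ _ (is_derive_flat _ _) d1.
  by apply: (is_derive_eq d3); rewrite mulrC.
split=> [x|]; first by have [] := partial_coord i j x dg.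
rewrite (_ : partial j _ = fun x => ((i == j)%:R * s) *
    (flat k.+2 (s * (x ord0 i - a)) + (- k%:R) * flat k.+1 (s * (x ord0 i - a)))).
  apply: CfunM; first exact: Cfun_cst.
  by apply: CfunD => //; apply: CfunM => //; exact: Cfun_cst.
apply/funext => x; have [_ ->] := partial_coord i j x dg.
by rewrite mulNr mulrA.
Qed.

End smooth_flat.

(** * Boxes and measurability in R^n *)

Section rV_boxes.
Context {R : realType} {n : nat}.
Implicit Types (a b x : 'rV[R]_n) (U K : set 'rV[R]_n).

Definition obox a b : set 'rV[R]_n :=
  [set x | forall i, a ord0 i < x ord0 i /\ x ord0 i < b ord0 i].

Definition cbox a b : set 'rV[R]_n :=
  [set x | forall i, a ord0 i <= x ord0 i /\ x ord0 i <= b ord0 i].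

Lemma obox_cbox a b : obox a b `<=` cbox a b.
Proof. by move=> x xab i; have [/ltW ? /ltW ?] := xab i. Qed.

Lemma measurable_coord_preimage (A : 'I_n -> set R) :
  (forall i, measurable (A i : set (measurableTypeR R))) ->
  measurable [set x : 'rV[R]_n | forall i, A i (x ord0 i)].
Proof.
move=> mA; rewrite (_ : [set _ | _] = \big[setI/setT]_(i < n)
    [set x : 'rV[R]_n | A i (x ord0 i)]).
  apply: bigsetI_measurable => i _; rewrite -[X in measurable X]setTI.
  by apply: measurable_coord_rV => //; exact: mA.
rewrite -bigcap_seq; apply/seteqP; split => x /= Ax i.
  by move=> _; exact: Ax.
by apply: (Ax i); rewrite /= mem_index_enum.
Qed.

Lemma oboxE a b :
  obox a b = [set x | forall i, `]a ord0 i, b ord0 i[%classic (x ord0 i)].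
Proof.
apply/seteqP; split=> x xab i; have := xab i; rewrite /= in_itv/=.
  by move=> [-> ->].
by move=> /andP.
Qed.

Lemma cboxE a b :
  cbox a b = [set x | forall i, `[a ord0 i, b ord0 i]%classic (x ord0 i)].
Proof.
apply/seteqP; split=> x xab i; have := xab i; rewrite /= in_itv/=.
  by move=> [-> ->].
by move=> /andP.
Qed.

Lemma measurable_obox a b : measurable (obox a b).
Proof.
rewrite oboxE; apply: (measurable_coord_preimage (A := fun i => [set` `]a ord0 i, b ord0 i[])).
by move=> i; exact: measurable_itv.
Qed.

Lemma measurable_cbox a b : measurable (cbox a b).
Proof.
rewrite cboxE; apply: (measurable_coord_preimage (A := fun i => [set` `[a ord0 i, b ord0 i]])).
by move=> i; exact: measurable_itv.
Qed.

Lemma compact_cbox a b : compact (cbox a b).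
Proof.
rewrite cboxE; apply: (@rV_compact R n (fun i => [set` `[a ord0 i, b ord0 i]])).
by move=> i; exact: segment_compact.
Qed.

Lemma lebesgue_cbox_lty a b : (lebesgue_rV n (cbox a b) < +oo)%E.
Proof.
rewrite cboxE (lebesgue_rV_box (A := fun i => [set` `[a ord0 i, b ord0 i]])); last first.
  by move=> i; exact: measurable_itv.
suff : (\prod_(i < n) lebesgue_measure `[a ord0 i, b ord0 i]%classic)%E \is a fin_num.
  by rewrite fin_numE ltey => /andP[].
apply: prode_fin_num => i _; rewrite lebesgue_measure_itv/=.
by case: ifP => _; rewrite -?EFinB.
Qed.

(** Cubes with rational centre and radius [1/(k+1)]. The index type is countable, so through
    [pickle] these cubes form a sequence: open sets become countable unions, and null sets attached
    to the cubes can be collected. *)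
Definition rat_box (q : 'rV[rat]_n * nat) : 'rV[R]_n * 'rV[R]_n :=
  (\row_i (ratr (q.1 ord0 i) - q.2.+1%:R^-1), \row_i (ratr (q.1 ord0 i) + q.2.+1%:R^-1)).

Lemma open_rat_box U x : open U -> U x ->
  exists q, obox (rat_box q).1 (rat_box q).2 x /\
            cbox (rat_box q).1 (rat_box q).2 `<=` U.
Proof.
move=> oU Ux; have /nbhs_ballP[e /= e0 eU] : nbhs x U by exact: open_nbhs_nbhs.
(* Half of [e], because [x] and every point of the closed cube are each within [1/(k+1)] of the
   centre in every coordinate. *)
have [k ke] : exists k : nat, k.+1%:R^-1 < e / 2.
  have e2 : 0 < e / 2 by rewrite divr_gt0.
  have [k _ /(_ k) hk] := near_infty_natSinv_lt (PosNum e2).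
  by exists k; exact: hk (leqnn k).
have k0 : 0 < k.+1%:R^-1 :> R by rewrite invr_gt0.
have /choice[c hc] (i : 'I_n) : exists q : rat,
    x ord0 i - k.+1%:R^-1 < ratr q /\ ratr q < x ord0 i + k.+1%:R^-1.
  have [|q] := @rat_in_itvoo R (x ord0 i - k.+1%:R^-1) (x ord0 i + k.+1%:R^-1).
    by rewrite ltrBlDr -addrA ltrDl addr_gt0.
  by rewrite in_itv/= => /andP[? ?]; exists q.
exists (\row_i c i, k); split=> [i|y xy].
  rewrite /rat_box /= !mxE; have [] := hc i; move: k0; set r := k.+1%:R^-1.
  by move=> *; split; lra.
apply: eU; split=> // i j; rewrite (ord1 i) /ball/=.
have := xy j; have := hc j; rewrite /rat_box /= !mxE ltr_norml.
move: ke; set r := k.+1%:R^-1 => ke.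
by move=> [? ?] [? ?]; apply/andP; split; lra.
Qed.

(** The sigma-algebra is generated by the coordinates, not by the topology; the countable family of
    rational cubes links the two. *)
Lemma open_measurable_rV U : open U -> measurable U.
Proof.
move=> oU; pose P q := `[< cbox (rat_box q).1 (rat_box q).2 `<=` U >].
rewrite (_ : U = \bigcup_k (if unpickle k is Some q then
  if P q then obox (rat_box q).1 (rat_box q).2 else set0 else set0)).
  apply: bigcup_measurable => k _; case: unpickle => // q.
  by case: ifP => // _; exact: measurable_obox.
apply/seteqP; split=> [x /(open_rat_box oU)[q [qx qU]]|x [k _]].
  exists (pickle q) => //; rewrite pickleK ifT//; exact/asboolP.
case: unpickle => // q; case: ifP => // /asboolP qU qx.
exact/qU/obox_cbox.
Qed.

Lemma closed_measurable_rV K : closed K -> measurable K.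
Proof.
move=> cK; rewrite -(setCK K); apply: measurableC; apply: open_measurable_rV.
exact: closed_openC.
Qed.

Lemma compact_closed_rV K : compact K -> closed K.
Proof. exact: compact_closed (@norm_hausdorff _ _). Qed.

Lemma compact_measurable_rV K : compact K -> measurable K.
Proof. by move=> /compact_closed_rV; exact: closed_measurable_rV. Qed.

Lemma continuous_measurable_rV (f : 'rV[R]_n -> R) D : measurable D ->
  continuous f -> measurable_fun D f.
Proof.
move=> mD cf; apply: (@measurable_funS _ _ _ _ setT) => //.
apply: (measurability _ (RGenOInfty.measurableE R)) => //.
move=> _ [_ [a ->] <-]; rewrite setTI; apply: open_measurable_rV.
by apply: open_comp => // x _; exact: cf.
Qed.

Lemma compact_sub_cbox K : compact K ->
  exists M : R, 0 < M /\ K `<=` cbox (const_mx (- M)) (const_mx M).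
Proof.
move=> /compact_bounded[M0 [_ hM]]; exists (`|M0| + 1).
split=> [|x Kx i]; first by rewrite ltr_wpDl.
rewrite !mxE; apply/andP; rewrite -ler_norml.
apply: le_trans (hM (`|M0| + 1) _ x Kx); last by rewrite ltr_pwDr// ler_norm.
rewrite [leRHS]/Num.norm/= mx_normrE.
exact: (le_bigmax _ (fun ij : 'I_1 * 'I_n => `|x ij.1 ij.2|) (ord0, i)).
Qed.

Lemma compact_lebesgue_lty K : compact K -> (lebesgue_rV n K < +oo)%E.
Proof.
move=> cK; have [M [_ KM]] := compact_sub_cbox cK.
apply: le_lt_trans (lebesgue_cbox_lty (const_mx (- M)) (const_mx M)).
by apply: le_measure => //; rewrite inE; [exact: compact_measurable_rV|exact: measurable_cbox].
Qed.

Lemma rint_patch D K (f : 'rV[R]_n -> R) : measurable D -> measurable K ->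
  (lebesgue_rV n).-integrable K (EFin \o f) ->
  (lebesgue_rV n).-integrable D (EFin \o (f \_ K)).
Proof.
move=> mD mK fi; apply: (@integrableS _ _ _ _ setT) => //.
have [+ _] := integrable_mkcond (mu := lebesgue_rV n) (EFin \o f) mK.
by rewrite restrict_EFin; exact.
Qed.

Lemma rint_compact_cst K (M : R) : compact K ->
  (lebesgue_rV n).-integrable K (EFin \o (fun=> M)).
Proof.
move=> cK; have mK := compact_measurable_rV cK.
apply/rintP; split=> //; rewrite integral_cst//.
by rewrite lte_mul_pinfty ?lee_fin// compact_lebesgue_lty.
Qed.

Lemma rint_bounded_support D K (f : 'rV[R]_n -> R) (M : R) :
  measurable D -> compact K -> measurable_fun D f ->
  (forall x, D x -> ~ K x -> f x = 0) -> (forall x, D x -> `|f x| <= M) ->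
  (lebesgue_rV n).-integrable D (EFin \o f).
Proof.
move=> mD cK mf f0 fM; have mK := compact_measurable_rV cK.
apply: rint_le (rint_patch mD mK (rint_compact_cst M cK)) => // x Dx.
rewrite patchE; have [xK|/negP xK] := boolP (x \in K); first exact: fM.
by rewrite f0 ?normr0// => Kx; apply: xK; rewrite inE.
Qed.

Lemma rint_mul_bounded_support D K (f h : 'rV[R]_n -> R) (M : R) :
  measurable D -> compact K ->
  (lebesgue_rV n).-integrable K (EFin \o f) ->
  measurable_fun D f -> measurable_fun D h ->
  (forall x, ~ K x -> h x = 0) -> (forall x, K x -> `|h x| <= M) ->
  (lebesgue_rV n).-integrable D (EFin \o (fun x => f x * h x)).
Proof.
move=> mD cK fi mf mh h0 hM; have mK := compact_measurable_rV cK.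
have fMi := rintZ mK M (rint_norm fi).
apply: rint_le (rint_patch mD mK fMi) => // [|x Dx]; first exact: measurable_funM.
rewrite patchE; have [xK|/negP xK] := boolP (x \in K).
  by rewrite normrM mulrC ler_wpM2r// hM//; rewrite inE in xK.
by rewrite h0 ?mulr0 ?normr0// => Kx; apply: xK; rewrite inE.
Qed.

Lemma continuous_bounded_support K (f : 'rV[R]_n -> R) : compact K ->
  continuous f -> (forall x, ~ K x -> f x = 0) ->
  exists2 M : R, 0 <= M & forall x, `|f x| <= M.
Proof.
move=> cK cf f0.
have /compact_bounded[M0 [_ hM]] : compact (f @` K).
  by apply: continuous_compact => //; apply: continuous_subspaceT.
exists (`|M0| + 1) => [|x]; first by rewrite addr_ge0.
have [Kx|nKx] := pselect (K x); last by rewrite f0// normr0 addr_ge0.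
by apply: hM; [rewrite ltr_pwDr// ler_norm|exists x].
Qed.

End rV_boxes.

(** * Iterated integrals *)

Section rVcons_lemmas.
Context {R : realType} {n : nat}.
Implicit Types (t : R) (y : 'rV[R]_n).

Lemma rVcons_ord0 t y : rVcons (t, y) ord0 ord0 = t.
Proof. by rewrite mxE unlift_none. Qed.

Lemma rVcons_lift t y j : rVcons (t, y) ord0 (lift ord0 j) = y ord0 j.
Proof. by rewrite mxE liftK. Qed.

Lemma ord_succP (P : 'I_n.+1 -> Prop) : P ord0 -> (forall j, P (lift ord0 j)) -> forall i, P i.
Proof. by move=> P0 Pl i; case: (unliftP ord0 i) => [j|] ->. Qed.

Lemma rVcons_addl (s t : R) y : s *: 'e_ord0 + rVcons (t, y) = rVcons (s + t, y).
Proof.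
apply/rowP; apply: ord_succP => [|j]; first by rewrite mxE !rVcons_ord0 !mxE mulr1.
by rewrite mxE !rVcons_lift !mxE/= mulr0 add0r.
Qed.

Lemma rVcons_addr j s t y :
  s *: 'e_(lift ord0 j) + rVcons (t, y) = rVcons (t, s *: 'e_j + y).
Proof.
apply/rowP; apply: ord_succP => [|k]; first by rewrite mxE !rVcons_ord0 !mxE/= mulr0 add0r.
rewrite mxE !rVcons_lift !mxE/=.
by rewrite -val_eqE /= /bump/= eqSS.
Qed.

Lemma continuous_rVconsl y : continuous (fun t : R => rVcons (t, y)).
Proof.
move=> t; apply/cvg_ballP => e e0; near=> s; split=> // k; rewrite (ord1 k).
apply: ord_succP => [|j]; last by rewrite !rVcons_lift; exact: ballxx.
by rewrite !rVcons_ord0; near: s; exact: (@nbhsx_ballx _ _ t e e0).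
Unshelve. all: by end_near. Qed.

Lemma continuous_rVconsr t : continuous (fun y : 'rV[R]_n => rVcons (t, y)).
Proof.
move=> y; apply/(@cvg_ballP _ _ _ (nbhs y) _) => e e0; near=> z; split=> // k; rewrite (ord1 k).
have : ball y e z by near: z; exact: (@nbhsx_ballx _ _ y e e0).
move=> [_ yz]; apply: ord_succP => [|j]; last by rewrite !rVcons_lift; exact: yz.
by rewrite !rVcons_ord0; exact: ballxx.
Unshelve. all: by end_near. Qed.

End rVcons_lemmas.

Section rV_fubini.
Local Open Scope ereal_scope.
Context {R : realType} {n : nat}.
Variables (f : 'rV[R]_n.+1 -> R) (K : set 'rV[R]_n.+1).
Hypotheses (cf : continuous f) (cK : compact K) (f0 : forall x, ~ K x -> f x = 0%R).

Let mu1 := @lebesgue_measure R.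
Let g (p : measurableTypeR R * 'rV[R]_n) := (f (rVcons p))%:E.

Let mg : measurable_fun setT (f \o @rVcons R n).
Proof.
apply: measurableT_comp; last exact: measurable_rVcons.
exact: continuous_measurable_rV.
Qed.

Let gi : (mu1 \x lebesgue_rV n).-integrable setT g.
Proof.
have [M M0 fM] := continuous_bounded_support cK cf f0.
have mK : measurable (@rVcons R n @^-1` K).
  rewrite -[X in measurable X]setTI; apply: measurable_rVcons => //.
  exact: compact_measurable_rV.
apply: (rint_le measurableT
    (g := fun p => (M * \1_(@rVcons R n @^-1` K) p)%R)) => //.
  move=> p _; rewrite indicE; have [pK|/negP pK] := boolP (p \in _).
    by rewrite mulr1; exact: fM.
  by rewrite /g /= f0 ?normr0 ?mulr0// => Kp; apply: pK; rewrite inE.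
apply: (rintZ measurableT M (f := \1_(@rVcons R n @^-1` K))) => //; apply/rintP; split=> //.
under eq_integral do rewrite ger0_norm//.
by rewrite integral_indic// setIT; exact: (compact_lebesgue_lty cK).
Qed.

(** By construction [lebesgue_rV n.+1] is the image of the product measure under [rVcons], so this
    is a change of variables. *)
Let pushE : \int[lebesgue_rV n.+1]_x (f x)%:E = \int[mu1 \x lebesgue_rV n]_p g p.
Proof.
have := @integral_pushforward _ _ _ _ R (@rVcons R n) (@measurable_rVcons R n)
  (mu1 \x lebesgue_rV n) setT (EFin \o f) _ gi measurableT.
move=> <-.
  by apply: eq_measure_integral; first exact: measurable_rVcons.
by apply/measurable_EFinP; exact: continuous_measurable_rV.
Qed.

Lemma integral_rV12 : \int[lebesgue_rV n.+1]_x (f x)%:E =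
  \int[mu1]_t \int[lebesgue_rV n]_y (f (rVcons (t, y)))%:E.
Proof. by rewrite pushE -integral12_prod_meas1. Qed.

Lemma integral_rV21 : \int[lebesgue_rV n.+1]_x (f x)%:E =
  \int[lebesgue_rV n]_y \int[mu1]_t (f (rVcons (t, y)))%:E.
Proof. by rewrite pushE -integral21_prod_meas1. Qed.

End rV_fubini.

(** * Integrals of partial derivatives *)

Section derive_along_line.
Context {R : realType} {U V : normedModType R}.

Lemma derive_line_eq (f : U -> R) (g : V -> R) (x v : U) (y w : V) :
  (forall s : R, f (s *: v + x) = g (s *: w + y)) ->
  'D_v f x = 'D_w g y /\ (derivable f x v -> derivable g y w).
Proof.
move=> fg.
have E : (fun s : R => s^-1 *: ((f \o shift x) (s *: v) - f x)) =
         (fun s : R => s^-1 *: ((g \o shift y) (s *: w) - g y)).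
  apply/funext => s /=; rewrite fg.
  by have := fg 0; rewrite !scale0r !add0r => ->.
by rewrite /derive /derivable E.
Qed.

End derive_along_line.

Section integral_partial.
Context {R : realType}.

Lemma integral_derive (f df : R -> R) (M : R) : 0 < M ->
  (forall t : R, is_derive t (1 : R) f (df t)) -> continuous df ->
  (forall t : R, ~ (- M <= t <= M) -> f t = 0) ->
  (forall t : R, ~ (- M <= t <= M) -> df t = 0) ->
  (\int[@lebesgue_measure R]_t (df t)%:E = 0)%E.
Proof.
(* The vanishing hypotheses say nothing at the endpoints [-M] and [M]; at distance 1 beyond them
   they apply. *)
move=> M0 fD cdf f0 df0; pose L := M + 1.
have cf : continuous f.
  move=> t; apply: differentiable_continuous; apply/derivable1_diffP.
  by have [] := fD t.
have -> : (\int[@lebesgue_measure R]_t (df t)%:E =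
    \int[@lebesgue_measure R]_(t in `[(- L)%R, L%R]) (df t)%:E)%E.
  rewrite [RHS]integral_mkcond; apply: eq_integral => t _.
  rewrite patchE; case: ifPn => // /negP tL; rewrite df0// => /andP[tM Mt].
  by apply: tL; rewrite inE/= in_itv/= /L; apply/andP; split; lra.
rewrite (@continuous_FTC2 R df f).
- by rewrite !f0 ?subee// /L => /andP[? ?]; lra.
- by rewrite /L; lra.
- exact: continuous_subspaceT.
- split=> [t _||]; first by have [] := fD t.
  + apply: cvg_at_right_filter; exact: cf.
  + apply: cvg_at_left_filter; exact: cf.
- by move=> t _; rewrite derive1E; have [_ ->] := fD t.
Qed.

(** Fubini, with the coordinate of differentiation in the inner integral. The first coordinate is
    settled by the fundamental theorem of calculus, any other one by induction applied to the
    slices. The support is enlarged to a cube because the slices of a cube are again cubes. *)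
Lemma integral_partial n (i : 'I_n) (h : 'rV[R]_n -> R) (K : set 'rV[R]_n) :
  continuous h -> (forall x, derivable h x 'e_i) -> continuous (partial i h) ->
  compact K -> (forall x, ~ K x -> h x = 0) ->
  (forall x, ~ K x -> partial i h x = 0) ->
  (\int[lebesgue_rV n]_x (partial i h x)%:E = 0)%E.
Proof.
elim: n i h K => [[]//|n IH] i h K ch dh cph cK h0 ph0.
have [M [M0 KM]] := compact_sub_cbox cK.
have nK t y : (forall i, - M <= rVcons (t, y) ord0 i <= M) \/ ~ K (rVcons (t, y)).
  have [/KM H|] := pselect (K (rVcons (t, y))); last by right.
  by left => k; have [] := H k; rewrite !mxE => -> ->.
case: (unliftP ord0 i) => [j|] iE; subst i.
- rewrite (integral_rV12 cph cK ph0); apply: integral0_eq => t _.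
  have E y s : h (s *: 'e_(lift ord0 j) + rVcons (t, y)) =
      h (rVcons (t, s *: 'e_j + y)) by rewrite rVcons_addr.
  have pE y : partial (lift ord0 j) h (rVcons (t, y)) =
      partial j (fun y => h (rVcons (t, y))) y.
    by have [] := derive_line_eq (g := fun y => h (rVcons (t, y))) (E y).
  have cr := @continuous_rVconsr R n t.
  under eq_integral do rewrite pE.
  apply: (IH j _ (cbox (const_mx (- M)) (const_mx M))).
  + by move=> y; apply: continuous_comp; [exact: cr|exact: ch].
  + move=> y.
    by have [_] := derive_line_eq (g := fun y => h (rVcons (t, y))) (E y); exact.
  + rewrite -(funext pE) => y.
    by apply: continuous_comp; [exact: cr|exact: cph].
  + exact: compact_cbox.
  + move=> y yM; have [H|/h0//] := nK t y; exfalso; apply: yM => k.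
    by have := H (lift ord0 k); rewrite rVcons_lift !mxE => /andP[].
  + move=> y yM; rewrite -pE; have [H|/ph0//] := nK t y; exfalso; apply: yM => k.
    by have := H (lift ord0 k); rewrite rVcons_lift !mxE => /andP[].
- rewrite (integral_rV21 cph cK ph0); apply: integral0_eq => y _.
  have cl := @continuous_rVconsl R n y.
  apply: (@integral_derive (fun t => h (rVcons (t, y))) _ M) => //.
  + move=> t; have E (s : R) : h (s *: 'e_ord0 + rVcons (t, y)) =
        h (rVcons (s *: (1 : R) + t, y)).
      by rewrite rVcons_addl -[s *: _]/(s * 1) mulr1.
    have [pE /(_ (dh _)) dE] := derive_line_eq (g := fun t => h (rVcons (t, y))) E.
    exact: DeriveDef dE (esym pE).
  + by move=> t; apply: continuous_comp; [exact: cl|exact: cph].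
  + move=> t tM; have [H|/h0//] := nK t y; exfalso; apply: tM.
    by have := H ord0; rewrite rVcons_ord0.
  + move=> t tM; have [H|/ph0//] := nK t y; exfalso; apply: tM.
    by have := H ord0; rewrite rVcons_ord0.
Qed.

End integral_partial.

(** * The fundamental lemma of the calculus of variations *)

Section box_generation.
Context {R : realType} {n : nat}.

Definition oboxes : set (set 'rV[R]_n) := [set A | exists a b, A = obox a b].

Lemma oboxI (a b a' b' : 'rV[R]_n) : obox a b `&` obox a' b' =
  obox (\row_i Num.max (a ord0 i) (a' ord0 i)) (\row_i Num.min (b ord0 i) (b' ord0 i)).
Proof.
apply/seteqP; split=> [x [h h'] i|x h]; last split=> i.
- by have [? ?] := h i; have [? ?] := h' i; rewrite !mxE gt_max lt_min; split; apply/andP.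
- by have := h i; rewrite !mxE gt_max lt_min => -[/andP[? ?] /andP[? ?]].
- by have := h i; rewrite !mxE gt_max lt_min => -[/andP[? ?] /andP[? ?]].
Qed.

Lemma setI_closed_oboxes : setI_closed oboxes.
Proof.
by move=> _ _ [a [b ->]] [a' [b' ->]]; rewrite oboxI; do 2 eexists.
Qed.

(** Prepares a Dynkin argument on the pi-system of open boxes. The half-spaces [x_i > a], which
    generate the sigma-algebra, are open and hence countable unions of rational boxes. *)
Lemma measurable_oboxes : @measurable _ 'rV[R]_n = <<s oboxes >>.
Proof.
apply/seteqP; split; last first.
  apply: smallest_sub; first exact: sigma_algebra_measurable.
  by move=> _ [a [b ->]]; exact: measurable_obox.
apply: smallest_sub; first exact: smallest_sigma_algebra.
rewrite -bigcup_seq => A [i _ [B mB <-]]; rewrite setTI.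
pose T := g_sigma_algebraType oboxes.
suff : measurable_fun [set: T] (fun x : T => (x : 'rV[R]_n) ord0 i : R).
  by move=> /(_ measurableT B mB); rewrite setTI.
apply: (measurability _ (RGenOInfty.measurableE R)) => //.
move=> _ [_ [a ->] <-]; rewrite setTI.
have oU : open ((fun x : 'rV[R]_n => x ord0 i) @^-1` `]a, +oo[%classic).
  by apply: open_comp => [x _|//]; exact: coord_continuous.
move: oU; set U := (X in open X) => oU.
pose P q := `[< cbox (rat_box q).1 (rat_box q).2 `<=` U >].
rewrite [X in measurable X](_ : _ = \bigcup_k (if unpickle k is Some q then
  if P q then obox (rat_box q).1 (rat_box q).2 else set0 else set0)).
  apply: bigcup_measurable => k _; case: unpickle => // q; case: ifP => // _.
  by apply: sub_sigma_algebra; do 2 eexists.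
apply/seteqP; split=> [x /(open_rat_box oU)[q [qx qU]]|x [k _]].
  exists (pickle q) => //; rewrite pickleK ifT//; exact/asboolP.
case: unpickle => // q; case: ifP => // /asboolP qU qx.
exact/qU/obox_cbox.
Qed.

End box_generation.

Section box_bump.
Context {R : realType} {n : nat} (a b : 'rV[R]_n).

Definition box_profile (x : 'rV[R]_n) : R := \prod_(i < n)
  (flat 0 (1 * (x ord0 i - a ord0 i)) * flat 0 (-1 * (x ord0 i - b ord0 i))).

Local Notation G := box_profile.

(** [G] is positive on the open box and zero off it. The quotient stays smooth and at most 1, and
    tends to 1 wherever [G] is positive, so it approximates the indicator of the box. *)
Definition box_bump (k : nat) (x : 'rV[R]_n) : R := G x * (k.+1%:R^-1 + G x)^-1.

Let G_ge0 x : 0 <= G x.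
Proof. by apply: prodr_ge0 => i _; rewrite mulr_ge0 ?flat_ge0. Qed.

Let den_gt0 (k : nat) x : 0 < k.+1%:R^-1 + G x.
Proof. by rewrite ltr_pwDl ?invr_gt0. Qed.

Lemma smooth_box_bump k : smooth (box_bump k).
Proof.
have sG : smooth G.
  apply: smooth_prod => i.
  by apply: smoothM; exact: smooth_flat_coord.
apply: smoothM => //; apply: smoothV => [x|]; first by rewrite gt_eqF.
by apply: smoothD => //; exact: smooth_cst.
Qed.

Lemma box_bump_bound k x : `|box_bump k x| <= 1.
Proof.
rewrite /box_bump ger0_norm.
  by rewrite ler_pdivrMr// mul1r lerDr invr_ge0.
by rewrite divr_ge0// ltW.
Qed.

Lemma box_bump_out k x : ~ obox a b x -> box_bump k x = 0.
Proof.
move=> /existsNP[i hi]; rewrite /box_bump /G (bigD1 i)//=.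
suff -> : flat 0 (1 * (x ord0 i - a ord0 i)) * flat 0 (-1 * (x ord0 i - b ord0 i)) = 0.
  by rewrite !mul0r.
have [xa|ax] := leP (x ord0 i) (a ord0 i).
  by rewrite flat_npos ?mul0r// mul1r subr_le0.
have [bx|xb] := leP (b ord0 i) (x ord0 i); last by case: hi.
by rewrite [flat 0 (-1 * _)]flat_npos ?mulr0// mulN1r oppr_le0 subr_ge0.
Qed.

Lemma box_bump_cvg x : obox a b x -> box_bump k x @[k --> \oo] --> (1 : R).
Proof.
move=> xab.
have G0 : 0 < G x.
  apply: prodr_gt0 => i _; have [ax xb] := xab i.
  by rewrite mulr_gt0// flat0_gt0// ?mul1r ?mulN1r ?oppr_gt0 ?subr_gt0 ?subr_lt0.
have hG : k.+1%:R^-1 + G x @[k --> \oo] --> G x.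
  rewrite -[X in _ --> X]add0r; apply: cvgD; last exact: cvg_cst.
  exact: cvg_harmonic.
rewrite -(divff (lt0r_neq0 G0)); apply: cvgM; first exact: cvg_cst.
by apply: cvgV => //; exact: lt0r_neq0.
Qed.

End box_bump.

Section fundamental_lemma.
Context {R : realType} {n : nat} (Omega : set 'rV[R]_n).
Hypothesis oO : open Omega.
Variable g : 'rV[R]_n -> R.
Local Notation mu := (lebesgue_rV n).
Hypotheses (mg : measurable_fun Omega g)
  (gloc : forall K, compact K -> K `<=` Omega -> mu.-integrable K (EFin \o g))
  (g0 : forall phi, smooth phi ->
    (exists K, [/\ compact K, K `<=` Omega & forall x, ~ K x -> phi x = 0]) ->
    \int[mu]_(x in Omega) (g x * phi x) = 0).

Let mO : measurable Omega := open_measurable_rV oO.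

(** Dominated convergence along the bumps, with [|g|] on the closed box as majorant. The closed box
    must lie in [Omega] for the bumps to be admissible and for [g] to be integrable there. *)
Lemma integral_obox_eq0 a b : cbox a b `<=` Omega ->
  (\int[mu]_(x in obox a b) (g x)%:E = 0)%E.
Proof.
move=> abO.
have cc : compact (cbox a b) by exact: compact_cbox.
have gi := gloc cc abO.
have goi : mu.-integrable (obox a b) (EFin \o g).
  by apply: integrableS gi; [exact: measurable_cbox|exact: measurable_obox|exact: obox_cbox].
have mb k : measurable_fun Omega (box_bump a b k).
  by apply: continuous_measurable_rV => //; exact/smooth_continuous/smooth_box_bump.
have z k : \int[mu]_(x in Omega) (g x * box_bump a b k x) = 0.
  apply: g0; first exact: smooth_box_bump.
  exists (cbox a b); split=> // x nx; apply: box_bump_out => /obox_cbox.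
  exact: nx.
have mo := measurable_obox a b.
have mc := measurable_cbox a b.
have [|||||_] := @rint_dominated_cvg _ _ _ mu Omega mO
  (fun k x => g x * box_bump a b k x) (g \_ (obox a b)) ((fun x => `|g x|) \_ (cbox a b)).
- by move=> k; exact: measurable_funM.
- exact/rint_measurable/rint_patch.
- apply: aeW => x Ox; rewrite patchE; case: ifPn => [/set_mem xab|xab].
    rewrite -[X in _ --> X]mulr1; apply: cvgM; first exact: cvg_cst.
    exact: box_bump_cvg.
  have nab : ~ obox a b x by move=> h; move/negP : xab; apply; exact: mem_set.
  rewrite (_ : (fun k => _) = fun=> 0); first exact: cvg_cst.
  by apply/funext => k; rewrite box_bump_out// mulr0.
- exact/rint_patch/rint_norm.
- apply: aeW => x k Ox; rewrite patchE; case: ifPn => [_|xab].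
    by rewrite normrM -[leRHS]mulr1 ler_wpM2l// box_bump_bound.
  rewrite box_bump_out ?mulr0 ?normr0// => /obox_cbox h.
  by move/negP : xab; apply; exact: mem_set.
under eq_fun do rewrite z.
move=> /(cvg_unique _ (@cvg_cst _ _ _ _ _)) => /(_ (@Rhausdorff R)).
rewrite -Rintegral_mkcondr setIidr; last exact: subset_trans (@obox_cbox _ _ _ _) abO.
rewrite /Rintegral => h.
by rewrite -[LHS]fineK ?(integrable_fin_num _ goi)// -h.
Qed.

(** The sets [A] over which [g] has zero integral inside the fixed box form a Dynkin system
    containing the open boxes, hence all measurable sets. Intersecting with the fixed box keeps [g]
    integrable, as complements and countable unions require. *)
Let ae_eq0_obox a0 b0 : cbox a0 b0 `<=` Omega -> 
  {ae mu, forall x, obox a0 b0 x -> g x = 0}.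
Proof.
move=> abO; pose Q := obox a0 b0.
have cc : compact (cbox a0 b0) by exact: compact_cbox.
have mQ : measurable Q := measurable_obox a0 b0.
have gQ : mu.-integrable Q (EFin \o g).
  by apply: integrableS (gloc cc abO); [exact: measurable_cbox| |exact: obox_cbox].
have gA A : measurable A -> mu.-integrable (A `&` Q) (EFin \o g).
  by move=> mA; apply: integrableS gQ => //; exact: measurableI.
suff H A : measurable A -> (\int[mu]_(x in A `&` Q) (g x)%:E = 0)%E.
  have : ae_eq mu Q (EFin \o g) (cst 0%E).
    apply: integral_ae_eq => //.
    move=> E EQ mE; rewrite integral0.
    by rewrite -[RHS](H E mE) (setIidl EQ).
  by apply: filterS => x h Qx; have [] := h Qx.
rewrite (measurable_oboxes (R := R)); move: A.
apply: (@dynkin_induction _ _ oboxes (fun A => (\int[mu]_(x in A `&` Q) (g x)%:E = 0)%E)).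
- exact: measurable_oboxes.
- exact: setI_closed_oboxes.
- by rewrite setTI integral_obox_eq0.
- move=> _ [a [b ->]]; rewrite oboxI integral_obox_eq0// => x xab; apply: abO => i.
  by have := xab i; rewrite !mxE ge_max le_min => -[/andP[_ ->] /andP[_ ->]].
- move=> A mA A0.
  have : (\int[mu]_(x in Q) (g x)%:E = 0)%E by rewrite integral_obox_eq0.
  rewrite -{1}(setIT Q) -(setUCr A) setIUr integral_setU//.
  + by rewrite ![Q `&` _]setIC A0 add0e.
  + exact: measurableI.
  + by apply: measurableI => //; exact: measurableC.
  + by rewrite -setIUr setUCr setIT; have /integrableP[] := gQ.
  + by apply/disj_setPS => x [[_ ?] [_ ?]].
- move=> F mF tF F0; rewrite setI_bigcupl integral_bigcup.
  + by apply: eseries0 => k _ _; exact: F0.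
  + exact: trivIset_setIr.
  + by move=> k; exact: measurableI.
  + by rewrite -setI_bigcupl; apply: gA; exact: bigcup_measurable.
Qed.

Lemma fundamental_lemma : {ae mu, forall x, Omega x -> g x = 0}.
Proof.
pose P q := `[< cbox (rat_box q).1 (rat_box q).2 `<=` Omega >].
have : {ae mu, forall x, forall k : nat, if unpickle k is Some q then
  P q -> obox (rat_box q).1 (rat_box q).2 x -> g x = 0 else True}.
  apply/ae_foralln => k; case: unpickle => [q|]; last exact: aeW.
  have [/asboolP qO|nq] := boolP (P q); last exact: aeW.
  by apply: filterS (ae_eq0_obox qO) => x h _; exact: h.
apply: filterS => x h /(open_rat_box oO)[q [qx qO]].
have := h (pickle q); rewrite pickleK; apply => //; exact/asboolP.
Qed.

End fundamental_lemma.

(** * Complex-valued functions *)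

Local Notation Re := complex.Re.
Local Notation Im := complex.Im.
Local Notation normc := ComplexField.Normc.normc.

Section complex_parts.
Context {R : realType}.
Implicit Types x y z : R[i].

Lemma ReD x y : Re (x + y) = Re x + Re y. Proof. by case: x; case: y. Qed.
Lemma ImD x y : Im (x + y) = Im x + Im y. Proof. by case: x; case: y. Qed.
Lemma ReN x : Re (- x) = - Re x. Proof. by case: x. Qed.
Lemma ImN x : Im (- x) = - Im x. Proof. by case: x. Qed.
Lemma ReM x y : Re (x * y) = Re x * Re y - Im x * Im y.
Proof. by case: x; case: y. Qed.
Lemma ImM x y : Im (x * y) = Re x * Im y + Im x * Re y.
Proof. by case: x; case: y => a b c d /=; rewrite addrC. Qed.
Lemma ReJ x : Re x^* = Re x. Proof. by case: x. Qed.
Lemma ImJ x : Im x^* = - Im x. Proof. by case: x. Qed.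
Lemma Re_real (r : R) : Re r%:C = r. Proof. by []. Qed.
Lemma Im_real (r : R) : Im r%:C = 0. Proof. by []. Qed.

(** Expands both parts of an expression, after which algebraic identities are left to [ring] over
    the reals. *)
Definition complexE := (ReD, ImD, ReN, ImN, ReM, ImM, ReJ, ImJ, Re_real, Im_real).

Lemma complexP x y : Re x = Re y -> Im x = Im y -> x = y.
Proof. by case: x y => [a b] [c d] /= -> ->. Qed.

Lemma Re_sum (I : Type) (s : seq I) (F : I -> R[i]) :
  Re (\sum_(i <- s) F i) = \sum_(i <- s) Re (F i).
Proof. by elim: s => [|i s IH]; rewrite ?big_nil// !big_cons ReD IH. Qed.

Lemma Im_sum (I : Type) (s : seq I) (F : I -> R[i]) :
  Im (\sum_(i <- s) F i) = \sum_(i <- s) Im (F i).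
Proof. by elim: s => [|i s IH]; rewrite ?big_nil// !big_cons ImD IH. Qed.

Lemma sqr_normcE z : normc z ^+ 2 = Re z ^+ 2 + Im z ^+ 2.
Proof. by case: z => a b /=; rewrite sqr_sqrtr// addr_ge0// sqr_ge0. Qed.

Lemma normc_ge0 z : 0 <= normc z.
Proof. by case: z => a b /=; rewrite sqrtr_ge0. Qed.

Lemma Re_le_normc z : `|Re z| <= normc z.
Proof.
rewrite -(@ler_pXn2r _ 2)// ?nnegrE ?normc_ge0//.
by rewrite sqr_normcE real_normK ?num_real// lerDl sqr_ge0.
Qed.

Lemma Im_le_normc z : `|Im z| <= normc z.
Proof.
rewrite -(@ler_pXn2r _ 2)// ?nnegrE ?normc_ge0//.
by rewrite sqr_normcE real_normK ?num_real// lerDr sqr_ge0.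
Qed.

Lemma normc_le_ReIm z : normc z <= `|Re z| + `|Im z|.
Proof.
rewrite -(@ler_pXn2r _ 2)// ?nnegrE ?normc_ge0// ?addr_ge0//.
rewrite sqr_normcE sqrrD !real_normK ?num_real// lerD2r lerDl.
by rewrite mulrn_wge0// mulr_ge0.
Qed.

Lemma normcJ x : normc x^* = normc x.
Proof. by case: x => a b /=; rewrite sqrrN. Qed.

Lemma normc_real (r : R) : normc r%:C = `|r|.
Proof. by rewrite /= expr0n addr0 sqrtr_sqr. Qed.

(* In a product [x * y^*] the notation [^*] denotes [Num.conj], elsewhere [conjc]. *)
Lemma conjcR (r : R) : Num.conj (r%:C : R[i]) = r%:C.
Proof. by apply: complexP; rewrite ?ReJ ?ImJ ?oppr0. Qed.

Lemma normcB_le x y : normc (x - y) <= normc x + normc y.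
Proof.
have := @ler_normD _ R[i] x (- y); rewrite normrN !normc_def -rmorphD lecR.
by case: x y => [a b] [c d]. Qed.

End complex_parts.

Section complex_integral.
Context {R : realType} {n : nat} (Omega : set 'rV[R]_n).
Hypothesis mO : measurable Omega.
Local Notation mu := (lebesgue_rV n).
Implicit Types f g : 'rV[R]_n -> R[i].

Definition cintegrable f :=
  mu.-integrable Omega (EFin \o (fun x => Re (f x))) /\
  mu.-integrable Omega (EFin \o (fun x => Im (f x))).

Lemma eq_cintegral f g : (forall x, Omega x -> f x = g x) ->
  cintegral Omega f = cintegral Omega g.
Proof.
move=> fg; rewrite /cintegral; congr Complex; apply: eq_Rintegral => x;
  by rewrite inE => /fg ->.
Qed.

Lemma cintegral_ae_eq f g : cmeasurable_fun Omega f -> cmeasurable_fun Omega g ->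
  ae_eq_on Omega f g -> cintegral Omega f = cintegral Omega g.
Proof.
move=> [mRf mIf] [mRg mIg] fg; rewrite /cintegral /Rintegral.
congr (fine _ +i* fine _); apply: ae_eq_integral => //; try exact/measurable_EFinP.
- by apply: filterS fg => x + Ox => /(_ Ox) ->.
- by apply: filterS fg => x + Ox => /(_ Ox) ->.
Qed.

Lemma cintegrableD f g : cintegrable f -> cintegrable g ->
  cintegrable (fun x => f x + g x).
Proof.
move=> [f1 f2] [g1 g2]; split.
- by apply: eq_rint (rintD mO f1 g1) => // x _; rewrite ReD.
- by apply: eq_rint (rintD mO f2 g2) => // x _; rewrite ImD.
Qed.

Lemma cintegrableZ c f : cintegrable f -> cintegrable (fun x => c * f x).
Proof.
move=> [f1 f2]; split.
- apply: eq_rint (rintB mO (rintZ mO (Re c) f1) (rintZ mO (Im c) f2)) => // x _.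
  by rewrite ReM.
- apply: eq_rint (rintD mO (rintZ mO (Re c) f2) (rintZ mO (Im c) f1)) => // x _.
  by rewrite ImM.
Qed.

Lemma cintegralD f g : cintegrable f -> cintegrable g ->
  cintegral Omega (fun x => f x + g x) = cintegral Omega f + cintegral Omega g.
Proof.
move=> [f1 f2] [g1 g2]; apply: complexP; rewrite ?complexE /cintegral /=.
- by rewrite -RintegralD//; apply: eq_Rintegral => x _; rewrite ReD.
- by rewrite -RintegralD//; apply: eq_Rintegral => x _; rewrite ImD.
Qed.

Lemma cintegralZ c f : cintegrable f ->
  cintegral Omega (fun x => c * f x) = c * cintegral Omega f.
Proof.
move=> [f1 f2]; apply: complexP; rewrite ?complexE /cintegral /=.
- rewrite -!RintegralZl// -RintegralB//; last 2 first.
  + exact: rintZ.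
  + exact: rintZ.
  by apply: eq_Rintegral => x _; rewrite ReM.
- rewrite -!RintegralZl// -RintegralD//; last 2 first.
  + exact: rintZ.
  + exact: rintZ.
  by apply: eq_Rintegral => x _; rewrite ImM.
Qed.

Lemma cintegrableN f : cintegrable f -> cintegrable (fun x => - f x).
Proof.
move=> fi; rewrite (_ : (fun _ => _) = fun x => -1 * f x).
  exact: cintegrableZ.
by apply/funext => x; rewrite mulN1r.
Qed.

Lemma cintegrableB f g : cintegrable f -> cintegrable g ->
  cintegrable (fun x => f x - g x).
Proof. by move=> fi /cintegrableN; exact: cintegrableD. Qed.

Lemma cintegralN f : cintegrable f ->
  cintegral Omega (fun x => - f x) = - cintegral Omega f.
Proof.
by move=> fi; rewrite -mulN1r -cintegralZ//; apply: eq_cintegral => x _; rewrite mulN1r.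
Qed.

Lemma cintegralB f g : cintegrable f -> cintegrable g ->
  cintegral Omega (fun x => f x - g x) = cintegral Omega f - cintegral Omega g.
Proof.
move=> fi gi; rewrite cintegralD//; last exact: cintegrableN.
by rewrite cintegralN.
Qed.

Lemma cintegrable_sum (I : Type) (s : seq I) (F : I -> 'rV[R]_n -> R[i]) :
  (forall i, cintegrable (F i)) -> cintegrable (fun x => \sum_(i <- s) F i x).
Proof.
move=> Fi; split.
- apply: eq_rint (rint_sum mO s (fun i => (Fi i).1)) => // x _.
  by rewrite Re_sum.
- apply: eq_rint (rint_sum mO s (fun i => (Fi i).2)) => // x _.
  by rewrite Im_sum.
Qed.

Lemma cintegral_sum (I : Type) (s : seq I) (F : I -> 'rV[R]_n -> R[i]) :
  (forall i, cintegrable (F i)) ->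
  cintegral Omega (fun x => \sum_(i <- s) F i x) = \sum_(i <- s) cintegral Omega (F i).
Proof.
move=> Fi; apply: complexP; rewrite ?Re_sum ?Im_sum /cintegral /=.
- rewrite -Rintegral_sum//; last by move=> i; exact: (Fi i).1.
  by apply: eq_Rintegral => x _; rewrite Re_sum.
- rewrite -Rintegral_sum//; last by move=> i; exact: (Fi i).2.
  by apply: eq_Rintegral => x _; rewrite Im_sum.
Qed.

Lemma cmeasurable_normc u : cmeasurable_fun Omega u ->
  measurable_fun Omega (fun x => normc (u x)).
Proof.
move=> [mR mI].
rewrite (_ : (fun _ => _) = Num.sqrt \o (fun x => Re (u x) ^+ 2 + Im (u x) ^+ 2)).
  apply: measurableT_comp.
    by apply: continuous_measurable_fun; exact: sqrt_continuous.
  by apply: measurable_funD; exact: measurable_funX.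
by apply/funext => x /=; case: (u x).
Qed.

Lemma cmeasurableD u v : cmeasurable_fun Omega u -> cmeasurable_fun Omega v ->
  cmeasurable_fun Omega (fun x => u x + v x).
Proof.
move=> [a b] [c d]; split.
- by under eq_fun do rewrite ReD; exact: measurable_funD.
- by under eq_fun do rewrite ImD; exact: measurable_funD.
Qed.

Lemma cmeasurableM u v : cmeasurable_fun Omega u -> cmeasurable_fun Omega v ->
  cmeasurable_fun Omega (fun x => u x * v x).
Proof.
move=> [a b] [c d]; split.
- under eq_fun do rewrite ReM; apply: measurable_funB; exact: measurable_funM.
- under eq_fun do rewrite ImM; apply: measurable_funD; exact: measurable_funM.
Qed.

Lemma cmeasurable_cst c : cmeasurable_fun Omega (fun=> c).
Proof. by split; exact: measurable_cst. Qed.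

Lemma cmeasurableZ c u : cmeasurable_fun Omega u ->
  cmeasurable_fun Omega (fun x => c * u x).
Proof. by move=> mu; apply: cmeasurableM => //; exact: cmeasurable_cst. Qed.

Lemma cmeasurableB u v : cmeasurable_fun Omega u -> cmeasurable_fun Omega v ->
  cmeasurable_fun Omega (fun x => u x - v x).
Proof.
move=> mu /(cmeasurableZ (-1)) mv.
rewrite (_ : (fun _ => _) = fun x => u x + (-1) * v x); first exact: cmeasurableD.
by apply/funext => x; rewrite mulN1r.
Qed.

Lemma cmeasurableJ u : cmeasurable_fun Omega u ->
  cmeasurable_fun Omega (fun x => (u x)^*).
Proof.
move=> [a b]; split.
- by under eq_fun do rewrite ReJ.
- by under eq_fun do rewrite ImJ; exact: measurableT_comp.
Qed.

Lemma cmeasurable_real (r : 'rV[R]_n -> R) : measurable_fun Omega r ->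
  cmeasurable_fun Omega (fun x => (r x)%:C).
Proof. by move=> mr; split => //; exact: measurable_cst. Qed.

Lemma cintegrable_le u (g : 'rV[R]_n -> R) : cmeasurable_fun Omega u ->
  (forall x, Omega x -> normc (u x) <= g x) ->
  mu.-integrable Omega (EFin \o g) -> cintegrable u.
Proof.
move=> [mR mI] ug gi; split.
- by apply: rint_le gi => // x Ox; rewrite (le_trans (Re_le_normc _))// ug.
- by apply: rint_le gi => // x Ox; rewrite (le_trans (Im_le_normc _))// ug.
Qed.

Lemma cintegrable_cmeasurable u : cintegrable u -> cmeasurable_fun Omega u.
Proof. by move=> [/rint_measurable a /rint_measurable b]. Qed.

End complex_integral.

(** * Test functions and weak derivatives *)

Section test_functions.
Context {R : realType} {n : nat} (Omega : set 'rV[R]_n).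
Hypothesis oO : open Omega.
Local Notation mu := (lebesgue_rV n).
Implicit Types u v g phi psi : 'rV[R]_n -> R[i].

Let mO : measurable Omega := open_measurable_rV oO.

Definition csmooth phi := smooth (fun x => Re (phi x)) /\ smooth (fun x => Im (phi x)).

Lemma csmoothD phi psi : csmooth phi -> csmooth psi -> csmooth (fun x => phi x + psi x).
Proof.
move=> [a b] [c d]; split.
- by under eq_fun do rewrite ReD; exact: smoothD.
- by under eq_fun do rewrite ImD; exact: smoothD.
Qed.

Lemma csmoothM phi psi : csmooth phi -> csmooth psi -> csmooth (fun x => phi x * psi x).
Proof.
move=> [a b] [c d]; split.
- by under eq_fun do rewrite ReM; apply: smoothB; exact: smoothM.
- by under eq_fun do rewrite ImM; apply: smoothD; exact: smoothM.
Qed.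

Lemma csmooth_cst c : csmooth (fun=> c).
Proof. by split; exact: smooth_cst. Qed.

Lemma csmooth_real (f : 'rV[R]_n -> R) : smooth f -> csmooth (fun x => (f x)%:C).
Proof. by move=> sf; split; [exact: sf|exact: smooth_cst]. Qed.

Lemma test_csmooth phi : test_function Omega phi -> csmooth phi.
Proof. by case. Qed.

Lemma test_cmeasurable phi : test_function Omega phi -> cmeasurable_fun Omega phi.
Proof.
move=> [/smooth_continuous a /smooth_continuous b _]; split.
  exact: continuous_measurable_rV mO a.
exact: continuous_measurable_rV mO b.
Qed.

Lemma testM phi psi : csmooth phi -> test_function Omega psi ->
  test_function Omega (fun x => phi x * psi x).
Proof.
move=> sphi tpsi; have [a b] := csmoothM sphi (test_csmooth tpsi); split=> //.
have [_ _ [K [cK KO K0]]] := tpsi; exists K; split=> // x /K0 ->.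
by rewrite mulr0.
Qed.

Lemma testZ c psi : test_function Omega psi -> test_function Omega (fun x => c * psi x).
Proof. by apply: testM; exact: csmooth_cst. Qed.

Lemma testD phi psi : test_function Omega phi -> test_function Omega psi ->
  test_function Omega (fun x => phi x + psi x).
Proof.
move=> tphi tpsi; have [a b] := csmoothD (test_csmooth tphi) (test_csmooth tpsi).
split=> //; have [_ _ [K [cK KO K0]]] := tphi; have [_ _ [L [cL LO L0]]] := tpsi.
exists (K `|` L); split; first exact: compactU.
- by move=> x [/KO|/LO].
- by move=> x /not_orP[/K0 -> /L0 ->]; rewrite addr0.
Qed.

Lemma testB phi psi : test_function Omega phi -> test_function Omega psi ->
  test_function Omega (fun x => phi x - psi x).
Proof.
move=> tphi /(testZ (-1)) tpsi; under eq_fun do rewrite -mulN1r; exact: testD.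
Qed.

Lemma testJ phi : test_function Omega phi -> test_function Omega (fun x => (phi x)^*).
Proof.
move=> [a b [K [cK KO K0]]]; split.
- by under eq_fun do rewrite ReJ; exact: a.
- by under eq_fun do rewrite ImJ; exact: smoothN b.
- by exists K; split=> // x /K0 ->; rewrite conjc0.
Qed.

Lemma partial_out i (f : 'rV[R]_n -> R) (K : set 'rV[R]_n) : closed K ->
  (forall x, ~ K x -> f x = 0) -> forall x, ~ K x -> partial i f x = 0.
Proof.
move=> cK f0 x nKx; rewrite /partial -(derive_cst (0 : R) x 'e_i).
apply: near_eq_derive; rewrite -/(nbhs x _).
have : nbhs x (~` K) by apply: open_nbhs_nbhs; split => //; exact: closed_openC.
by apply: filterS => y; exact: f0.
Qed.

Lemma test_cpartial i phi : test_function Omega phi ->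
  test_function Omega (cpartial i phi).
Proof.
move=> [a b [K [cK KO K0]]]; split; rewrite ?/cpartial/=.
- exact: (smooth_partial i a).
- exact: (smooth_partial i b).
- exists K; split=> // x nKx; rewrite /cpartial.
  have clK := compact_closed_rV cK.
  by rewrite !(partial_out i clK)// => y /K0 ->.
Qed.

Lemma L1_loc_rint u (K : set 'rV[R]_n) : L1_loc Omega u -> compact K -> K `<=` Omega ->
  [/\ mu.-integrable K (EFin \o (fun x => Re (u x))),
      mu.-integrable K (EFin \o (fun x => Im (u x))) &
      mu.-integrable K (EFin \o (fun x => normc (u x)))].
Proof.
move=> [mu uK] cK KO; have mK := compact_measurable_rV cK.
have [mR mI] : cmeasurable_fun K u.
  by have [a b] := mu; split; exact: measurable_funS KO _.
have ni : (lebesgue_rV n).-integrable K (EFin \o (fun x => normc (u x))).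
  apply/rintP; split; first exact: cmeasurable_normc.
  by under eq_integral do rewrite ger0_norm ?normc_ge0//; exact: uK.
by split=> //; apply: rint_le ni => // x _; [exact: Re_le_normc|exact: Im_le_normc].
Qed.

Lemma L1_loc_le u (g : 'rV[R]_n -> R) : cmeasurable_fun Omega u ->
  (forall x, Omega x -> normc (u x) <= g x) ->
  (forall K, compact K -> K `<=` Omega -> mu.-integrable K (EFin \o g)) ->
  L1_loc Omega u.
Proof.
move=> mu ug gi; split=> // K cK KO; have mK := compact_measurable_rV cK.
have : (lebesgue_rV n).-integrable K (EFin \o (fun x => normc (u x))).
  apply: rint_le (gi K cK KO) => //.
    by apply: cmeasurable_normc => //; have [a b] := mu; split; exact: measurable_funS KO _.
  by move=> x /KO Ox; rewrite ger0_norm ?normc_ge0// ug.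
by move=> /rintP[_]; under eq_integral do rewrite ger0_norm ?normc_ge0//.
Qed.

Lemma L1_locD u v : L1_loc Omega u -> L1_loc Omega v -> L1_loc Omega (fun x => u x + v x).
Proof.
move=> lu lv; apply: (L1_loc_le (g := fun x => normc (u x) + normc (v x))).
- by apply: cmeasurableD => //; [case: lu|case: lv].
- by move=> x _; have := normcB_le (u x) (- v x); rewrite opprK normcN.
- move=> K cK KO; have mK := compact_measurable_rV cK.
  by apply: rintD => //; [have [] := L1_loc_rint lu cK KO|have [] := L1_loc_rint lv cK KO].
Qed.

Lemma L1_locZ c u : L1_loc Omega u -> L1_loc Omega (fun x => c * u x).
Proof.
move=> lu; apply: (L1_loc_le (g := fun x => normc c * normc (u x))).
- by apply: cmeasurableZ => //; case: lu.
- by move=> x _; rewrite ComplexField.Normc.normcM.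
- move=> K cK KO; have mK := compact_measurable_rV cK.
  by apply: rintZ => //; have [] := L1_loc_rint lu cK KO.
Qed.

Lemma L1_locB u v : L1_loc Omega u -> L1_loc Omega v -> L1_loc Omega (fun x => u x - v x).
Proof.
move=> lu /(L1_locZ (-1)) lv; under eq_fun do rewrite -mulN1r; exact: L1_locD.
Qed.

Lemma test_L1_loc phi : test_function Omega phi -> L1_loc Omega phi.
Proof.
move=> tphi; have mphi := test_cmeasurable tphi.
have [a b [K [cK KO K0]]] := tphi.
have mK := compact_measurable_rV cK.
apply: (L1_loc_le (g := fun x => `|Re (phi x)| + `|Im (phi x)|)) => //.
  by move=> x _; exact: normc_le_ReIm.
move=> L cL LO; have mL := compact_measurable_rV cL.
apply: rintD => //; apply: rint_norm.
- have [M M0 fM] : exists2 M : R, 0 <= M & forall x, `|Re (phi x)| <= M.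
    apply: (continuous_bounded_support cK); first exact: smooth_continuous.
    by move=> x /K0 ->.
  apply: (rint_bounded_support (M := M) mL cK) => //.
    by apply: continuous_measurable_rV => //; exact: smooth_continuous.
  by move=> x _ /K0 ->.
- have [M M0 fM] : exists2 M : R, 0 <= M & forall x, `|Im (phi x)| <= M.
    apply: (continuous_bounded_support cK); first exact: smooth_continuous.
    by move=> x /K0 ->.
  apply: (rint_bounded_support (M := M) mL cK) => //.
    by apply: continuous_measurable_rV => //; exact: smooth_continuous.
  by move=> x _ /K0 ->.
Qed.

Lemma cintegrable_test u phi : L1_loc Omega u -> test_function Omega phi ->
  cintegrable Omega (fun x => u x * phi x).
Proof.
move=> lu [a b [K [cK KO K0]]].
have [mR mI] : cmeasurable_fun Omega u by case: lu.
have [iR iI _] := L1_loc_rint lu cK KO.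
have H (f h : 'rV[R]_n -> R) : measurable_fun Omega f ->
    mu.-integrable K (EFin \o f) -> smooth h -> (forall x, ~ K x -> h x = 0) ->
    mu.-integrable Omega (EFin \o (fun x => f x * h x)).
  move=> mf fi sh h0; have ch := smooth_continuous sh.
  have [M M0 hM] := continuous_bounded_support cK ch h0.
  by apply: (rint_mul_bounded_support (M := M) mO cK) => //; exact: continuous_measurable_rV.
have Re0 x : ~ K x -> Re (phi x) = 0 by move=> /K0 ->.
have Im0 x : ~ K x -> Im (phi x) = 0 by move=> /K0 ->.
split.
- by under eq_fun do rewrite ReM; apply: rintB => //; exact: H.
- by under eq_fun do rewrite ImM; apply: rintD => //; exact: H.
Qed.

Let rint_smooth_mul (p q : 'rV[R]_n -> R) (K : set 'rV[R]_n) : compact K ->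
  smooth p -> smooth q -> (forall x, ~ K x -> p x = 0) ->
  mu.-integrable Omega (EFin \o (fun x => p x * q x)).
Proof.
move=> cK sp sq p0.
have spq := smoothM sp sq.
have pq0 x : ~ K x -> p x * q x = 0 by move=> /p0 ->; rewrite mul0r.
have [M M0 hM] := continuous_bounded_support cK (smooth_continuous spq) pq0.
apply: (rint_bounded_support (M := M) mO cK) => //; last by move=> x _; exact: pq0.
by apply: continuous_measurable_rV => //; exact: smooth_continuous.
Qed.

(** The product [f h] inherits the compact support of [f], so its derivative has zero integral over
    the whole space, and [h] may be any smooth function. *)
Lemma Rintegral_parts (f h : 'rV[R]_n -> R) (i : 'I_n) (K : set 'rV[R]_n) :
  smooth f -> smooth h -> compact K -> K `<=` Omega ->
  (forall x, ~ K x -> f x = 0) ->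
  \int[mu]_(x in Omega) (f x * partial i h x) = - \int[mu]_(x in Omega) (partial i f x * h x).
Proof.
move=> sf sh cK KO f0.
have clK := compact_closed_rV cK.
have pf0 := partial_out i clK f0.
have I1 := rint_smooth_mul cK sf (smooth_partial i sh) f0.
have I2 := rint_smooth_mul cK (smooth_partial i sf) sh pf0.
apply/eqP; rewrite -addr_eq0 -(RintegralD mO I1 I2).
have sfh := smoothM sf sh.
have fh0 x : ~ K x -> f x * h x = 0 by move=> /f0 ->; rewrite mul0r.
have := integral_partial (i := i) (smooth_continuous sfh)
  (fun x => @smooth_derivable R n _ i x sfh) (smooth_continuous (smooth_partial i sfh)) cK fh0
  (partial_out i clK fh0).
move=> I0; rewrite Rintegral_mkcond /Rintegral -[X in _ == X]/(fine 0%E) -I0.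
apply/eqP; congr fine; apply: eq_integral => x _; congr EFin.
rewrite patchE partialM; try exact: smooth_derivable.
case: ifPn => [_|/negP xO]; first by rewrite [h x * _]mulrC.
have nKx : ~ K x by move=> /KO Ox; apply: xO; exact: mem_set.
by rewrite f0// pf0// mul0r mulr0 addr0.
Qed.

Lemma cintegral_parts i phi psi : test_function Omega phi -> test_function Omega psi ->
  cintegral Omega (fun x => phi x * cpartial i psi x) =
  - cintegral Omega (fun x => cpartial i phi x * psi x).
Proof.
move=> tphi tpsi.
have [a b [K [cK KO K0]]] := tphi; have [c d _] := tpsi.
have Re0 x : ~ K x -> Re (phi x) = 0 by move=> /K0 ->.
have Im0 x : ~ K x -> Im (phi x) = 0 by move=> /K0 ->.
have clK := compact_closed_rV cK.
have pRe0 := partial_out i clK Re0.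
have pIm0 := partial_out i clK Im0.
have I1 := rint_smooth_mul cK a (smooth_partial i c) Re0.
have I2 := rint_smooth_mul cK b (smooth_partial i d) Im0.
have I3 := rint_smooth_mul cK a (smooth_partial i d) Re0.
have I4 := rint_smooth_mul cK b (smooth_partial i c) Im0.
have J1 := rint_smooth_mul cK (smooth_partial i a) c pRe0.
have J2 := rint_smooth_mul cK (smooth_partial i b) d pIm0.
have J3 := rint_smooth_mul cK (smooth_partial i a) d pRe0.
have J4 := rint_smooth_mul cK (smooth_partial i b) c pIm0.
apply: complexP; rewrite ?ReN ?ImN /cintegral/=.
- transitivity (\int[mu]_(x in Omega) (Re (phi x) * partial i (fun y => Re (psi y)) x -
      Im (phi x) * partial i (fun y => Im (psi y)) x)).
    by apply: eq_Rintegral => x _; rewrite ReM.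
  rewrite (RintegralB mO I1 I2) (Rintegral_parts i a c cK KO Re0) (Rintegral_parts i b d cK KO Im0).
  rewrite -opprD -(RintegralB mO J1 J2); congr (- _).
  by apply: eq_Rintegral => x _; rewrite ReM.
- transitivity (\int[mu]_(x in Omega) (Re (phi x) * partial i (fun y => Im (psi y)) x +
      Im (phi x) * partial i (fun y => Re (psi y)) x)).
    by apply: eq_Rintegral => x _; rewrite ImM.
  rewrite (RintegralD mO I3 I4) (Rintegral_parts i a d cK KO Re0) (Rintegral_parts i b c cK KO Im0).
  rewrite -opprD -(RintegralD mO J3 J4); congr (- _).
  by apply: eq_Rintegral => x _; rewrite ImM.
Qed.

(** Real-valued test functions separate the real part of [g] from its imaginary part. *)
Lemma fundamental_lemma_complex g : L1_loc Omega g ->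
  (forall phi, test_function Omega phi -> cintegral Omega (fun x => g x * phi x) = 0) ->
  ae_eq_on Omega g (fun=> 0).
Proof.
move=> lg g0; have [mR mI] : cmeasurable_fun Omega g by case: lg.
have H (f : 'rV[R]_n -> R) : smooth f ->
    (exists K, [/\ compact K, K `<=` Omega & forall x, ~ K x -> f x = 0]) ->
    \int[mu]_(x in Omega) (Re (g x) * f x) = 0 /\
    \int[mu]_(x in Omega) (Im (g x) * f x) = 0.
  move=> sf [K [cK KO K0]].
  have : test_function Omega (fun x => (f x)%:C).
    have [p q] := csmooth_real sf; split=> //; exists K; split=> // x /K0 -> //.
  move=> /g0; rewrite /cintegral => -[h1 h2]; split.
    by rewrite -[RHS]h1; apply: eq_Rintegral => x _; rewrite ReM mulr0 subr0.
  by rewrite -[RHS]h2; apply: eq_Rintegral => x _; rewrite ImM mulr0 add0r.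
have hR : {ae mu, forall x, Omega x -> Re (g x) = 0}.
  apply: fundamental_lemma => // [K cK KO|f sf fK]; first by have [] := L1_loc_rint lg cK KO.
  by have [] := H f sf fK.
have hI : {ae mu, forall x, Omega x -> Im (g x) = 0}.
  apply: fundamental_lemma => // [K cK KO|f sf fK]; first by have [] := L1_loc_rint lg cK KO.
  by have [] := H f sf fK.
apply: filterS2 hR hI => x hr hi Ox.
by apply: complexP; [exact: hr|exact: hi].
Qed.

Lemma weak_partial_unique i u g g' : weak_partial Omega i u g ->
  weak_partial Omega i u g' -> ae_eq_on Omega g g'.
Proof.
move=> [_ lg ug] [_ lg' ug'].
have : ae_eq_on Omega (fun x => g x - g' x) (fun=> 0).
  apply: fundamental_lemma_complex; first exact: L1_locB.
  move=> phi tphi.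
  rewrite (eq_cintegral (g := fun x => g x * phi x - g' x * phi x)); last first.
    by move=> x _; rewrite mulrBl.
  rewrite cintegralB//; try exact: cintegrable_test.
  by apply/eqP; rewrite subr_eq0 -eqr_opp -ug// -ug'.
by apply: filterS => x h Ox; apply/eqP; rewrite -subr_eq0 h.
Qed.

Lemma weak_partial_test i phi : test_function Omega phi ->
  weak_partial Omega i phi (cpartial i phi).
Proof.
move=> tphi; split; first exact: test_L1_loc.
- exact/test_L1_loc/test_cpartial.
- by move=> psi tpsi; exact: cintegral_parts.
Qed.

Lemma weak_partialB i u v g h : weak_partial Omega i u g -> weak_partial Omega i v h ->
  weak_partial Omega i (fun x => u x - v x) (fun x => g x - h x).
Proof.
move=> [lu lg ug] [lv lh vh]; split; [exact: L1_locB|exact: L1_locB|] => phi tphi.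
have tp := test_cpartial i tphi.
under eq_cintegral do rewrite mulrBl.
under [in RHS]eq_cintegral do rewrite mulrBl.
by rewrite !cintegralB ?ug ?vh ?opprB//; first (by rewrite opprK addrC); exact: cintegrable_test.
Qed.

Lemma weak_partialZ i c u g : weak_partial Omega i u g ->
  weak_partial Omega i (fun x => c * u x) (fun x => c * g x).
Proof.
move=> [lu lg ug]; split; [exact: L1_locZ|exact: L1_locZ|] => phi tphi.
have tp := test_cpartial i tphi.
under eq_cintegral do rewrite -mulrA.
under [in RHS]eq_cintegral do rewrite -mulrA.
by rewrite !cintegralZ ?ug ?mulrN//; exact: cintegrable_test.
Qed.

Lemma wpartialP i u g : weak_partial Omega i u g ->
  weak_partial Omega i u (wpartial Omega i u).
Proof. by move=> ug; rewrite /wpartial; apply: xgetPex; exists g. Qed.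

Lemma wpartial_ae i u g : weak_partial Omega i u g -> ae_eq_on Omega (wpartial Omega i u) g.
Proof. by move=> ug; exact: weak_partial_unique (wpartialP ug) ug. Qed.

End test_functions.

(** * Lebesgue spaces and the nonlinearity *)

Section Lp_spaces.
Context {R : realType} {n : nat} (Omega : set 'rV[R]_n).
Hypothesis mO : measurable Omega.
Local Notation mu := (lebesgue_rV n).
Implicit Types u v : 'rV[R]_n -> R[i].

Lemma LpE (p : R) u : Lp Omega p u <-> cmeasurable_fun Omega u /\
  mu.-integrable Omega (EFin \o (fun x => normc (u x) `^ p)).
Proof.
split=> -[mu ui]; split=> //.
  apply/rintP; split.
    apply: (measurableT_comp (measurable_powR p)); exact: cmeasurable_normc.
  by under eq_integral do rewrite ger0_norm ?powR_ge0//.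
by move/rintP : ui => [_]; under eq_integral do rewrite ger0_norm ?powR_ge0//.
Qed.

Lemma Lp2E u : Lp Omega 2 u <-> cmeasurable_fun Omega u /\
  mu.-integrable Omega (EFin \o (fun x => normc (u x) ^+ 2)).
Proof.
rewrite LpE; split=> -[mu ui]; split=> //; apply: eq_rint ui => // x _.
  by rewrite powR_mulrn// normc_ge0.
by rewrite powR_mulrn// normc_ge0.
Qed.

Lemma Lp_ae (p : R) u v : cmeasurable_fun Omega v -> ae_eq_on Omega v u ->
  Lp Omega p u -> Lp Omega p v.
Proof.
move=> mv vu [mu ui]; split=> //; rewrite (@ae_eq_integral _ _ _ (lebesgue_rV n) Omega
  (fun x => (normc (u x) `^ p)%:E))//.
- apply/measurable_EFinP/(measurableT_comp (measurable_powR p)).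
  exact: cmeasurable_normc.
- apply/measurable_EFinP/(measurableT_comp (measurable_powR p)).
  exact: cmeasurable_normc.
- by apply: filterS vu => x + Ox => /(_ Ox) ->.
Qed.

Lemma powR_add_le (p s t : R) : 0 <= p -> 0 <= s -> 0 <= t ->
  (s + t) `^ p <= 2 `^ p * (s `^ p + t `^ p).
Proof.
move=> p0; wlog st : s t / s <= t => [H s0 t0|s0 t0].
  have /orP[st|ts] := le_total s t; first exact: H.
  by rewrite addrC [X in _ * X]addrC; exact: H.
apply: (@le_trans _ _ ((2 * t) `^ p)).
  by apply: ge0_ler_powR; rewrite ?nnegrE ?addr_ge0 ?mulr_ge0//; lra.
by rewrite powRM// ler_wpM2l ?powR_ge0// lerDr powR_ge0.
Qed.

Lemma LpB (p : R) u v : 0 <= p -> Lp Omega p u -> Lp Omega p v ->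
  Lp Omega p (fun x => u x - v x).
Proof.
move=> p0 /LpE[mu ui] /LpE[mv vi]; apply/LpE; split; first exact: cmeasurableB.
apply: rint_le (rintZ mO (2 `^ p) (rintD mO ui vi)) => // [|x Ox].
  apply: (measurableT_comp (measurable_powR p)); apply: cmeasurable_normc => //.
  exact: cmeasurableB.
rewrite ger0_norm ?powR_ge0//; apply: le_trans (powR_add_le _ _ _) => //; try exact: normc_ge0.
by apply: ge0_ler_powR => //; rewrite ?nnegrE ?addr_ge0 ?normc_ge0 ?normcB_le.
Qed.

Lemma LpZ (p : R) c u : Lp Omega p u -> Lp Omega p (fun x => c * u x).
Proof.
move=> /LpE[mu ui]; apply/LpE; split; first exact: cmeasurableZ.
apply: eq_rint (rintZ mO (normc c `^ p) ui) => // x _.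
by rewrite ComplexField.Normc.normcM powRM// normc_ge0.
Qed.

Lemma Lp2_mul u v : Lp Omega 2 u -> Lp Omega 2 v ->
  mu.-integrable Omega (EFin \o (fun x => normc (u x) * normc (v x))).
Proof.
move=> /Lp2E[mu ui] /Lp2E[mv vi]; apply: rint_le (rintD mO ui vi) => // [|x _].
  by apply: measurable_funM; exact: cmeasurable_normc.
rewrite ger0_norm ?mulr_ge0 ?normc_ge0//.
set s := normc _; set t := normc _.
have := sqr_ge0 (s - t); have : 0 <= s by exact: normc_ge0.
have : 0 <= t by exact: normc_ge0.
by nra.
Qed.

Lemma cintegrable_Lp2 u v : Lp Omega 2 u -> Lp Omega 2 v ->
  cintegrable Omega (fun x => u x * (v x)^*).
Proof.
move=> lu lv; apply: cintegrable_le (Lp2_mul lu lv) => //.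
- by apply: cmeasurableM; [case: lu|apply: cmeasurableJ; case: lv].
- by move=> x _; rewrite ComplexField.Normc.normcM normcJ.
Qed.

Lemma L1_loc_Lp2 u : open Omega -> Lp Omega 2 u -> L1_loc Omega u.
Proof.
move=> oO /Lp2E[mu ui]; apply: (@L1_loc_le _ _ _ oO u (fun x => 1 + normc (u x) ^+ 2)) => //.
- move=> x _; have := sqr_ge0 (normc (u x) - 1).
  by have := normc_ge0 (u x); nra.
- move=> K cK KO; have mK := compact_measurable_rV cK.
  by apply: rintD => //; [exact: rint_compact_cst|exact: integrableS ui].
Qed.

End Lp_spaces.

Section nonlinearity.
Context {R : realType} (m : R).
Hypothesis m0 : 0 < m.
Implicit Types z : R[i].

Lemma nonlin0 : nonlin m (0 : R[i]) = 0.
Proof. by rewrite /nonlin mulr0. Qed.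

Lemma normc_nonlin z : normc (nonlin m z) = normc z `^ m.
Proof.
(* At 0 both sides vanish, whatever the negative power is there; the right-hand side does so because
   [m] is positive. Elsewhere the exponents [-(1-m)] and 1 add up to [m]. *)
have [->|z0] := eqVneq z 0.
  by rewrite nonlin0 !ComplexField.Normc.normc0 powR0// gt_eqF.
have nz : 0 < normc z.
  rewrite lt_neqAle normc_ge0 andbT eq_sym; apply/negP => /eqP/ComplexField.Normc.eq0_normc h.
  by rewrite h eqxx in z0.
rewrite /nonlin ComplexField.Normc.normcM normc_real ger0_norm ?powR_ge0//.
rewrite -[X in _ * X]powRr1 ?ltW// -powRD; last by apply/implyP => _; rewrite gt_eqF.
by congr (_ `^ _); ring.
Qed.

(** With [r], [s] the moduli and [p] the real inner product, the expression equals [(r^m - s^m) (r -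
    s) + (al + be) (r s - p)]. The first term is nonnegative by radial monotonicity, the second by
    Cauchy-Schwarz. If the sum is 0, then [r = s] and [p = r s], so
    [|z1 - z2|^2 = r^2 + s^2 - 2 p = 0]. *)
Lemma nonlin_monotone z1 z2 : 0 <= Re ((nonlin m z1 - nonlin m z2) * (z1 - z2)^*) /\
  (Re ((nonlin m z1 - nonlin m z2) * (z1 - z2)^*) = 0 -> z1 = z2).
Proof.
pose r := normc z1; pose s := normc z2.
pose al := r `^ (- (1 - m)); pose be := s `^ (- (1 - m)).
pose p := Re (z1 * z2^*).
have r0 : 0 <= r by exact: normc_ge0.
have s0 : 0 <= s by exact: normc_ge0.
have al0 : 0 <= al by exact: powR_ge0.
have be0 : 0 <= be by exact: powR_ge0.
have alr : al * r = r `^ m.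
  by rewrite -normc_nonlin ComplexField.Normc.normcM normc_real ger0_norm.
have bes : be * s = s `^ m.
  by rewrite -normc_nonlin ComplexField.Normc.normcM normc_real ger0_norm.
have prs : p <= r * s.
  rewrite (le_trans (ler_norm _))// (le_trans (Re_le_normc _))//.
  by rewrite ComplexField.Normc.normcM normcJ.
have dE : normc (z1 - z2) ^+ 2 = r ^+ 2 + s ^+ 2 - 2 * p.
  by rewrite !sqr_normcE /p !complexE; ring.
have -> : Re ((nonlin m z1 - nonlin m z2) * (z1 - z2)^*) =
    (r `^ m - s `^ m) * (r - s) + (al + be) * (r * s - p).
  rewrite -alr -bes.
  have -> : (al * r - be * s) * (r - s) + (al + be) * (r * s - p) =
    al * r ^+ 2 + be * s ^+ 2 - (al + be) * p by ring.
  by rewrite !sqr_normcE /p /nonlin -/r -/s -/al -/be !complexE; ring.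
have mono (t t' : R) : 0 <= t -> t < t' -> t `^ m < t' `^ m.
  by move=> t0 tt'; apply: gt0_ltr_powR; rewrite ?nnegrE// (le_trans t0)// ltW.
have h1 : 0 <= (r `^ m - s `^ m) * (r - s) /\
    ((r `^ m - s `^ m) * (r - s) = 0 -> r = s).
  have [rs|sr|<-] := ltgtP r s; last by rewrite !subrr mul0r.
  - have := mono _ _ r0 rs => ms.
    have : 0 < (r `^ m - s `^ m) * (r - s) by rewrite nmulr_rgt0 subr_lt0.
    by move=> h; split; [exact: ltW|move=> e; rewrite e ltxx in h].
  - have := mono _ _ s0 sr => ms.
    have : 0 < (r `^ m - s `^ m) * (r - s) by rewrite mulr_gt0// subr_gt0.
    by move=> h; split; [exact: ltW|move=> e; rewrite e ltxx in h].
have h2 : 0 <= (al + be) * (r * s - p) by apply: mulr_ge0; [exact: addr_ge0|rewrite subr_ge0].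
have [h10 h1e] := h1.
split=> [|/eqP]; first by rewrite addr_ge0.
rewrite paddr_eq0// => /andP[/eqP/h1e rs /eqP e2].
(* The weight [al] is known to be positive only for [r > 0]; for [r = 0] the equality [r = s]
   already makes both numbers 0. *)
have [r00|rn0] := eqVneq r 0.
  have /ComplexField.Normc.eq0_normc -> : normc z1 = 0 by [].
  by have /ComplexField.Normc.eq0_normc -> : normc z2 = 0 by rewrite -/s -rs.
have rgt : 0 < r by rewrite lt_neqAle eq_sym rn0.
have algt : 0 < al by exact: powR_gt0.
have pe : r * s - p = 0.
  by move/eqP: e2; rewrite mulf_eq0 gt_eqF ?orFb ?ltr_wpDr// => /eqP.
apply/eqP; rewrite -subr_eq0; apply/eqP/ComplexField.Normc.eq0_normc/eqP.
rewrite -sqrf_eq0 dE -rs.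
rewrite -rs in pe.
by apply/eqP; move: pe; lra.
Qed.

End nonlinearity.

(** * The multiplier *)

Section multiplier.
Context {R : realType} (m : R) (a b c : R[i]).
Hypothesis m0 : 0 < m.

Definition difference_term (z1 z2 : R[i]) (v : R) : R[i] :=
  a * (nonlin m z1 - nonlin m z2) + b * (z1 - z2) + c * v%:C ^+ 2 * (z1 - z2).

Definition energy (lam z1 z2 : R[i]) (v : R) : R :=
  Re (lam^* * (difference_term z1 z2 v * (z1 - z2)^*)).

(** Monotonicity controls only the real part of the nonlinear pairing. A real [lam^* a] keeps its
    imaginary part, which has no sign, out of the energy. *)
Let energyE (lam z1 z2 : R[i]) (v : R) : Im (lam^* * a) = 0 ->
  energy lam z1 z2 v =
    Re (lam^* * a) * Re ((nonlin m z1 - nonlin m z2) * (z1 - z2)^*) +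
    (Re (lam^* * b) + Re (lam^* * c) * v ^+ 2) * normc (z1 - z2) ^+ 2.
Proof.
move=> ima; rewrite /energy /difference_term.
set P := nonlin m z1 - nonlin m z2; set w := z1 - z2.
have -> : lam^* * ((a * P + b * w + c * v%:C ^+ 2 * w) * w^*) =
  (lam^* * a) * (P * w^*) + (lam^* * b + lam^* * c * v%:C ^+ 2) * (w * w^*) by ring.
have -> : w * w^* = (normc w ^+ 2)%:C.
  by apply: complexP; rewrite ?sqr_normcE !complexE; ring.
have -> : v%:C ^+ 2 = (v ^+ 2)%:C by rewrite rmorphXn.
rewrite ReD (ReM (lam^* * a)) ima mul0r subr0 (ReM _ (normc w ^+ 2)%:C).
by rewrite Im_real mulr0 subr0 ReD (ReM _ (v ^+ 2)%:C) !Re_real Im_real mulr0 subr0.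
Qed.

(** Strictness cannot rest on the coefficient of [c], since [v] may be 0. It comes from the term in
    [a] through strict monotonicity, or from the term in [b] through [|z1 - z2|^2]. For the choice
    [lam = c], it is [k > 0] that makes [lam^* a] positive. *)
Let energyP (lam : R[i]) : Im (lam^* * a) = 0 -> 0 <= Re (lam^* * a) ->
  0 <= Re (lam^* * b) -> 0 <= Re (lam^* * c) ->
  0 < Re (lam^* * a) \/ 0 < Re (lam^* * b) ->
  forall z1 z2 v, 0 <= energy lam z1 z2 v /\ (energy lam z1 z2 v = 0 -> z1 = z2).
Proof.
move=> ima a0 b0 c0 ab z1 z2 v; rewrite energyE//.
have [P0 Pe] := nonlin_monotone m0 z1 z2.
have h2 : 0 <= (Re (lam^* * b) + Re (lam^* * c) * v ^+ 2) * normc (z1 - z2) ^+ 2.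
  by rewrite mulr_ge0 ?sqr_ge0// addr_ge0// mulr_ge0// sqr_ge0.
have h1 := mulr_ge0 a0 P0.
split=> [|/eqP]; first exact: addr_ge0.
rewrite paddr_eq0// => /andP[/eqP e1 /eqP e2].
have [ag|bg] := ab.
  by apply: Pe; move/eqP: e1; rewrite mulf_eq0 gt_eqF// => /eqP.
have cg : 0 < Re (lam^* * b) + Re (lam^* * c) * v ^+ 2.
  by rewrite ltr_wpDr// mulr_ge0// sqr_ge0.
move/eqP: e2; rewrite mulf_eq0 gt_eqF//= sqrf_eq0 => /eqP/ComplexField.Normc.eq0_normc/eqP.
by rewrite subr_eq0 => /eqP.
Qed.

Let Re_conj_sqr (z : R[i]) : Re (z^* * z) = normc z ^+ 2.
Proof. by rewrite sqr_normcE !complexE; ring. Qed.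

Let normc_sqr_gt0 (z : R[i]) : z != 0 -> 0 < normc z ^+ 2.
Proof.
move=> z0; rewrite lt_neqAle sqr_ge0 andbT eq_sym sqrf_eq0.
by apply: contra z0 => /eqP/ComplexField.Normc.eq0_normc ->.
Qed.

Lemma exists_multiplier :
  [\/ [/\ a != 0, 0 <= Re a, 0 <= Re (a * b^*) & 0 <= Re (a * c^*)],
      [/\ b != 0, 0 <= Re b, exists2 k : R, 0 <= k & a = k%:C * b
        & 0 <= Re (b * c^*)]
    | [/\ c != 0, 0 <= Re c, exists2 k : R, 0 < k & a = k%:C * c
        & 0 <= Re (b * c^*)]] ->
  exists2 lam : R[i], 0 <= Re lam &
    forall z1 z2 v, 0 <= energy lam z1 z2 v /\ (energy lam z1 z2 v = 0 -> z1 = z2).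
Proof.
have ReJC (x y : R[i]) : Re (x^* * y) = Re (x * y^*) by rewrite !complexE; ring.
case=> [[a0 ra ab ac]|[b0 rb [k k0 ak] bc]|[c0 rc [k k0 ak] bc]].
- exists a => //; apply: energyP; rewrite ?Re_conj_sqr ?ReJC ?sqr_ge0//.
  + by rewrite !complexE; ring.
  + by left; exact: normc_sqr_gt0.
- have aE : b^* * a = (k * normc b ^+ 2)%:C.
    by rewrite ak; apply: complexP; rewrite ?sqr_normcE !complexE; ring.
  exists b => //; apply: energyP; rewrite ?aE ?Re_conj_sqr ?sqr_ge0//.
  + by rewrite Re_real mulr_ge0// sqr_ge0.
  + by rewrite ReJC.
  + by right; rewrite normc_sqr_gt0.
- have aE : c^* * a = (k * normc c ^+ 2)%:C.
    by rewrite ak; apply: complexP; rewrite ?sqr_normcE !complexE; ring.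
  exists c => //; apply: energyP; rewrite ?aE ?Re_conj_sqr ?sqr_ge0//.
  + by rewrite Re_real mulr_ge0 ?sqr_ge0// ltW.
  + by rewrite mulrC.
  + by left; rewrite Re_real mulr_gt0 ?normc_sqr_gt0.
Qed.

End multiplier.

(** * Integrability of the energy *)

Section difference.
Context {R : realType} {n : nat} (Omega : set 'rV[R]_n).
Variables (V : 'rV[R]_n -> R) (m : R) (a b c : R[i]).
Variables (u1 u2 : 'rV[R]_n -> R[i]).
Hypotheses (oO : open Omega) (m0 : 0 < m).
Hypotheses (hu1 : H1 Omega u1) (hu1m : Lp Omega (m + 1) u1)
  (hu2 : H1 Omega u2) (hu2m : Lp Omega (m + 1) u2)
  (hVu1 : Lp Omega 2 (Vmul V u1)) (hVu2 : Lp Omega 2 (Vmul V u2)).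
Local Notation mu := (lebesgue_rV n).
Implicit Types u v : 'rV[R]_n -> R[i].

Let mO : measurable Omega := open_measurable_rV oO.

Lemma cmeasurable_nonlin u : cmeasurable_fun Omega u ->
  cmeasurable_fun Omega (fun x => nonlin m (u x)).
Proof.
move=> mu; apply: cmeasurableM => //; apply: cmeasurable_real.
apply: (measurableT_comp (measurable_powR _)); exact: cmeasurable_normc.
Qed.

(** In place of the Hölder inequality, [s^m t] is bounded by the power [m + 1] of the larger of [s]
    and [t]. *)
Lemma cintegrable_nonlin u v : Lp Omega (m + 1) u -> Lp Omega (m + 1) v ->
  cintegrable Omega (fun x => nonlin m (u x) * (v x)^*).
Proof.
move=> /LpE[mu ui] /LpE[mv vi].
apply: cintegrable_le (rintD mO ui vi) => //.
  by apply: cmeasurableM; [exact: cmeasurable_nonlin|exact: cmeasurableJ].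
move=> x Ox; rewrite ComplexField.Normc.normcM normcJ normc_nonlin//.
set s := normc (u x); set t := normc (v x).
have s0 : 0 <= s by exact: normc_ge0.
have t0 : 0 <= t by exact: normc_ge0.
have pE (r : R) : 0 <= r -> r `^ (m + 1) = r `^ m * r.
  move=> r0; rewrite powRD ?powRr1//; apply/implyP => /eqP h.
  by exfalso; move: h m0; lra.
have [st|/ltW ts] := leP s t.
  apply: (@le_trans _ _ (t `^ (m + 1))); last by rewrite lerDr powR_ge0.
  by rewrite pE// ler_wpM2r//; apply: ge0_ler_powR; rewrite ?nnegrE// ltW.
apply: (@le_trans _ _ (s `^ (m + 1))); last by rewrite lerDl powR_ge0.
by rewrite pE// ler_wpM2l// powR_ge0.
Qed.

Let w x := u1 x - u2 x.

Lemma Vmul_sub : Vmul V w = fun x => Vmul V u1 x - Vmul V u2 x.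
Proof. by apply/funext => x; rewrite /Vmul /w mulrBr. Qed.

Lemma Lp2_sub : Lp Omega 2 w.
Proof. exact: (LpB mO (ler0n _ 2) hu1.1 hu2.1). Qed.

Lemma Lpm_sub : Lp Omega (m + 1) w.
Proof. by apply: (LpB mO _ hu1m hu2m); rewrite addr_ge0// ltW. Qed.

Lemma Lp2_Vmul_sub : Lp Omega 2 (Vmul V w).
Proof. by rewrite Vmul_sub; exact: (LpB mO (ler0n _ 2) hVu1 hVu2). Qed.

Definition difference_fun x := difference_term m a b c (u1 x) (u2 x) (V x).

(** Paired with [w^*], the reaction becomes integrable over all of [Omega]: [V^2] is shared between
    the two factors, giving the square-integrable [V w] twice, and the nonlinear part is paired
    inside [L^(m+1)]. *)
Lemma cintegrable_difference :
  cintegrable Omega (fun x => difference_fun x * (w x)^*).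
Proof.
have h1 := cintegrableB mO (cintegrable_nonlin hu1m Lpm_sub) (cintegrable_nonlin hu2m Lpm_sub).
have h2 := cintegrable_Lp2 mO Lp2_sub Lp2_sub.
have h3 := cintegrable_Lp2 mO Lp2_Vmul_sub Lp2_Vmul_sub.
have := cintegrableD mO (cintegrableD mO (cintegrableZ mO a h1) (cintegrableZ mO b h2))
  (cintegrableZ mO c h3).
congr (cintegrable _ _); apply/funext => x.
rewrite /difference_fun /difference_term /Vmul /= -/(w x) !rmorphM /= conjcR.
by rewrite expr2; ring.
Qed.

Lemma rint_energy lam :
  mu.-integrable Omega (EFin \o (fun x => energy m a b c lam (u1 x) (u2 x) (V x))).
Proof. by have [] := cintegrableZ mO lam^* cintegrable_difference. Qed.

Lemma ae_eq_of_energy_le0 lam :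
  (forall z1 z2 (v : R), 0 <= energy m a b c lam z1 z2 v /\
    (energy m a b c lam z1 z2 v = 0 -> z1 = z2)) ->
  \int[mu]_(x in Omega) energy m a b c lam (u1 x) (u2 x) (V x) <= 0 ->
  ae_eq_on Omega u1 u2.
Proof.
move=> eP e_le0.
have Ei := rint_energy lam; have mE := rint_measurable Ei.
set E := (fun x => energy m a b c lam (u1 x) (u2 x) (V x)) in Ei mE e_le0 *.
have : ae_eq mu Omega (EFin \o E) (cst 0%E).
  apply/(ae_eq_integral_abs mu mO); first exact/measurable_EFinP.
  rewrite (eq_integral (EFin \o E)); last first.
    by move=> x _ /=; rewrite ger0_norm// (eP _ _ _).1.
  rewrite -[LHS]fineK; last exact: integrable_fin_num.
  congr EFin; apply/le_anti/andP; split; first exact: e_le0.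
  by apply: Rintegral_ge0 => x _; exact: (eP _ _ _).1.
by apply: filterS => x h Ox; apply: (eP _ _ (V x)).2; have [] := h Ox.
Qed.

End difference.

(** * The Neumann problem *)

Section sobolev.
Context {R : realType} {n : nat} (Omega : set 'rV[R]_n).
Hypothesis oO : open Omega.
Implicit Types u v : 'rV[R]_n -> R[i].

Let mO : measurable Omega := open_measurable_rV oO.

(** [H1] provides some square-integrable weak derivative; uniqueness almost everywhere carries this
    property over to the representative picked by [wpartial]. *)
Lemma H1_wpartial u i : H1 Omega u ->
  weak_partial Omega i u (wpartial Omega i u) /\ Lp Omega 2 (wpartial Omega i u).
Proof.
move=> [_ /(_ i)[g ug lg]]; have wp := wpartialP ug; split; first exact: wp.
have [_ [mw _] _] := wp.
exact: (Lp_ae mO mw (wpartial_ae oO ug) lg).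
Qed.

Lemma H1B u v : H1 Omega u -> H1 Omega v -> H1 Omega (fun x => u x - v x).
Proof.
move=> hu hv; split; first exact: (LpB mO (ler0n _ 2) hu.1 hv.1).
move=> i; have [wu lu] := H1_wpartial i hu; have [wv lv] := H1_wpartial i hv.
by exists (fun x => wpartial Omega i u x - wpartial Omega i v x);
  [exact: (weak_partialB oO wu wv)|exact: (LpB mO (ler0n _ 2) lu lv)].
Qed.

Lemma H1Z c u : H1 Omega u -> H1 Omega (fun x => c * u x).
Proof.
move=> hu; split; first exact: (LpZ mO c hu.1).
move=> i; have [wu lu] := H1_wpartial i hu.
by exists (fun x => c * wpartial Omega i u x);
  [exact: (weak_partialZ oO c wu)|exact: (LpZ mO c lu)].
Qed.

End sobolev.

Section neumann.
Context {R : realType} {n : nat} (Omega : set 'rV[R]_n).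
Variables (V : 'rV[R]_n -> R) (m : R) (a b c : R[i]).
Variables (u1 u2 : 'rV[R]_n -> R[i]).
Hypotheses (oO : open Omega) (m0 : 0 < m).
Hypotheses (hu1 : H1 Omega u1) (hu1m : Lp Omega (m + 1) u1)
  (hu2 : H1 Omega u2) (hu2m : Lp Omega (m + 1) u2)
  (hVu1 : Lp Omega 2 (Vmul V u1)) (hVu2 : Lp Omega 2 (Vmul V u2)).
Local Notation mu := (lebesgue_rV n).

Let mO : measurable Omega := open_measurable_rV oO.

Lemma neumann_energy_le0 (ell : ('rV[R]_n -> R[i]) -> R) (lam : R[i]) : 0 <= Re lam ->
  neumann_solution Omega V m a b c ell u1 ->
  neumann_solution Omega V m a b c ell u2 ->
  \int[mu]_(x in Omega) energy m a b c lam (u1 x) (u2 x) (V x) <= 0.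
Proof.
move=> lam0 s1 s2.
pose w x := u1 x - u2 x; pose v x := lam * w x.
have hw : H1 Omega w := H1B oO hu1 hu2.
have hv : H1 Omega v := H1Z oO lam hw.
have vm : Lp Omega (m + 1) v := LpZ mO lam (Lpm_sub oO m0 hu1m hu2m).
have VvE : Vmul V v = fun x => lam * Vmul V w x.
  by apply/funext => x; rewrite /Vmul /v mulrCA.
have hVw : Lp Omega 2 (Vmul V w) := Lp2_Vmul_sub oO hVu1 hVu2.
have hVv : Lp Omega 2 (Vmul V v) by rewrite VvE; exact: (LpZ mO lam hVw).
have lv : Lp Omega 2 v := hv.1.
have lu1 : Lp Omega 2 u1 := hu1.1.
have lu2 : Lp Omega 2 u2 := hu2.1.
(* That [V u1] and [V u2] are square integrable enters here: it makes [lam w] an admissible test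
   function. *)
have Xv : spaceX Omega V m v := And3 hv vm hVv.
have reorg (A1 A2 B1 B2 C1 C2 : R[i]) :
    Re A1 + Re B1 + Re (c * C1) - (Re A2 + Re B2 + Re (c * C2)) =
    Re (A1 - A2) + Re ((B1 - B2) + c * (C1 - C2)) by rewrite !complexE; ring.
have := congr2 (fun s t => s - t) (s1 v Xv) (s2 v Xv); rewrite subrr.
set p1 := fun i => wpartial Omega i u1; set p2 := fun i => wpartial Omega i u2.
set pv := fun i => wpartial Omega i v.
have lp1 i : Lp Omega 2 (p1 i) by have [] := H1_wpartial oO i hu1.
have lp2 i : Lp Omega 2 (p2 i) by have [] := H1_wpartial oO i hu2.
have lpv i : Lp Omega 2 (pv i) by have [] := H1_wpartial oO i hv.
set A1 := cintegral _ _; set B1 := cintegral _ _; set C1 := cintegral _ _.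
set A2 := cintegral _ _; set B2 := cintegral _ _; set C2 := cintegral _ _.
rewrite reorg {reorg}.
have cA (p : 'I_n -> 'rV[R]_n -> R[i]) : (forall i, Lp Omega 2 (p i)) ->
    cintegrable Omega (fun x => \sum_(i < n) p i x * (pv i x)^*).
  by move=> lp; apply: (cintegrable_sum mO) => i; exact: (cintegrable_Lp2 mO (lp i) (lpv i)).
have cA1 := cA _ lp1; have cA2 := cA _ lp2.
have AE : 0 <= Re (A1 - A2).
  have cd : cintegrable Omega (fun x => \sum_(i < n)
      lam^* * ((p1 i x - p2 i x) * (p1 i x - p2 i x)^*)).
    apply: (cintegrable_sum mO) => i; apply: (cintegrableZ mO).
    have lp := LpB mO (ler0n _ 2) (lp1 i) (lp2 i); exact: (cintegrable_Lp2 mO lp lp).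
  rewrite /A1 /A2 -(cintegralB mO cA1 cA2).
  rewrite (cintegral_ae_eq mO (cintegrable_cmeasurable (cintegrableB mO cA1 cA2))
    (cintegrable_cmeasurable cd)).
    apply: Rintegral_ge0 => x _; rewrite Re_sum sumr_ge0// => i _.
    rewrite [X in 0 <= X](_ : _ = Re lam * normc (p1 i x - p2 i x) ^+ 2).
      by rewrite mulr_ge0// sqr_ge0.
    by rewrite sqr_normcE !complexE; ring.
  have wp i : ae_eq_on Omega (pv i) (fun x => lam * (p1 i x - p2 i x)).
    have [w1 _] := H1_wpartial oO i hu1; have [w2 _] := H1_wpartial oO i hu2.
    exact: (wpartial_ae oO (weak_partialZ oO lam (weak_partialB oO w1 w2))).
  have wpa : {ae mu, forall x, forall i, Omega x -> pv i x = lam * (p1 i x - p2 i x)}.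
    exact: (filter_forall _ wp).
  apply: filterS wpa => x h Ox; rewrite -sumrB; apply: eq_bigr => i _.
  by rewrite h// rmorphM /=; ring.
have cB u : Lp Omega 2 u -> Lp Omega (m + 1) u ->
    cintegrable Omega (fun x => (a * nonlin m (u x) + b * u x) * (v x)^*).
  move=> lu lum.
  have := cintegrableD mO (cintegrableZ mO a (cintegrable_nonlin oO m0 lum vm))
     (cintegrableZ mO b (cintegrable_Lp2 mO lu lv)).
  by congr (cintegrable _ _); apply/funext => x; ring.
have cB1 := cB _ lu1 hu1m; have cB2 := cB _ lu2 hu2m.
have cC1 := cintegrable_Lp2 mO hVu1 hVv; have cC2 := cintegrable_Lp2 mO hVu2 hVv.
have cC := cintegrableB mO cC1 cC2.
(* The conjugate of the test function [lam w] brings out the factor [lam^*], and since [V] is real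
   its two occurrences recombine into [V^2]. *)
have BE : B1 - B2 + c * (C1 - C2) = cintegral Omega
    (fun x => lam^* * (difference_fun V m a b c u1 u2 x * (w x)^*)).
  rewrite /B1 /B2 /C1 /C2 -(cintegralB mO cB1 cB2) -(cintegralB mO cC1 cC2).
  rewrite -(cintegralZ mO c cC) -(cintegralD mO (cintegrableB mO cB1 cB2) (cintegrableZ mO c cC)).
  apply: eq_cintegral => x _.
  rewrite /difference_fun /difference_term /Vmul /v /w /= !rmorphM /= conjcR expr2.
  by ring.
rewrite BE => h.
have {h} : Re (A1 - A2) + \int[mu]_(x in Omega) energy m a b c lam (u1 x) (u2 x) (V x) = 0.
  exact: h.
by move=> /eqP; rewrite addrC addr_eq0 => /eqP ->; rewrite oppr_le0.
Qed.

End neumann.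

(** * The Dirichlet problem *)

Section approximation.
Context {R : realType} {n : nat} (Omega : set 'rV[R]_n).
Hypothesis oO : open Omega.
Local Notation mu := (lebesgue_rV n).
Implicit Types u phi : 'rV[R]_n -> R[i].

Let mO : measurable Omega := open_measurable_rV oO.

(** Pointwise density of [H1_dist_sqr], with the classical derivative of [phi] in place of the
    representative chosen by [wpartial]. *)
Definition H1_gap u phi (x : 'rV[R]_n) : R := normc (u x - phi x) ^+ 2 +
  \sum_(i < n) normc (wpartial Omega i u x - cpartial i phi x) ^+ 2.

Lemma H10_approx u : H10 Omega u ->
  exists (phi : nat -> 'rV[R]_n -> R[i]) (S : 'rV[R]_n -> R),
  [/\ forall k, test_function Omega (phi k), mu.-integrable Omega (EFin \o S),
    {ae mu, forall x, forall k, Omega x -> H1_gap u (phi k) x <= S x} &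
    {ae mu, forall x, Omega x -> H1_gap u (phi k) x @[k --> \oo] --> (0 : R)}].
Proof.
(* Summable errors: the entire sequence of gaps is then dominated by an integrable function and
   tends to 0 almost everywhere. *)
move=> [hu happ]; pose e (k : nat) : R := 1 / (2 ^ k.+1)%:R.
have e0 k : 0 < e k by rewrite divr_gt0.
have /choice[phi hphi] (k : nat) : exists phi, test_function Omega phi /\
    (H1_dist_sqr Omega u phi < (e k)%:E)%E.
  by have [phi tphi d] := happ _ (e0 k); exists phi.
have tphi k := (hphi k).1.
have mwp (v : 'rV[R]_n -> R[i]) i g : weak_partial Omega i v g ->
    cmeasurable_fun Omega (wpartial Omega i v).
  by move=> /wpartialP[_ [h _] _].
have mu0 : cmeasurable_fun Omega u by have [[]] := hu.
have mgu i : cmeasurable_fun Omega (wpartial Omega i u).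
  by have [/mwp] := H1_wpartial oO i hu.
have mgphi i k : cmeasurable_fun Omega (wpartial Omega i (phi k)).
  exact: mwp (weak_partial_test oO i (tphi k)).
pose f k x := normc (u x - phi k x) ^+ 2 +
  \sum_(i < n) normc (wpartial Omega i u x - wpartial Omega i (phi k) x) ^+ 2.
have m1 k : measurable_fun Omega (fun x => normc (u x - phi k x) ^+ 2).
  apply: measurable_funX; apply: cmeasurable_normc.
  exact: (cmeasurableB mu0 (test_cmeasurable oO (tphi k))).
have m2 i k : measurable_fun Omega
    (fun x => normc (wpartial Omega i u x - wpartial Omega i (phi k) x) ^+ 2).
  apply: measurable_funX; apply: cmeasurable_normc.
  exact: (cmeasurableB (mgu i) (mgphi i k)).
have mf k : measurable_fun Omega (f k).
  by apply: measurable_funD; [exact: m1|exact: measurable_sum].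
have f0 k x : Omega x -> 0 <= f k x.
  by move=> _; rewrite addr_ge0 ?sqr_ge0// sumr_ge0// => i _; exact: sqr_ge0.
have he k : (\int[mu]_(x in Omega) (f k x)%:E <= (e k)%:E)%E.
  apply: le_trans (ltW (hphi k).2).
  rewrite /f; under eq_integral do rewrite EFinD -sumEFin.
  rewrite ge0_integralD//.
  - rewrite leeD2l// ge0_integral_sum//.
      by move=> i; exact/measurable_EFinP.
    by move=> i x _; rewrite lee_fin sqr_ge0.
  - by move=> x _; rewrite lee_fin sqr_ge0.
  - exact/measurable_EFinP.
  - by move=> x _; rewrite sume_ge0// => i _; rewrite lee_fin sqr_ge0.
  - apply: emeasurable_sum => i; exact/measurable_EFinP.
have [S [Si fS fcvg]] := summable_dominated mO mf f0 he
  (le_lt_trans (epsilon_trick0 xpredT ler01) (ltry _)).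
exists phi, S.
(* A single null set serves all [k] and [i], as there are countably many of the former and finitely
   many of the latter. *)
have fE : {ae mu, forall x, forall k, forall i : 'I_n, Omega x ->
    wpartial Omega i (phi k) x = cpartial i (phi k) x}.
  apply/ae_foralln => k; apply: (filter_forall _) => i.
  exact: (wpartial_ae oO (weak_partial_test oO i (tphi k))).
have gapE x : (forall k, forall i : 'I_n, Omega x ->
    wpartial Omega i (phi k) x = cpartial i (phi k) x) -> Omega x ->
    forall k, H1_gap u (phi k) x = f k x.
  move=> h Ox k; rewrite /H1_gap /f; congr (_ + _); apply: eq_bigr => i _.
  by rewrite h.
split=> //.
- by apply: filterS2 fE fS => x h hS k Ox; rewrite gapE//; exact: hS.
- apply: filterS2 fE fcvg => x h hc Ox.
  by under eq_fun do rewrite gapE//; exact: hc.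
Qed.

End approximation.

Section dirichlet_identity.
Context {R : realType} {n : nat} (Omega : set 'rV[R]_n).
Variables (V : 'rV[R]_n -> R) (m : R) (a b c : R[i]).
Variables (u1 u2 F : 'rV[R]_n -> R[i]).
Hypotheses (oO : open Omega) (m0 : 0 < m) (hV : Linfty_loc Omega V).
Hypotheses (hu1 : H1 Omega u1) (hu1m : Lp Omega (m + 1) u1)
  (hu2 : H1 Omega u2) (hu2m : Lp Omega (m + 1) u2)
  (hVu1 : Lp Omega 2 (Vmul V u1)) (hVu2 : Lp Omega 2 (Vmul V u2)).
Local Notation mu := (lebesgue_rV n).
Implicit Types u : 'rV[R]_n -> R[i].

Let mO : measurable Omega := open_measurable_rV oO.

Lemma L1_loc_nonlin u : Lp Omega (m + 1) u -> L1_loc Omega (fun x => nonlin m (u x)).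
Proof.
move=> /LpE[cu ui].
apply: (L1_loc_le oO (g := fun x => 1 + normc (u x) `^ (m + 1))).
- exact: cmeasurable_nonlin.
- move=> x _; rewrite normc_nonlin//; set t := normc _.
  have t0 : 0 <= t by exact: normc_ge0.
  have [t1|/ltW t1] := leP t 1.
    apply: (@le_trans _ _ 1); last by rewrite lerDl powR_ge0.
    rewrite -[leRHS](congr1 (@^~ m) (powR1 R)).
    by apply: ge0_ler_powR; rewrite ?nnegrE// ltW.
  apply: (@le_trans _ _ (t `^ (m + 1))); last by rewrite lerDr.
  by apply: ler_powR => //; rewrite lerDl.
- move=> K cK KO; have mK := compact_measurable_rV cK.
  exact: (rintD mK (rint_compact_cst 1 cK) (integrableS mO mK KO ui)).
Qed.

(** Written as [V (V u)], the potential term is at most [V^2 + |V u|^2] in modulus. The first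
    summand is integrable only on compact subsets, where [V] is bounded almost everywhere. *)
Lemma L1_loc_potential u : cmeasurable_fun Omega u -> Lp Omega 2 (Vmul V u) ->
  L1_loc Omega (fun x => (V x)%:C ^+ 2 * u x).
Proof.
move=> cu hVu; have [cVu Vui] := (Lp2E mO _).1 hVu; have [mV Vloc] := hV.
apply: (L1_loc_le oO (g := fun x => V x ^+ 2 + normc (Vmul V u x) ^+ 2)).
- apply: cmeasurableM => //; under eq_fun do rewrite -rmorphXn.
  by apply: cmeasurable_real; exact: measurable_funX.
- move=> x _; rewrite expr2 -mulrA ComplexField.Normc.normcM normc_real -/(Vmul V u x).
  set t := normc _; have := sqr_ge0 (`|V x| - t).
  have := sqr_ge0 (`|V x|); have := sqr_ge0 t.
  by rewrite -(real_normK (num_real (V x))); nra.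
- move=> K cK KO; have mK := compact_measurable_rV cK.
  have [M VM] := Vloc K cK KO.
  apply: (rintD mK _ (integrableS mO mK KO Vui)).
  apply: (rint_le_ae mK _ _ (rint_compact_cst (M ^+ 2) cK)).
    by apply: measurable_funX; exact: measurable_funS mV.
  apply: filterS VM => x h Kx; rewrite ger0_norm ?sqr_ge0//.
  rewrite -(real_normK (num_real (V x))).
  by apply: lerXn2r; rewrite ?nnegrE ?(le_trans _ (h Kx))// h.
Qed.

Let reaction u x := a * nonlin m (u x) + b * u x + c * (V x)%:C ^+ 2 * u x.

Let L1_loc_reaction u : H1 Omega u -> Lp Omega (m + 1) u -> Lp Omega 2 (Vmul V u) ->
  L1_loc Omega (reaction u).
Proof.
move=> hu hum hVu; have lu := L1_loc_Lp2 mO oO hu.1.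
have -> : reaction u = fun x => a * nonlin m (u x) + b * u x + c * ((V x)%:C ^+ 2 * u x).
  by apply/funext => x; rewrite /reaction mulrA.
exact: (L1_locD oO (L1_locD oO (L1_locZ oO a (L1_loc_nonlin hum)) (L1_locZ oO b lu))
  (L1_locZ oO c (L1_loc_potential lu.1 hVu))).
Qed.

Lemma L1_loc_difference : L1_loc Omega (difference_fun V m a b c u1 u2).
Proof.
have -> : difference_fun V m a b c u1 u2 = fun x => reaction u1 x - reaction u2 x.
  by apply/funext => x; rewrite /difference_fun /difference_term /reaction; ring.
exact: (L1_locB oO (L1_loc_reaction hu1 hu1m hVu1) (L1_loc_reaction hu2 hu2m hVu2)).
Qed.

(** One integration by parts per coordinate, against the test function [cpartial i phi]. Only first
    derivatives remain, which approximation in [H^1] controls. *)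
Let laplacian_parts u phi : H1 Omega u -> test_function Omega phi ->
  - cintegral Omega (fun x => u x * laplacian phi x) =
  \sum_(i < n) cintegral Omega (fun x => wpartial Omega i u x * cpartial i phi x).
Proof.
move=> hu tphi.
have lu := L1_loc_Lp2 mO oO hu.1.
have I i : cintegrable Omega (fun x => u x * cpartial i (cpartial i phi) x).
  by apply: (cintegrable_test oO lu); do 2 apply: test_cpartial.
rewrite (eq_cintegral (g := fun x => \sum_(i < n) u x * cpartial i (cpartial i phi) x)); last first.
  by move=> x _; rewrite /laplacian mulr_sumr.
rewrite (cintegral_sum mO _ I) -sumrN; apply: eq_bigr => i _.
have [[_ _ wp] _] := H1_wpartial oO i hu.
by rewrite wp ?opprK//; exact: test_cpartial.
Qed.

(** The source cancels in the difference. The pairing is bilinear, so the conjugate that appears in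
    the energy has to be put into the test function. *)
Lemma dirichlet_identity phi : distributional_solution Omega V m a b c F u1 ->
  distributional_solution Omega V m a b c F u2 -> test_function Omega phi ->
  \sum_(i < n) cintegral Omega
    (fun x => (wpartial Omega i u1 x - wpartial Omega i u2 x) * cpartial i phi x) +
  cintegral Omega (fun x => difference_fun V m a b c u1 u2 x * phi x) = 0.
Proof.
move=> s1 s2 tphi.
have := s1 phi tphi; rewrite -(s2 phi tphi) (laplacian_parts hu1 tphi) (laplacian_parts hu2 tphi).
have r1 := cintegrable_test oO (L1_loc_reaction hu1 hu1m hVu1) tphi.
have r2 := cintegrable_test oO (L1_loc_reaction hu2 hu2m hVu2) tphi.
have dE : cintegral Omega (fun x => difference_fun V m a b c u1 u2 x * phi x) =
    cintegral Omega (fun x => reaction u1 x * phi x) -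
    cintegral Omega (fun x => reaction u2 x * phi x).
  rewrite -(cintegralB mO r1 r2); apply: eq_cintegral => x _.
  by rewrite /difference_fun /difference_term /reaction; ring.
have pE : \sum_(i < n) cintegral Omega
    (fun x => (wpartial Omega i u1 x - wpartial Omega i u2 x) * cpartial i phi x) =
  \sum_(i < n) cintegral Omega (fun x => wpartial Omega i u1 x * cpartial i phi x) -
  \sum_(i < n) cintegral Omega (fun x => wpartial Omega i u2 x * cpartial i phi x).
  rewrite -sumrB; apply: eq_bigr => i _.
  have tp := test_cpartial i tphi.
  have [[_ l1 _] _] := H1_wpartial oO i hu1; have [[_ l2 _] _] := H1_wpartial oO i hu2.
  rewrite -(cintegralB mO (cintegrable_test oO l1 tp) (cintegrable_test oO l2 tp)).
  by apply: eq_cintegral => x _; rewrite mulrBl.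
have alg (x1 x2 y1 y2 : R[i]) : x1 + y1 = x2 + y2 -> x1 - x2 + (y1 - y2) = 0.
  by move=> e; rewrite addrACA -opprD e subrr.
by rewrite dE pE; exact: alg.
Qed.

End dirichlet_identity.

(** * The cutoff and its uniform bounds *)

Section cutoff.
Context {R : realType}.
Implicit Types z y dz dy : R[i].

(** The squared modulus as a polynomial in the two parts: smoothness and derivatives follow from the
    rules for sums and products, with no square root. *)
Definition nsq z : R := Re z * Re z + Im z * Im z.

Definition rdot z y : R := Re z * Re y + Im z * Im y.

(** In the notation of the overview [z] stands for [z_j] and [y] for [z_k]; the term [e] keeps the
    denominator positive at common zeros. *)
Definition theta (e : R) z y : R := nsq y * (nsq z + nsq y + e)^-1.

(* The derivative of [theta e z y] when z and y have derivatives dz and dy. *)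
Definition dtheta (e : R) z y dz dy : R :=
  2 * (rdot y dy * (nsq z + e) - nsq y * rdot z dz) *
  ((nsq z + nsq y + e)^-1 * (nsq z + nsq y + e)^-1).

Lemma nsqE z : nsq z = normc z ^+ 2.
Proof. by rewrite sqr_normcE /nsq -!expr2. Qed.

Lemma nsq_ge0 z : 0 <= nsq z.
Proof. by rewrite nsqE sqr_ge0. Qed.

Lemma rdot_le z y : `|rdot z y| <= normc z * normc y.
Proof.
have -> : rdot z y = Re (z * y^*) by rewrite /rdot !complexE; ring.
by rewrite (le_trans (Re_le_normc _))// ComplexField.Normc.normcM normcJ.
Qed.

Let den_gt0 (e : R) z y : 0 < e -> 0 < nsq z + nsq y + e.
Proof. by move=> e0; rewrite ltr_wpDl// addr_ge0// nsq_ge0. Qed.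

Lemma theta_ge0 e z y : 0 < e -> 0 <= theta e z y.
Proof. by move=> e0; rewrite mulr_ge0 ?nsq_ge0// invr_ge0 ltW// den_gt0. Qed.

Lemma theta_le1 e z y : 0 < e -> theta e z y <= 1.
Proof.
move=> e0; rewrite ler_pdivrMr ?den_gt0// mul1r.
by have := nsq_ge0 z; lra.
Qed.

(** Holds because [|y| |z|] is at most the denominator. Being independent of [z], the bound
    dominates the reaction term while [z] tends to [w]. *)
Lemma theta_mul_le e z y : 0 < e -> theta e z y * normc z <= normc y.
Proof.
move=> e0; rewrite /theta mulrAC ler_pdivrMr ?den_gt0// !nsqE.
have := normc_ge0 z; have := normc_ge0 y.
set s := normc z; set t := normc y => t0 s0.
have h : t * s <= s ^+ 2 + t ^+ 2 + e.
  by have := sqr_ge0 (s - t); have := mulr_ge0 t0 s0; nra.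
by rewrite expr2 -mulrA ler_wpM2l.
Qed.

(** With [s = |z|], [t = |y|] and [D] the denominator, each of [2 s t], [s^2 + e], [s^2] and [t^2]
    is at most [D], which absorbs the factor [1 / D^2]. The constants do not involve [e], so the
    bound survives [e] tending to 0. *)
Lemma dtheta_mul_le e z y dz dy : 0 < e ->
  `|dtheta e z y dz dy| * normc z <= normc dy + 2 * normc dz.
Proof.
move=> e0; have d0 := den_gt0 z y e0.
have i0 : 0 <= (nsq z + nsq y + e)^-1 by rewrite invr_ge0 ltW.
rewrite /dtheta !normrM [`|2|]ger0_norm// (ger0_norm i0).
rewrite -invfM [leLHS]mulrAC ler_pdivrMr ?mulr_gt0//.
have r1 := rdot_le y dy; have r2 := rdot_le z dz.
move: d0 r1 r2; rewrite !nsqE.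
have := normc_ge0 z; have := normc_ge0 y; have := normc_ge0 dz; have := normc_ge0 dy.
move: (normc z) (normc y) (normc dz) (normc dy) (rdot y dy) (rdot z dz).
move=> s t ds dt r1 r2 dt0 ds0 t0 s0; set D := s ^+ 2 + t ^+ 2 + e => D0 hr1 hr2.
have sD : s ^+ 2 + e <= D by rewrite /D; have := sqr_ge0 t; lra.
have tD : t ^+ 2 <= D by rewrite /D; have := sqr_ge0 s; lra.
have s2D : s ^+ 2 <= D by rewrite /D; have := sqr_ge0 t; lra.
have stD : 2 * (s * t) <= D by rewrite /D; have := sqr_ge0 (s - t); nra.
have se0 : 0 <= s ^+ 2 + e by rewrite addr_ge0 ?sqr_ge0// ltW.
have A : `|r1 * (s ^+ 2 + e) - t ^+ 2 * r2| <= t * dt * (s ^+ 2 + e) + t ^+ 2 * (s * ds).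
  apply: le_trans (ler_normB _ _) _.
  rewrite (normrM r1) (normrM (t ^+ 2) r2) (ger0_norm se0) (ger0_norm (sqr_ge0 t)).
  by apply: lerD; [exact: ler_wpM2r|apply: ler_wpM2l => //; exact: sqr_ge0].
apply: (@le_trans _ _ (2 * (t * dt * (s ^+ 2 + e) + t ^+ 2 * (s * ds)) * s)).
  by rewrite ler_wpM2r// ler_wpM2l.
have h1 : (2 * (s * t)) * (s ^+ 2 + e) <= D * D.
  by apply: ler_pM => //; rewrite mulr_ge0// mulr_ge0.
have h2 : t ^+ 2 * s ^+ 2 <= D * D by apply: ler_pM => //; exact: sqr_ge0.
have -> : 2 * (t * dt * (s ^+ 2 + e) + t ^+ 2 * (s * ds)) * s =
  dt * ((2 * (s * t)) * (s ^+ 2 + e)) + (2 * ds) * (t ^+ 2 * s ^+ 2) by ring.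
rewrite [leRHS]mulrDl; apply: lerD; first exact: ler_wpM2l.
by apply: ler_wpM2l => //; rewrite mulr_ge0.
Qed.

End cutoff.

Section cutoff_smooth.
Context {R : realType} {n : nat} (Omega : set 'rV[R]_n).
Hypothesis oO : open Omega.
Implicit Types z y : 'rV[R]_n -> R[i].

Let smooth_nsq z : csmooth z -> smooth (fun x => nsq (z x)).
Proof.
by move=> [a b]; exact: (smoothD (smoothM a a) (smoothM b b)).
Qed.

Let partial_nsq i z x : csmooth z ->
  partial i (fun x => nsq (z x)) x = 2 * rdot (z x) (cpartial i z x).
Proof.
move=> [a b]; rewrite /nsq /rdot /cpartial /=.
have da := @smooth_derivable _ _ _ i x a; have db := @smooth_derivable _ _ _ i x b.
rewrite (partialD (derivableM da da) (derivableM db db)) (partialM da da) (partialM db db).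
by ring.
Qed.

Let den_neq0 (e : R) (z y : R[i]) : 0 < e -> nsq z + nsq y + e != 0.
Proof. by move=> e0; rewrite gt_eqF// ltr_wpDl// addr_ge0// nsq_ge0. Qed.

Let smooth_den (e : R) z y : csmooth z -> csmooth y ->
  smooth (fun x => nsq (z x) + nsq (y x) + e).
Proof.
move=> /smooth_nsq sz /smooth_nsq sy.
exact: (smoothD (smoothD sz sy) (smooth_cst e)).
Qed.

Lemma smooth_theta (e : R) z y : 0 < e -> csmooth z -> csmooth y ->
  smooth (fun x => theta e (z x) (y x)).
Proof.
move=> e0 sz sy.
exact: (smoothM (smooth_nsq sy) (smoothV (fun x => den_neq0 (z x) (y x) e0) (smooth_den e sz sy))).
Qed.

Let partial_theta i (e : R) z y x : 0 < e -> csmooth z -> csmooth y ->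
  partial i (fun x => theta e (z x) (y x)) x =
  dtheta e (z x) (y x) (cpartial i z x) (cpartial i y x).
Proof.
move=> e0 sz sy; have D0 := den_neq0 (z x) (y x) e0.
have sD := smooth_den e sz sy.
have dz := @smooth_derivable _ _ _ i x (smooth_nsq sz).
have dy := @smooth_derivable _ _ _ i x (smooth_nsq sy).
have dD := @smooth_derivable _ _ _ i x sD.
have dV : derivable (fun x => (nsq (z x) + nsq (y x) + e)^-1) x 'e_i.
  exact: (@smooth_derivable _ _ _ i x (smoothV (fun x => den_neq0 (z x) (y x) e0) sD)).
have dzy : derivable (fun x => nsq (z x) + nsq (y x)) x 'e_i.
  exact: (@smooth_derivable _ _ _ i x (smoothD (smooth_nsq sz) (smooth_nsq sy))).
have dc := @smooth_derivable _ _ _ i x (smooth_cst e).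
have EM : partial i (fun x => theta e (z x) (y x)) x = _ := partialM dy dV.
have EV := partialV dD D0.
have ED := partialD dzy dc.
have Ezy := partialD dz dy.
rewrite EM EV ED Ezy (congr1 (@^~ x) (partial_cst i e)) (partial_nsq i x sy) (partial_nsq i x sz).
rewrite /dtheta; move: D0.
move: (rdot (z x) _) (rdot (y x) _) (nsq (z x)) (nsq (y x)) => r1 r2 s t D0.
by field.
Qed.

(* Both factors are smooth, and [theta e z y] vanishes with y, so the cutoff is
   a test function bounded by |y|, uniformly in z. *)
Definition cutoff (e : R) z y : 'rV[R]_n -> R[i] :=
  fun x => (theta e (z x) (y x))%:C * (z x)^*.

Lemma test_cutoff (e : R) z y : 0 < e -> test_function Omega z -> test_function Omega y ->
  test_function Omega (cutoff e z y).
Proof.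
move=> e0 tz ty.
exact: (testM (csmooth_real (smooth_theta e0 (test_csmooth tz) (test_csmooth ty))) (testJ tz)).
Qed.

Lemma cpartial_cutoff i (e : R) z y x : 0 < e -> csmooth z -> csmooth y ->
  cpartial i (cutoff e z y) x =
  (theta e (z x) (y x))%:C * (cpartial i z x)^* +
  (dtheta e (z x) (y x) (cpartial i z x) (cpartial i y x))%:C * (z x)^*.
Proof.
move=> e0 sz sy; have st := smooth_theta e0 sz sy.
have [a b] := sz.
have dt := @smooth_derivable _ _ _ i x st.
have da := @smooth_derivable _ _ _ i x a.
have dNb := @smooth_derivable _ _ _ i x (smoothN b).
have db := @smooth_derivable _ _ _ i x b.
have ReE : (fun x => Re (cutoff e z y x)) = fun x => theta e (z x) (y x) * Re (z x).
  by apply/funext => t; rewrite /cutoff !complexE; ring.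
have ImE : (fun x => Im (cutoff e z y x)) = fun x => theta e (z x) (y x) * - Im (z x).
  by apply/funext => t; rewrite /cutoff !complexE; ring.
rewrite [LHS]/cpartial ReE ImE (partialM dt da) (partialM dt dNb) partial_theta//.
have -> : partial i (fun x => - Im (z x)) x = - partial i (fun x => Im (z x)) x.
  by rewrite /partial deriveN.
rewrite -[partial i (fun x => Re (z x)) x]/(Re (cpartial i z x)).
rewrite -[partial i (fun x => Im (z x)) x]/(Im (cpartial i z x)).
set s := theta e _ _; set t := dtheta e _ _ _ _.
move: s t (cpartial i z x) (z x) => s t p q; apply: complexP.
  by rewrite -[LHS]/(s * Re p + Re q * t) !complexE; ring.
by rewrite -[LHS]/(s * - Im p + - Im q * t) !complexE; ring.
Qed.

End cutoff_smooth.

(** * Limits and measurability of the cutoff *)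

Section componentwise_limits.
Context {R : realType}.
Implicit Types (f g : nat -> R[i]) (l : R[i]).

(** Convergence is kept on real and imaginary parts because every integrand that passes to the limit
    is a real expression in them. *)
Definition ccvg f l : Prop :=
  (Re (f k) @[k --> \oo] --> Re l) /\ (Im (f k) @[k --> \oo] --> Im l).

Lemma ccvg_cst l : ccvg (fun=> l) l.
Proof. by split; exact: cvg_cst. Qed.

Let cvg_of_sqr_le (h s : nat -> R) (r : R) : (forall k, (r - h k) ^+ 2 <= s k) ->
  s k @[k --> \oo] --> (0 : R) -> h k @[k --> \oo] --> r.
Proof.
move=> hs s0; apply/cvgrPdist_lt => eps eps0.
have e20 : 0 < eps ^+ 2 by rewrite exprn_gt0.
near=> k.
have sk : `|s k| < eps ^+ 2 by near: k; exact: (cvgr0_norm_lt _ s0 _ e20).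
rewrite -(@ltr_pXn2r _ 2)// ?nnegrE ?ltW//.
rewrite real_normK ?num_real//; apply: le_lt_trans (hs k) _.
by apply: le_lt_trans sk; exact: ler_norm.
Unshelve. all: by end_near. Qed.

Lemma ccvg_of_normc f l (s : nat -> R) : (forall k, normc (l - f k) ^+ 2 <= s k) ->
  s k @[k --> \oo] --> (0 : R) -> ccvg f l.
Proof.
move=> fs s0; split; apply: cvg_of_sqr_le s0 => k; apply: le_trans (fs k);
  by rewrite sqr_normcE !complexE ?lerDl ?lerDr sqr_ge0.
Qed.

Lemma ccvgB f g l l' : ccvg f l -> ccvg g l' -> ccvg (fun k => f k - g k) (l - l').
Proof.
move=> [a b] [c d]; split.
- by rewrite !complexE; under eq_fun do rewrite !complexE; exact: cvgB.
- by rewrite !complexE; under eq_fun do rewrite !complexE; exact: cvgB.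
Qed.

Lemma cvg_Re_conj f l (A : R[i]) : ccvg f l ->
  Re (A * (f k)^*) @[k --> \oo] --> Re (A * l^*).
Proof.
move=> [a b]; have E z : Re (A * z^*) = Re A * Re z + Im A * Im z.
  by rewrite !complexE; ring.
rewrite E; under eq_fun do rewrite E.
by apply: cvgD; apply: cvgM => //; exact: cvg_cst.
Qed.

Lemma cvg_nsq f l : ccvg f l -> nsq (f k) @[k --> \oo] --> nsq l.
Proof. by move=> [a b]; apply: cvgD; exact: cvgM. Qed.

Lemma cvg_rdot f g l l' : ccvg f l -> ccvg g l' ->
  rdot (f k) (g k) @[k --> \oo] --> rdot l l'.
Proof. by move=> [a b] [c d]; apply: cvgD; exact: cvgM. Qed.

(** The parameter may vary so that one statement covers both limits: a constant positive parameter,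
    and one tending to 0, where the limiting denominator is nonzero as soon as [w] is. *)
Lemma cvg_theta (e : nat -> R) (e' : R) f g l l' : e k @[k --> \oo] --> e' ->
  ccvg f l -> ccvg g l' -> nsq l + nsq l' + e' != 0 ->
  theta (e k) (f k) (g k) @[k --> \oo] --> theta e' l l'.
Proof.
move=> ee fl gl d0; apply: cvgM; first exact: cvg_nsq.
apply: cvgV => //; apply: cvgD => //.
by apply: cvgD; exact: cvg_nsq.
Qed.

Lemma cvg_dtheta (e : nat -> R) (e' : R) f g df dg l l' dl dl' :
  e k @[k --> \oo] --> e' ->
  ccvg f l -> ccvg g l' -> ccvg df dl -> ccvg dg dl' -> nsq l + nsq l' + e' != 0 ->
  dtheta (e k) (f k) (g k) (df k) (dg k) @[k --> \oo] --> dtheta e' l l' dl dl'.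
Proof.
move=> ee fl gl dfl dgl d0.
have DV : (nsq (f k) + nsq (g k) + e k)^-1 @[k --> \oo] --> (nsq l + nsq l' + e')^-1.
  apply: cvgV => //; apply: cvgD => //.
  by apply: cvgD; exact: cvg_nsq.
apply: cvgM; last exact: cvgM.
apply: cvgM; first exact: cvg_cst.
apply: cvgB; apply: cvgM.
- exact: cvg_rdot.
- by apply: cvgD => //; exact: cvg_nsq.
- exact: cvg_nsq.
- exact: cvg_rdot.
Qed.

End componentwise_limits.

Section cutoff_measurable.
Context {R : realType} {n : nat} (Omega : set 'rV[R]_n).
Implicit Types z y dz dy : 'rV[R]_n -> R[i].

Lemma measurable_nsq z : cmeasurable_fun Omega z -> measurable_fun Omega (fun x => nsq (z x)).
Proof. by move=> [a b]; apply: measurable_funD; exact: measurable_funM. Qed.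

Lemma measurable_rdot z y : cmeasurable_fun Omega z -> cmeasurable_fun Omega y ->
  measurable_fun Omega (fun x => rdot (z x) (y x)).
Proof. by move=> [a b] [c d]; apply: measurable_funD; exact: measurable_funM. Qed.

Let measurable_den_inv (e : R) z y : 0 < e ->
  cmeasurable_fun Omega z -> cmeasurable_fun Omega y ->
  measurable_fun Omega (fun x => (nsq (z x) + nsq (y x) + e)^-1).
Proof.
move=> e0 mz my.
(* The denominator is nonnegative, so its inverse is its real power of exponent -1, and real powers
   are measurable. *)
rewrite (_ : (fun _ => _) = (powR (R := R))^~ (-1) \o (fun x => nsq (z x) + nsq (y x) + e)).
  apply: measurableT_comp; first exact: measurable_powR.
  apply: measurable_funD; last exact: measurable_cst.
  by apply: measurable_funD; exact: measurable_nsq.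
apply/funext => x; rewrite /= powR_inv1//.
by apply: addr_ge0; [rewrite addr_ge0// nsq_ge0|exact: ltW].
Qed.

Lemma measurable_theta (e : R) z y : 0 < e ->
  cmeasurable_fun Omega z -> cmeasurable_fun Omega y ->
  measurable_fun Omega (fun x => theta e (z x) (y x)).
Proof.
move=> e0 mz my; apply: measurable_funM; first exact: measurable_nsq.
exact: measurable_den_inv.
Qed.

Lemma measurable_dtheta (e : R) z y dz dy : 0 < e ->
  cmeasurable_fun Omega z -> cmeasurable_fun Omega y ->
  cmeasurable_fun Omega dz -> cmeasurable_fun Omega dy ->
  measurable_fun Omega (fun x => dtheta e (z x) (y x) (dz x) (dy x)).
Proof.
move=> e0 mz my mdz mdy; have mV := measurable_den_inv e0 mz my.
apply: measurable_funM; last exact: measurable_funM.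
apply: measurable_funM; first exact: measurable_cst.
apply: measurable_funB; apply: measurable_funM.
- exact: measurable_rdot.
- by apply: measurable_funD; [exact: measurable_nsq|exact: measurable_cst].
- exact: measurable_nsq.
- exact: measurable_rdot.
Qed.

Lemma measurable_Re_conj (lam : R[i]) z y : cmeasurable_fun Omega z -> cmeasurable_fun Omega y ->
  measurable_fun Omega (fun x => Re (lam * (z x * (y x)^*))).
Proof.
move=> mz my.
by have [] := cmeasurableZ lam (cmeasurableM mz (cmeasurableJ my)).
Qed.

End cutoff_measurable.

(** * Approximation of the difference of the solutions *)

Section difference_approximation.
Context {R : realType} {n : nat} (Omega : set 'rV[R]_n).
Hypothesis oO : open Omega.
Local Notation mu := (lebesgue_rV n).
Implicit Types u z : 'rV[R]_n -> R[i].

Let mO : measurable Omega := open_measurable_rV oO.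

Let cpartialB i phi psi x : test_function Omega phi -> test_function Omega psi ->
  cpartial i (fun x => phi x - psi x) x = cpartial i phi x - cpartial i psi x.
Proof.
move=> [a b _] [c d _].
have E (f g : 'rV[R]_n -> R) : smooth f -> smooth g ->
    partial i (fun x => f x - g x) x = partial i f x - partial i g x.
  move=> sf sg; have df := @smooth_derivable _ _ _ i x sf.
  by have dg := @smooth_derivable _ _ _ i x sg; rewrite /partial deriveB.
rewrite /cpartial (_ : (fun y => Re (phi y - psi y)) = fun y => Re (phi y) - Re (psi y)).
  rewrite (_ : (fun y => Im (phi y - psi y)) = fun y => Im (phi y) - Im (psi y)).
    by rewrite (E _ _ a c) (E _ _ b d).
  by apply/funext => y; rewrite !complexE.
by apply/funext => y; rewrite !complexE.
Qed.

Let normc_sub4_le (a b c d : R[i]) : normc ((a - b) - (c - d)) ^+ 2 <=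
  2 * (normc (a - c) ^+ 2 + normc (b - d) ^+ 2).
Proof.
rewrite !sqr_normcE !complexE.
have := sqr_ge0 ((Re a - Re c) + (Re b - Re d)).
have := sqr_ge0 ((Im a - Im c) + (Im b - Im d)).
nra.
Qed.

(** One majorant for all [k] serves both limits. It concerns the gradients only: [z k] itself is
    absorbed by [theta] and [dtheta], so pointwise convergence is enough for it. *)
Lemma difference_approx u1 u2 : H10 Omega u1 -> H10 Omega u2 ->
  exists (z : nat -> 'rV[R]_n -> R[i]) (S : 'rV[R]_n -> R),
  [/\ forall k, test_function Omega (z k), mu.-integrable Omega (EFin \o S),
    {ae mu, forall x, Omega x -> forall k i,
      normc (wpartial Omega i u1 x - wpartial Omega i u2 x - cpartial i (z k) x) ^+ 2 <= S x} &
    {ae mu, forall x, Omega x -> ccvg (fun k => z k x) (u1 x - u2 x) /\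
      forall i, ccvg (fun k => cpartial i (z k) x)
        (wpartial Omega i u1 x - wpartial Omega i u2 x)}].
Proof.
move=> /(H10_approx oO)[phi [S1 [tphi S1i phiS phi0]]].
move=> /(H10_approx oO)[psi [S2 [tpsi S2i psiS psi0]]].
exists (fun k x => phi k x - psi k x), (fun x => 2 * (S1 x + S2 x)).
have gapl u v x : normc (u x - v x) ^+ 2 <= H1_gap Omega u v x.
  by rewrite /H1_gap lerDl sumr_ge0// => i _; exact: sqr_ge0.
have gapr u v x i : normc (wpartial Omega i u x - cpartial i v x) ^+ 2 <= H1_gap Omega u v x.
  rewrite /H1_gap (bigD1 i)//= addrCA lerDl addr_ge0 ?sqr_ge0// sumr_ge0// => j _.
  exact: sqr_ge0.
have dE x k i : wpartial Omega i u1 x - wpartial Omega i u2 x -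
    cpartial i (fun x => phi k x - psi k x) x =
    wpartial Omega i u1 x - wpartial Omega i u2 x - (cpartial i (phi k) x - cpartial i (psi k) x).
  by rewrite (cpartialB i x (tphi k) (tpsi k)).
split.
- by move=> k; exact: (testB (tphi k) (tpsi k)).
- exact: (rintZ mO 2 (rintD mO S1i S2i)).
- apply: filterS2 phiS psiS => x h1 h2 Ox k i; rewrite dE.
  apply: le_trans (normc_sub4_le _ _ _ _) _; apply: ler_wpM2l => //.
  apply: lerD; first exact: le_trans (gapr _ _ _ _) (h1 k Ox).
  exact: le_trans (gapr _ _ _ _) (h2 k Ox).
- apply: filterS2 phi0 psi0 => x h1 h2 Ox; have {}h1 := h1 Ox; have {}h2 := h2 Ox.
  split=> [|i].
    exact: (ccvgB (ccvg_of_normc (fun k => gapl u1 (phi k) x) h1)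
                  (ccvg_of_normc (fun k => gapl u2 (psi k) x) h2)).
  have -> : (fun k => cpartial i (fun x => phi k x - psi k x) x) =
      (fun k => cpartial i (phi k) x - cpartial i (psi k) x).
    by apply/funext => k; rewrite (cpartialB i x (tphi k) (tpsi k)).
  exact: (ccvgB (ccvg_of_normc (fun k => gapr u1 (phi k) x i) h1)
                (ccvg_of_normc (fun k => gapr u2 (psi k) x i) h2)).
Qed.

End difference_approximation.

Section dirichlet_tools.
Context {R : realType}.

Lemma cvg_sum_seq (I : Type) (s : seq I) (f : nat -> I -> R) (l : I -> R) :
  (forall i, f k i @[k --> \oo] --> l i) ->
  \sum_(i <- s) f k i @[k --> \oo] --> \sum_(i <- s) l i.
Proof.
move=> fl; elim: s => [|i s IH].
  by rewrite big_nil; under eq_fun do rewrite big_nil; exact: cvg_cst.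
by rewrite big_cons; under eq_fun do rewrite big_cons; exact: cvgD.
Qed.

Lemma cvg_Re_conj2 (L A l : R[i]) (f : nat -> R[i]) : ccvg f l ->
  Re (L * (A * (f k)^*)) @[k --> \oo] --> Re (L * (A * l^*)).
Proof.
move=> fl; rewrite mulrA; under eq_fun do rewrite mulrA; exact: cvg_Re_conj.
Qed.

Lemma rint_test_sqr n (Omega : set 'rV[R]_n) phi : open Omega ->
  test_function Omega phi ->
  (lebesgue_rV n).-integrable Omega (EFin \o (fun x => normc (phi x) ^+ 2)).
Proof.
move=> oO tphi; have mO := open_measurable_rV oO.
have [h _] := cintegrable_test oO (test_L1_loc oO tphi) (testJ tphi).
by apply: (eq_rint mO _ h) => x _; rewrite sqr_normcE !complexE; ring.
Qed.

End dirichlet_tools.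

(** * The two successive limits *)

Section dirichlet.
Context {R : realType} {n : nat} (Omega : set 'rV[R]_n).
Variables (V : 'rV[R]_n -> R) (m : R) (a b c : R[i]).
Variables (u1 u2 F : 'rV[R]_n -> R[i]).
Hypotheses (oO : open Omega) (m0 : 0 < m) (hV : Linfty_loc Omega V).
Hypotheses (hu1 : H1 Omega u1) (hu1m : Lp Omega (m + 1) u1)
  (hu2 : H1 Omega u2) (hu2m : Lp Omega (m + 1) u2)
  (hVu1 : Lp Omega 2 (Vmul V u1)) (hVu2 : Lp Omega 2 (Vmul V u2)).
Hypotheses (s1 : distributional_solution Omega V m a b c F u1)
  (s2 : distributional_solution Omega V m a b c F u2).
Variable lam : R[i].
Local Notation mu := (lebesgue_rV n).

Let mO : measurable Omega := open_measurable_rV oO.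
Let w x := u1 x - u2 x.
Let p i x := wpartial Omega i u1 x - wpartial Omega i u2 x.
Let G := difference_fun V m a b c u1 u2.
Let nl := normc lam.

Let lp i : Lp Omega 2 (p i).
Proof.
have [_ l1] := H1_wpartial oO i hu1; have [_ l2] := H1_wpartial oO i hu2.
exact: (LpB mO (ler0n _ 2) l1 l2).
Qed.

Let cp i : cmeasurable_fun Omega (p i) := (lp i).1.
Let cw : cmeasurable_fun Omega w := (Lp2_sub oO hu1 hu2).1.
Let lG : L1_loc Omega G := L1_loc_difference a b c oO m0 hV hu1 hu1m hu2 hu2m hVu1 hVu2.
Let cG : cmeasurable_fun Omega G := lG.1.

(** The real part of [lam^*] times the identity tested with the cutoff, before integration. The
    derivatives are separate arguments because in the limit [z] becomes [w] and [dz] becomes [p],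
    which is only a weak derivative. *)
Let integrand (e : R) (z : 'rV[R]_n -> R[i]) (dz : 'I_n -> 'rV[R]_n -> R[i])
    (y : 'rV[R]_n -> R[i]) (dy : 'I_n -> 'rV[R]_n -> R[i]) (x : 'rV[R]_n) : R :=
  \sum_(i < n) (theta e (z x) (y x) * Re (lam^* * (p i x * (dz i x)^*)) +
    dtheta e (z x) (y x) (dz i x) (dy i x) * Re (lam^* * (p i x * (z x)^*))) +
  theta e (z x) (y x) * Re (lam^* * (G x * (z x)^*)).

Let measurable_integrand e z dz y dy : 0 < e ->
  cmeasurable_fun Omega z -> (forall i, cmeasurable_fun Omega (dz i)) ->
  cmeasurable_fun Omega y -> (forall i, cmeasurable_fun Omega (dy i)) ->
  measurable_fun Omega (integrand e z dz y dy).
Proof.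
move=> e0 mz mdz my mdy; have mt := measurable_theta e0 mz my.
apply: measurable_funD.
  apply: measurable_sum => i; apply: measurable_funD.
    by apply: measurable_funM mt _; exact: measurable_Re_conj (cp i) (mdz i).
  apply: measurable_funM; first exact: measurable_dtheta e0 mz my (mdz i) (mdy i).
  exact: measurable_Re_conj (cp i) mz.
by apply: measurable_funM mt _; exact: measurable_Re_conj cG mz.
Qed.

Let Re_cutoff_grad (s t : R) (q dq r : R[i]) :
  s * Re (lam^* * (q * dq^*)) + t * Re (lam^* * (q * r^*)) =
  Re (lam^* * (q * (s%:C * dq^* + t%:C * r^*))).
Proof. by rewrite !complexE; ring. Qed.

Let Re_cutoff (s : R) (q r : R[i]) :
  s * Re (lam^* * (q * r^*)) = Re (lam^* * (q * (s%:C * r^*))).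
Proof. by rewrite !complexE; ring. Qed.

Let cutoff_identity e z y : 0 < e -> test_function Omega z -> test_function Omega y ->
  \int[mu]_(x in Omega) integrand e z (fun i => cpartial i z) y (fun i => cpartial i y) x = 0.
Proof.
move=> e0 tz ty; have tc := test_cutoff e0 tz ty.
have sz := test_csmooth tz; have sy := test_csmooth ty.
have := dirichlet_identity oO m0 hV hu1 hu1m hu2 hu2m hVu1 hVu2 s1 s2 tc.
rewrite -/G => idt.
have pi_int i : cintegrable Omega (fun x => p i x * cpartial i (cutoff e z y) x).
  apply: (cintegrable_test oO _ (test_cpartial i tc)).
  exact: (L1_loc_Lp2 mO oO (lp i)).
have G_int := cintegrable_test oO lG tc.
have S_int := cintegrable_sum mO (index_enum 'I_n) pi_int.
have := congr1 (fun s => Re (lam^* * s)) idt; rewrite mulr0 => h.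
rewrite -[RHS]h.
rewrite -(cintegral_sum mO (index_enum 'I_n) pi_int) -(cintegralD mO S_int G_int).
rewrite -(cintegralZ mO _ (cintegrableD mO S_int G_int)).
apply: eq_Rintegral => x _.
rewrite mulrDr ReD mulr_sumr Re_sum; congr (_ + _).
  apply: eq_bigr => i _; rewrite (cpartial_cutoff i x e0 sz sy).
  exact: Re_cutoff_grad.
exact: Re_cutoff.
Qed.

Let Re_mul_le (A B : R[i]) : `|Re (lam^* * (A * B^*))| <= nl * (normc A * normc B).
Proof.
by rewrite (le_trans (Re_le_normc _))// !ComplexField.Normc.normcM !normcJ.
Qed.

Let mul_le_sqr (s t : R) : s * t <= s ^+ 2 + t ^+ 2.
Proof. by have := sqr_ge0 (s - t); have := sqr_ge0 (s + t); nra. Qed.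

Let sqr_le_gap (A B : R[i]) (S : R) : normc (A - B) ^+ 2 <= S ->
  normc B ^+ 2 <= 2 * normc A ^+ 2 + 2 * S.
Proof.
rewrite !sqr_normcE !complexE.
have := sqr_ge0 ((Re A - Re B) + Re A); have := sqr_ge0 ((Im A - Im B) + Im A).
nra.
Qed.

Let nl0 : 0 <= nl := normc_ge0 lam.

(** Let [q], [r], [s] be the moduli of [A], [dz], [dy]. The two bounds on the cutoff give
    [3 q r + q s <= 4 q^2 + 3 r^2 + s^2], and [r^2 <= 2 q^2 + 2 S] then produces 10 and 6. Neither
    [z] nor [e] is left. *)
Let term_le e (A dz z y dy : R[i]) (S : R) : 0 < e -> normc (A - dz) ^+ 2 <= S ->
  `|theta e z y * Re (lam^* * (A * dz^*)) +
    dtheta e z y dz dy * Re (lam^* * (A * z^*))| <=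
  nl * (10 * normc A ^+ 2 + 6 * S + normc dy ^+ 2).
Proof.
move=> e0 hS; have hdz := sqr_le_gap hS.
have h1 : `|theta e z y * Re (lam^* * (A * dz^*))| <= nl * (normc A * normc dz).
  rewrite normrM (ger0_norm (theta_ge0 z y e0)) -[leRHS]mul1r.
  by apply: ler_pM => //; [exact: theta_ge0|exact: theta_le1].
have h2 : `|dtheta e z y dz dy * Re (lam^* * (A * z^*))| <=
    nl * (normc A * (normc dy + 2 * normc dz)).
  rewrite normrM; apply: le_trans (ler_wpM2l (normr_ge0 _) (Re_mul_le A z)) _.
  have -> : `|dtheta e z y dz dy| * (nl * (normc A * normc z)) =
    nl * (normc A * (`|dtheta e z y dz dy| * normc z)) by ring.
  apply: ler_wpM2l => //; apply: ler_wpM2l; first exact: normc_ge0.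
  exact: dtheta_mul_le.
apply: le_trans (ler_normD _ _) _; apply: le_trans (lerD h1 h2) _.
rewrite -mulrDr; apply: ler_wpM2l => //.
have := mul_le_sqr (normc A) (normc dz); have := mul_le_sqr (normc A) (normc dy).
have := normc_ge0 A; move: hdz; set q := normc A; set r := normc dz; set s := normc dy.
have := sqr_ge0 q; nra.
Qed.

(** Only [z] moves: the support of [y] stays fixed, and [G] is integrable over it. Integrability of
    the limit is recorded because its integral is compared with another one afterwards. *)
Let limit_identity e z S y : 0 < e -> (forall k, test_function Omega (z k)) ->
  test_function Omega y -> mu.-integrable Omega (EFin \o S) ->
  {ae mu, forall x, Omega x -> forall k i, normc (p i x - cpartial i (z k) x) ^+ 2 <= S x} ->
  {ae mu, forall x, Omega x -> ccvg (fun k => z k x) (w x) /\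
      forall i, ccvg (fun k => cpartial i (z k) x) (p i x)} ->
  mu.-integrable Omega (EFin \o (integrand e w p y (fun i => cpartial i y))) /\
  \int[mu]_(x in Omega) integrand e w p y (fun i => cpartial i y) x = 0.
Proof.
move=> e0 tz ty Si zS zcv.
have cy := test_cmeasurable oO ty.
have cdy i := test_cmeasurable oO (test_cpartial i ty).
have cz k := test_cmeasurable oO (tz k).
have cdz k i := test_cmeasurable oO (test_cpartial i (tz k)).
(* The sum dominates the gradient terms. The last term dominates [nl |G| |y|], split into parts so
   that its integrability is that of [G] against the test function [y]. *)
pose g x := \sum_(i < n) nl * (10 * normc (p i x) ^+ 2 + 6 * S x + normc (cpartial i y x) ^+ 2) +
  nl * (`|Re (G x * y x)| + `|Im (G x * y x)|).
have gi : mu.-integrable Omega (EFin \o g).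
  apply: (rintD mO).
    apply: (rint_sum mO) => i; apply: (rintZ mO); apply: (rintD mO).
      apply: (rintD mO); apply: (rintZ mO) => //.
      by have [_] := (Lp2E mO _).1 (lp i).
    exact: rint_test_sqr oO (test_cpartial i ty).
  have [r1 r2] := cintegrable_test oO lG ty.
  exact: (rintZ mO nl (rintD mO (rint_norm r1) (rint_norm r2))).
have mI := measurable_integrand e0 cw cp cy cdy.
have mIk k := measurable_integrand e0 (cz k) (cdz k) cy cdy.
have cv : {ae mu, forall x, Omega x ->
    integrand e (z k) (fun i => cpartial i (z k)) y (fun i => cpartial i y) x @[k --> \oo] -->
    integrand e w p y (fun i => cpartial i y) x}.
  apply: filterS zcv => x h Ox; have [zx dzx] := h Ox.
  have d0 : nsq (w x) + nsq (y x) + e != 0.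
    by rewrite gt_eqF// ltr_wpDl// addr_ge0// nsq_ge0.
  have ecv : (fun _ : nat => e) k @[k --> \oo] --> e by exact: cvg_cst.
  have tcv : theta e (z k x) (y x) @[k --> \oo] --> theta e (w x) (y x).
    exact: (cvg_theta ecv zx (ccvg_cst (y x)) d0).
  apply: cvgD; last by apply: cvgM; [exact: tcv|exact: cvg_Re_conj2].
  apply: cvg_sum_seq => i; apply: cvgD; first by apply: cvgM; [exact: tcv|exact: cvg_Re_conj2].
  apply: cvgM; last exact: cvg_Re_conj2.
  exact: (cvg_dtheta ecv zx (ccvg_cst (y x)) (dzx i) (ccvg_cst (cpartial i y x)) d0).
have bd : {ae mu, forall x, forall k, Omega x ->
    `|integrand e (z k) (fun i => cpartial i (z k)) y (fun i => cpartial i y) x| <= g x}.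
  apply: filterS zS => x h k Ox.
  apply: le_trans (ler_normD _ _) _; apply: lerD.
    apply: le_trans (ler_norm_sum _ _ _) _; apply: ler_sum => i _.
    exact: term_le e0 (h Ox k i).
  rewrite normrM (ger0_norm (theta_ge0 _ _ e0)).
  apply: le_trans (ler_wpM2l (theta_ge0 _ _ e0) (Re_mul_le _ _)) _.
  have -> (t q r : R) : t * (nl * (q * r)) = nl * (q * (t * r)) by ring.
  apply: ler_wpM2l => //.
  apply: le_trans (ler_wpM2l (normc_ge0 _) (theta_mul_le _ _ e0)) _.
  by rewrite -ComplexField.Normc.normcM; exact: normc_le_ReIm.
have [Fi Fcv] := rint_dominated_cvg mO mIk mI cv gi bd.
split=> //; move: Fcv.
under eq_fun do rewrite (cutoff_identity e0 (tz _) ty).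
by move=> /(cvg_unique _ (@cvg_cst _ _ _ _ _)) => /(_ (@Rhausdorff R)).
Qed.

Let E x := energy m a b c lam (u1 x) (u2 x) (V x).

Let EE x : E x = Re (lam^* * (G x * (w x)^*)).
Proof. by []. Qed.

(** Here the derivative of [z] is already its limit [A]. With [q = |A|] and [s = |dy|], the bound
    [q (s + 2 q) <= 3 q^2 + s^2] and [s^2 <= 2 q^2 + 2 S] give 5 and 2. *)
Let cross_le e (A dy z y : R[i]) (S : R) : 0 < e -> normc (A - dy) ^+ 2 <= S ->
  `|dtheta e z y A dy * Re (lam^* * (A * z^*))| <= nl * (5 * normc A ^+ 2 + 2 * S).
Proof.
move=> e0 hS; have hdy := sqr_le_gap hS.
rewrite normrM; apply: le_trans (ler_wpM2l (normr_ge0 _) (Re_mul_le A z)) _.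
have -> : `|dtheta e z y A dy| * (nl * (normc A * normc z)) =
  nl * (normc A * (`|dtheta e z y A dy| * normc z)) by ring.
apply: ler_wpM2l => //.
apply: le_trans (ler_wpM2l (normc_ge0 A) (dtheta_mul_le z y A dy e0)) _.
have := mul_le_sqr (normc A) (normc dy).
by move: hdy; set q := normc A; set s := normc dy; nra.
Qed.

Hypotheses (lam0 : 0 <= Re lam)
  (E0 : forall z1 z2 v, 0 <= energy m a b c lam z1 z2 v)
  (h1 : H10 Omega u1) (h2 : H10 Omega u2).

Lemma dirichlet_energy_le0 : \int[mu]_(x in Omega) E x <= 0.
Proof.
have [z [S [tz Si zS zcv]]] := difference_approx oO h1 h2.
(* The parameter must tend to 0 together with the second approximation: for a fixed
   parameter the cross terms would not vanish in the limit. *)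
pose e (k : nat) : R := k.+1%:R^-1.
have e0 k : 0 < e k by rewrite invr_gt0.
have Ei : mu.-integrable Omega (EFin \o E).
  exact: rint_energy oO m0 hu1 hu1m hu2 hu2m hVu1 hVu2 lam.
pose H k x := \sum_(i < n) dtheta (e k) (w x) (z k x) (p i x) (cpartial i (z k) x) *
    Re (lam^* * (p i x * (w x)^*)) + theta (e k) (w x) (z k x) * E x.
pose g x := \sum_(i < n) nl * (5 * normc (p i x) ^+ 2 + 2 * S x) + E x.
have gi : mu.-integrable Omega (EFin \o g).
  apply: (rintD mO) => //; apply: (rint_sum mO) => i; apply: (rintZ mO).
  apply: (rintD mO); apply: (rintZ mO) => //.
  by have [_] := (Lp2E mO _).1 (lp i).
have cz k := test_cmeasurable oO (tz k).
have cdz k i := test_cmeasurable oO (test_cpartial i (tz k)).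
have mH k : measurable_fun Omega (H k).
  apply: measurable_funD.
    apply: measurable_sum => i; apply: measurable_funM.
      exact: measurable_dtheta (e0 k) cw (cz k) (cp i) (cdz k i).
    exact: measurable_Re_conj (cp i) cw.
  by apply: measurable_funM (measurable_theta (e0 k) cw (cz k)) _; exact: rint_measurable Ei.
have Hg : {ae mu, forall x, forall k, Omega x -> `|H k x| <= g x}.
  apply: filterS zS => x h k Ox.
  apply: le_trans (ler_normD _ _) _; apply: lerD.
    apply: le_trans (ler_norm_sum _ _ _) _; apply: ler_sum => i _.
    exact: cross_le (e0 k) (h Ox k i).
  rewrite normrM (ger0_norm (theta_ge0 _ _ (e0 k))) (ger0_norm (E0 _ _ _)) -[leRHS]mul1r.
  by apply: ler_wpM2r; [exact: E0|exact: theta_le1].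
have Hi k : mu.-integrable Omega (EFin \o H k).
  by apply: (rint_le_ae mO (mH k) _ gi); apply: filterS Hg => x h; exact: h.
have H_le0 k : \int[mu]_(x in Omega) H k x <= 0.
  have [Ii I0] := limit_identity (e0 k) tz (tz k) Si zS zcv.
  rewrite -I0; apply: (le_Rintegral mO (Hi k) Ii) => x _.
  (* [H k] is [integrand] without the nonnegative terms [theta * Re lam * |p i|^2]. *)
  rewrite /H /integrand big_split/= -addrA lerDr sumr_ge0// => i _.
  rewrite mulr_ge0 ?theta_ge0//.
  have -> (A : R[i]) : Re (lam^* * (A * A^*)) = Re lam * normc A ^+ 2.
    by rewrite sqr_normcE !complexE; ring.
  by rewrite mulr_ge0// sqr_ge0.
have Hcv : {ae mu, forall x, Omega x -> H k x @[k --> \oo] --> 2^-1 * E x}.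
  apply: filterS zcv => x h Ox; have [zx dzx] := h Ox.
  (* Where [w] vanishes the limiting denominator is 0 and [theta] need not converge, but every term
     of [H k] contains the factor [w^*]. *)
  have [w0|w0] := eqVneq (w x) 0.
    have Ex0 : E x = 0 by rewrite EE w0 conjC0 !mulr0.
    rewrite (_ : (fun k => _) = fun=> 0) ?Ex0 ?mulr0; first exact: cvg_cst.
    apply/funext => k; rewrite /H Ex0 mulr0 addr0 big1// => i _.
    by rewrite w0 conjC0 2!mulr0; exact: mulr0.
  have nw : 0 < nsq (w x).
    rewrite lt_neqAle nsq_ge0 andbT eq_sym nsqE sqrf_eq0.
    by apply: contra w0 => /eqP/ComplexField.Normc.eq0_normc ->.
  have d0 : nsq (w x) + nsq (w x) + 0 != 0 by rewrite addr0 gt_eqF// addr_gt0.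
  have ecv : e k @[k --> \oo] --> (0 : R) by exact: cvg_harmonic.
  have t2 : theta 0 (w x) (w x) = 2^-1.
    by rewrite /theta; field; rewrite addr0 in d0.
  rewrite -[X in _ --> X]add0r -t2; apply: cvgD; last first.
    by apply: cvgM; [exact: (cvg_theta ecv (ccvg_cst (w x)) zx d0)|exact: cvg_cst].
  rewrite [X in _ --> X](_ : _ = \sum_(i < n) (0 : R)); last by rewrite big1_eq.
  apply: cvg_sum_seq => i.
  (* For [e = 0] and equal arguments the two products in the numerator of [dtheta] coincide. *)
  have dt0 : dtheta 0 (w x) (w x) (p i x) (p i x) = 0.
    by rewrite /dtheta addr0 [nsq _ * rdot _ _]mulrC subrr mulr0 mul0r.
  rewrite -(mul0r (Re (lam^* * (p i x * (w x)^*)))) -dt0.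
  apply: cvgM; last exact: cvg_cst.
  exact: (cvg_dtheta ecv (ccvg_cst (w x)) zx (ccvg_cst (p i x)) (dzx i) d0).
have mhE : measurable_fun Omega (fun x => 2^-1 * E x).
  exact: rint_measurable (rintZ mO 2^-1 Ei).
have [_ lim] := rint_dominated_cvg mO mH mhE Hcv gi Hg.
have : \int[mu]_(x in Omega) (2^-1 * E x) <= 0.
  by apply: (cvgr_to_le lim); apply: nearW.
by rewrite RintegralZl// pmulr_rle0// invr_gt0.
Qed.

End dirichlet.

Theorem theorem2p10 (R : realType) (N : nat) (Omega : set 'rV[R]_N)
    (V : 'rV[R]_N -> R) (m : R) (a b c : R[i])
    (F u1 u2 : 'rV[R]_N -> R[i])
    (hOmega : open Omega) (hOmega0 : Omega !=set0)
    (hV : Linfty_loc Omega V)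
    (hm0 : 0 < m) (hm1 : m < 1)
    (habc :
      [\/ [/\ a != 0, 0 <= complex.Re a, 0 <= complex.Re (a * b^*) & 0 <= complex.Re (a * c^*)],
          [/\ b != 0, 0 <= complex.Re b, exists2 k : R, 0 <= k & a = k%:C * b
            & 0 <= complex.Re (b * c^*)]
        | [/\ c != 0, 0 <= complex.Re c, exists2 k : R, 0 < k & a = k%:C * c
            & 0 <= complex.Re (b * c^*)]])
    (hF : L1_loc Omega F)
    (hu1 : H1 Omega u1) (hu1m : Lp Omega (m + 1) u1)
    (hu2 : H1 Omega u2) (hu2m : Lp Omega (m + 1) u2)
    (hsol :
      (dirichlet_solution Omega V m a b c F u1 /\
       dirichlet_solution Omega V m a b c F u2) \/
      (C1_boundary Omega /\
       exists ell : ('rV[R]_N -> R[i]) -> R,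
         [/\ extends_source Omega V m F ell,
             neumann_solution Omega V m a b c ell u1
           & neumann_solution Omega V m a b c ell u2]))
    (hVu1 : Lp Omega 2 (Vmul V u1)) (hVu2 : Lp Omega 2 (Vmul V u2)) :
  ae_eq_on Omega u1 u2.
Proof.
have mO := open_measurable_rV hOmega.
have [lam lam0 eP] := exists_multiplier hm0 habc.
apply: (ae_eq_of_energy_le0 hOmega hm0 hu1 hu1m hu2 hu2m hVu1 hVu2 eP).
case: hsol => [[[h1 s1] [h2 s2]]|[_ [ell [_ s1 s2]]]].
  exact: (dirichlet_energy_le0 hOmega hm0 hV hu1 hu1m hu2 hu2m hVu1 hVu2 s1 s2 lam0
    (fun z1 z2 v => (eP z1 z2 v).1) h1 h2).
exact: (neumann_energy_le0 hOmega hm0 hu1 hu1m hu2 hu2m hVu1 hVu2 lam0 s1 s2).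
Qed.
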